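(* There exists a family of constants $(\varepsilon_\delta)_{\delta \ge 1}$, with $\varepsilon_\delta>0$ depending only on $\delta$, such that both of the following hold. (a) For every real $\delta\ge 1$, a smallest weight Hamiltonian cycle in an $n$-vertex edge-weighted undirected graph of average degree at most $\delta$ can be found in $\mathcal{O}^\star(2^{(1-\varepsilon_\delta)n})$ time and exponential space. (b) For every real $d$ with $2d\ge 1$, given an $n$-vertex undirected graph $G$ of average degree at most $d$, one can count the number of perfect matchings in $G$ in $\mathcal{O}^\star(2^{(1-\varepsilon_{2d})n/2})$ time and exponential space.
   Context: Graphs are finite. The average degree of an $n$-vertex graph $G=(V,E)$ is $\frac1n\sum_{v\in V}\deg(v) = 2|E|/n$. Edge weights are given by a function $c:E\to\mathbb{R}_+$, and the weight of a cycle is the sum of the weights of its edges; if no Hamiltonian cycle exists the algorithm in (a) reports this. The notation $\mathcal{O}^\star(\cdot)$ suppresses factors polynomial in the input size. ''Exponential space'' means that the space used is not restricted to be polynomial. *)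

(* Defs.v *)
From HB Require Import structures.
From mathcomp Require Import all_boot all_order all_algebra.
From mathcomp Require Import reals exp.

Set Implicit Arguments.
Unset Strict Implicit.
Unset Printing Implicit Defensive.

Import Order.TTheory GRing.Theory Num.Theory.

Local Open Scope nat_scope.

(** * Graphs *)

(* An edge is a two-element set of vertices, so graphs are simple. *)
Record graph (n : nat) := Graph {
  edges : {set {set 'I_n}};
  edges_card2 : forall e, e \in edges -> #|e| = 2
}.

Section Graph.
Variables (n : nat) (G : graph n).

Definition adj : rel 'I_n := fun u v => [set u; v] \in edges G.

Definition deg (v : 'I_n) : nat := #|[set e in edges G | v \in e]|.

Definition avg_degree (R : numFieldType) : R :=
  ((\sum_(v < n) deg v)%:R / n%:R)%R.

(* A Hamiltonian cycle is given by the cyclic sequence of its vertices; with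
   fewer than three vertices, a closed walk through all of them is not a
   cycle. *)
Definition ham_cycle (p : seq 'I_n) : bool :=
  [&& 3 <= n, uniq p, size p == n & cycle adj p].

Definition cycle_edges (p : seq 'I_n) : {set {set 'I_n}} :=
  [set [set v; next p v] | v in p].

Definition cycle_weight (R : numDomainType) (c : {set 'I_n} -> R)
    (p : seq 'I_n) : R :=
  (\sum_(e in cycle_edges p) c e)%R.

Definition smallest_ham_cycle (R : numDomainType) (c : {set 'I_n} -> R)
    (p : seq 'I_n) : Prop :=
  ham_cycle p /\
  forall q, ham_cycle q -> (cycle_weight c p <= cycle_weight c q)%R.

Definition perfect_matching (M : {set {set 'I_n}}) : bool :=
  (M \subset edges G) && [forall v, #|[set e in M | v \in e]| == 1].

Definition num_perfect_matchings : nat :=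
  #|[set M : {set {set 'I_n}} | perfect_matching M]|.

End Graph.

(** * Machine model

   A random access machine with logarithmic cost for natural numbers, together
   with real cells, as needed for real edge weights.  It is presented as a
   while language over a fixed number of unbounded arrays, which a program
   refers to by (static) number.  Real numbers can only be copied, added and
   compared, at unit cost; as the only real constant is 0, every real in memory is
   a sum of input weights. *)

Definition bitlen (x : nat) : nat := (trunc_log 2 x).+1.

Inductive binop := Add | Sub | Mul | Div | Mod.

Inductive nexpr :=
  | Lit of nat
  | NGet of nat & nexpr              (* array number, index *)
  | Op of binop & nexpr & nexpr.

Inductive rexpr :=
  | RZero
  | RGet of nat & nexpr
  | RAdd of rexpr & rexpr.

Inductive cond :=
  | NLe of nexpr & nexpr
  | RLe of rexpr & rexpr.

Inductive cmd :=
  | Skip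
  | NSet of nat & nexpr & nexpr      (* array number, index, value *)
  | RSet of nat & nexpr & rexpr
  | Seq of cmd & cmd
  | If of cond & cmd & cmd
  | While of cond & cmd.

Record state (R : Type) := State {
  nmem : nat -> nat -> nat;
  rmem : nat -> nat -> R
}.

Definition upd T (m : nat -> nat -> T) (a i : nat) (x : T) : nat -> nat -> T :=
  fun b j => if (b == a) && (j == i) then x else m b j.

Definition binop_eval (o : binop) (x y : nat) : nat :=
  match o with
  | Add => x + y
  | Sub => x - y
  | Mul => x * y
  | Div => x %/ y
  | Mod => x %% y
  end.

Section Semantics.
Variable R : numDomainType.
Implicit Types s : state R.

Fixpoint nval s (e : nexpr) : nat :=
  match e with
  | Lit k => k
  | NGet a i => nmem s a (nval s i)
  | Op o e1 e2 => binop_eval o (nval s e1) (nval s e2)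
  end.

Fixpoint rval s (e : rexpr) : R :=
  match e with
  | RZero => 0%R
  | RGet a i => rmem s a (nval s i)
  | RAdd e1 e2 => (rval s e1 + rval s e2)%R
  end.

Definition cval s (b : cond) : bool :=
  match b with
  | NLe e1 e2 => nval s e1 <= nval s e2
  | RLe e1 e2 => (rval s e1 <= rval s e2)%R
  end.

(* Every subexpression is charged the bit length of its value; this covers the
   operands and the result of each operation, and the addresses used. *)
Fixpoint ncost s (e : nexpr) : nat :=
  bitlen (nval s e) +
  match e with
  | Lit _ => 0
  | NGet _ i => ncost s i
  | Op _ e1 e2 => ncost s e1 + ncost s e2
  end.

Fixpoint rcost s (e : rexpr) : nat :=
  1 +
  match e with
  | RZero => 0
  | RGet _ i => ncost s i
  | RAdd e1 e2 => rcost s e1 + rcost s e2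
  end.

Definition ccost s (b : cond) : nat :=
  1 +
  match b with
  | NLe e1 e2 => ncost s e1 + ncost s e2
  | RLe e1 e2 => rcost s e1 + rcost s e2
  end.

(* [exec c s s' t]: started in [s], the program [c] halts in [s'] after
   time [t]. *)
Inductive exec : cmd -> state R -> state R -> nat -> Prop :=
  | ExecSkip s : exec Skip s s 1
  | ExecNSet s a i e :
      exec (NSet a i e) s
        (State (upd (nmem s) a (nval s i) (nval s e)) (rmem s))
        (1 + ncost s i + ncost s e)
  | ExecRSet s a i e :
      exec (RSet a i e) s
        (State (nmem s) (upd (rmem s) a (nval s i) (rval s e)))
        (1 + ncost s i + rcost s e)
  | ExecSeq s s1 s2 c1 c2 t1 t2 :
      exec c1 s s1 t1 -> exec c2 s1 s2 t2 -> exec (Seq c1 c2) s s2 (t1 + t2)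
  | ExecIf s s' b c1 c2 t :
      exec (if cval s b then c1 else c2) s s' t ->
      exec (If b c1 c2) s s' (ccost s b + t)
  | ExecWhileTrue s s1 s2 b c t1 t2 :
      cval s b -> exec c s s1 t1 -> exec (While b c) s1 s2 t2 ->
      exec (While b c) s s2 (ccost s b + t1 + t2)
  | ExecWhileFalse s b c :
      ~~ cval s b -> exec (While b c) s s (ccost s b).

End Semantics.

(** * Input and output conventions

   Natural-number arrays: cell 0 of array 0 holds [n], array 1 holds the
   adjacency matrix, array 2 receives the output.  Real array 0 holds the weight
   matrix.  Matrices are stored row by row; all other cells are initially 0. *)

Definition matrix_cells (T : Type) (x0 : T) (n : nat) (f : 'I_n -> 'I_n -> T)
    (k : nat) : T :=
  match insub (k %/ n), insub (k %% n) with
  | Some i, Some j => f i j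
  | _, _ => x0
  end.

Definition graph_cells (n : nat) (G : graph n) (a : nat) : nat -> nat :=
  match a with
  | 0 => fun k => if k == 0 then n else 0
  | 1 => matrix_cells 0 (fun i j => nat_of_bool (adj G i j))
  | _ => fun _ => 0
  end.

Definition graph_input (R : numDomainType) (n : nat) (G : graph n) : state R :=
  State (graph_cells G) (fun _ _ => 0%R).

Definition weighted_graph_input (R : numDomainType) (n : nat) (G : graph n)
    (c : {set 'I_n} -> R) : state R :=
  State (graph_cells G)
    (fun a => if a == 0
              then matrix_cells 0%R
                     (fun i j => if adj G i j then c [set i; j] else 0%R)
              else fun _ => 0%R).

Definition graph_size (n : nat) : nat := bitlen n + n * n.

(* A real number in the input counts as one unit. *)
Definition weighted_graph_size (n : nat) : nat := graph_size n + n * n.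

Definition output (R : Type) (s : state R) : nat -> nat := nmem s 2.

Definition outputs_smallest_ham_cycle (R : numDomainType) (n : nat)
    (G : graph n) (c : {set 'I_n} -> R) (s : state R) : Prop :=
  (output s 0 = 1 /\
   exists2 p : seq 'I_n, smallest_ham_cycle G c p &
     [seq output s i | i <- iota 1 n] = [seq val v | v <- p])
  \/ (output s 0 = 0 /\ forall p : seq 'I_n, ~~ ham_cycle G p).

Definition solves_within (R : numDomainType) (prog : cmd) (s0 : state R) (T : R)
    (correct : state R -> Prop) : Prop :=
  exists (s : state R) (t : nat),
    [/\ exec prog s0 s t, (t%:R <= T)%R & correct s].

(* The bounds hidden by the O-star notation are those of the form
   [Ostar_factor C k size], with [C] and [k] independent of the instance. *)
Definition Ostar_factor (R : numDomainType) (C k size : nat) : R :=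
  ((C * size ^ k)%N%:R)%R.

(* Main.v *)
Require Import Defs.
From mathcomp Require Import all_boot all_order all_algebra.
From mathcomp Require Import zify ring lra.
From mathcomp Require Import boolp reals sequences exp.

(** Both problems are solved by dynamic programming over the reachable states only.

    For the travelling salesman problem, the states are those of Held and Karp: the set
    [X] of vertices visited by a path and the last vertex [v] of the path.  For perfect
    matchings, the vertices are grouped arbitrarily into pairs; the vertex [v] to be
    matched next is always the partner of the one matched last, so that the matching is
    revealed along alternating cycles, each new cycle starting at the least untouched
    pair.  Here [X] is the set of touched pairs, a subset of a graph with half as many
    vertices, hence with average degree at most [2 d].

    In both cases every element of [X] outside an initial segment [0..s] (which is
    contained in [X]) has a neighbour in [X], its predecessor, and predecessors are
    distinct.  In a graph of average degree at most [d] there is a threshold [D] such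
    that the number [h] of vertices of degree more than [D] is much smaller than [N / D]
    (otherwise the sum of the degrees, cut into dyadic levels, would be too large), and
    there are about [N / D] vertices [a] of degree at most [2 d] with disjoint closed
    neighbourhoods [B a], where vertices of degree more than [D] are disregarded.  At
    most [h] of these [a] can satisfy [X :&: B a = [set a]], as the predecessor of [a]
    is then one of the [h] vertices, whereas a random set satisfies this with
    probability [2 ^- #|B a|], independently for distinct [a].  So only
    [2 ^ ((1 - eps) N)] sets [X] are reachable. *)

Set Implicit Arguments.
Unset Strict Implicit.
Unset Printing Implicit Defensive.

Import Order.TTheory GRing.Theory Num.Theory.

Local Open Scope ring_scope.

(** * Counting traced sets *)

(** The obstacle is the vertices of large degree: a block containing one could meet too many other
    blocks, while removing them from the blocks allows up to [h] blocks to match. These are absorbed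
    by an exponential moment: a reachable set matches at most [h] patterns, so it contributes at
    least [2 ^- h] to the sum over all sets of 2 to the minus number of matched patterns; this sum
    factorises over the disjoint blocks and is at most [2 ^ N * (1 - x) ^ #|A|] with
    [x = 2 ^- (2 d + 2)]. The exponent left is [N + h - x #|A|], so [h] must be at most half of
    [x #|A|]. As [#|A|] is only known to be of order [N / D], smallness of [h] relative to [N] would
    not do; averaging over constantly many dyadic thresholds yields a suitable [D] bounded in terms
    of [d] alone. The family of reachable sets is never computed separately: breadth-first search
    meets only reachable states, and as each proper transition adds one bit to [X], its queue is
    sorted by the number of bits. Read backwards, the queue is an evaluation order for the dynamic
    program. *)

Lemma exists_independent (T : finType) (L : {set T}) (e : rel T) (q : nat) :
  symmetric e -> reflexive e ->
  {in L, forall a, #|[set b in L | e a b]| <= q}%N ->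
  exists A : {set T}, [/\ A \subset L,
    {in A &, forall a b, e a b -> a = b} & (#|L| <= q * #|A|)%N].
Proof.
move=> esym erefl hq.
pose P (A : {set T}) := (A \subset L) &&
  [forall a in A, forall b in A, e a b ==> (a == b)].
have P0 : P set0.
  by rewrite /P sub0set; apply/forall_inP => a; rewrite inE.
have [A /maxsetP[/andP[AL /forall_inP PA] Amax] _] := maxset_exists P0.
exists A; split=> //.
  by move=> a b aA bA eab; apply/eqP; move: (PA a aA) => /forall_inP/(_ b bA)/implyP; apply.
(* A maximal independent set dominates [L]: an element related to no member of [A] could be added to
   [A]. *)
have sub : L \subset \bigcup_(a in A) [set b in L | e a b].
  apply/subsetP => b bL; apply/bigcupP.
  have [/existsP[a /andP[aA eab]]|nex] := boolP [exists a, (a \in A) && e a b].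
    by exists a; rewrite // inE bL.
  have nA a : a \in A -> ~~ e a b.
    by move=> aA; apply: contra nex => eab; apply/existsP; exists a; rewrite aA.
  suff bA : b \in A by exists b; rewrite // inE bL erefl.
  rewrite -(Amax (b |: A)) ?setU11 ?subsetUr // /P.
  apply/andP; split; first by rewrite subUset sub1set bL AL.
  apply/forall_inP => x; rewrite in_setU1 => /orP[/eqP->|xA];
    apply/forall_inP => y; rewrite in_setU1 => /orP[/eqP->|yA].
  - by apply/implyP.
  - by apply/implyP; rewrite esym (negPf (nA _ yA)).
  - by rewrite (negPf (nA _ xA)).
  - by move: (PA x xA) => /forall_inP/(_ y yA).
apply: leq_trans (subset_leq_card sub) _.
have card_cup : (#|\bigcup_(a in A) [set b in L | e a b]|
    <= \sum_(a in A) #|[set b in L | e a b]|)%N.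
  elim/big_rec2: _ => [|a n X _ IH]; first by rewrite cards0.
  by rewrite (leq_trans (leq_card_setU _ _)) // leq_add2l.
apply: leq_trans card_cup _.
rewrite mulnC -sum_nat_const; apply: leq_sum => a aA.
by apply: hq; apply: (subsetP AL).
Qed.

(* Averaging over all sets [X], each block matching its pattern with probability
   at least [2 ^- k], independently of the others. *)
Lemma sum_avoiding_patterns (R : numFieldType) (T : finType) (A : {set T})
    (B P : T -> {set T}) (k : nat) :
  {in A &, forall a b, ~~ [disjoint B a & B b] -> a = b} ->
  {in A, forall a, P a \subset B a} -> {in A, forall a, #|B a| <= k}%N ->
  \sum_(X : {set T}) 2%:R ^- #|[set a in A | X :&: B a == P a]|
    <= 2%:R ^+ #|T| * (1 - 2%:R ^- k.+1) ^+ #|A| :> R.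
Proof.
move Em : #|A| => m; elim: m A Em => [|m IH] A Em disj sub bnd.
  have -> : A = set0 by apply/eqP; rewrite -cards_eq0 Em.
  rewrite expr0 mulr1 -natrX -cardsT -card_powerset powersetT.
  rewrite (eq_bigr (fun _ => 1)) => [|X _]; first by rewrite sumr_const cardsT.
  suff -> : [set a in set0 | X :&: B a == P a] = set0 by rewrite cards0 expr0 invr1.
  by apply/setP => a; rewrite !inE.
have [a aA] : exists a, a \in A by apply/set0Pn; rewrite -card_gt0 Em.
set A' := A :\ a.
have sA : {subset A' <= A} by move=> x; rewrite inE => /andP[].
have Em' : #|A'| = m by move: Em; rewrite (cardsD1 a) aA => -[].
have {IH} := IH A' Em' (sub_in2 sA disj) (sub_in1 sA sub) (sub_in1 sA bnd).
pose g (X : {set T}) : R := 2%:R ^- #|[set b in A' | X :&: B b == P b]|.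
rewrite -[X in X <= _]/(\sum_X g X) => IH.
have g_ge0 X : 0 <= g X by rewrite invr_ge0 exprn_ge0 ?ler0n.
(* The remaining blocks are disjoint from [B a], so [g] does not see the trace of [X] on [B a]. *)
have gE (X Y : {set T}) : X :\: B a = Y :\: B a -> g X = g Y.
  move=> XY; rewrite /g; congr (_ ^- #|pred_of_set _|); apply/setP => b.
  rewrite !inE; apply: andb_id2l => /andP[bna bA].
  suff -> : X :&: B b = Y :&: B b by [].
  apply/setP => x; rewrite !inE; apply: andb_id2r => xb.
  have xa : x \notin B a.
    apply/negP => xa; case/eqP: bna; apply: disj => //.
    by apply/pred0Pn; exists x; rewrite /= xb.
  by move/setP: XY => /(_ x); rewrite !inE xa.
pose S := \sum_(X : {set T} | X :&: B a == P a) g X.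
(* The sets are classified by their trace on [B a]. Exchanging one trace for another keeps [g], so
   the [2 ^ #|B a|] classes have equal sums. *)
have sumE : \sum_X g X = 2%:R ^+ #|B a| * S.
  rewrite (partition_big (fun X => X :&: B a) (fun Y => Y \in powerset (B a)))
    => [|X _] /=; last by rewrite inE subsetIr.
  rewrite (eq_bigr (fun _ => S)) => [|Y].
    by rewrite sumr_const card_powerset -natrX mulr_natl.
  rewrite inE => YB.
  rewrite /S (reindex_onto (fun X => (X :\: B a) :|: Y) (fun X => (X :\: B a) :|: P a)) /=.
    apply: eq_big => [X|X /andP[_ /eqP XY]].
      have -> : ((X :\: B a) :|: Y) :&: B a = Y.
        apply/setP => x; rewrite !inE; have := subsetP YB x.
        by case: (x \in Y); case: (x \in B a); case: (x \in X) => //= /(_ isT).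
      rewrite eqxx /=.
      have PB := subsetP (sub a aA).
      apply/eqP/eqP => [<-|XP].
        apply/setP => x; rewrite !inE; have := PB x; have := subsetP YB x.
        case: (x \in Y); case: (x \in B a); case: (x \in P a); case: (x \in X) => //= H1 H2;
          by [have := H1 isT | have := H2 isT].
      apply/setP => x; move/setP: XP => /(_ x); rewrite !inE => <-.
      have := subsetP YB x.
      by case: (x \in Y); case: (x \in B a); case: (x \in X) => //= H1; have := H1 isT.
    apply: gE; apply/setP => x; rewrite !inE; have := subsetP YB x.
    by case: (x \in Y); case: (x \in B a); case: (x \in X) => //= /(_ isT).
  move=> X /eqP XY; apply/setP => x; move/setP: XY => /(_ x); rewrite !inE => <-.
  have := subsetP (sub a aA) x.
  by case: (x \in P a); case: (x \in B a); case: (x \in X) => //= H1; have := H1 isT.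
(* Matching at [a] halves the weight, and by [sumE] the sets matching there carry the fraction
   [2 ^- #|B a|] of the sum; the net factor is [1 - 2 ^- #|B a|.+1]. *)
have stepE X : 2%:R ^- #|[set b in A | X :&: B b == P b]|
    = g X - (if X :&: B a == P a then g X / 2%:R else 0) :> R.
  rewrite (cardsD1 a) !inE aA /=.
  have -> : [set b in A | X :&: B b == P b] :\ a = [set b in A' | X :&: B b == P b].
    by apply/setP => b; rewrite !inE andbA.
  case: ifP => _; last by rewrite add0n subr0.
  by rewrite add1n exprSr invfM -/(g X); field.
rewrite (eq_bigr _ (fun X _ => stepE X)) sumrB -big_mkcond /= -mulr_suml -/S.
have -> : \sum_X g X - S / 2%:R = (1 - 2%:R ^- #|B a|.+1) * \sum_X g X.
  rewrite mulrBl mul1r; congr (_ - _).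
  have nz : 2%:R ^+ #|B a| != 0 :> R by rewrite expf_neq0 ?pnatr_eq0.
  by rewrite sumE exprSr; field; rewrite nz.
have le1 j : 2%:R ^- j <= 1 :> R.
  by rewrite invf_le1 ?exprn_gt0 ?ltr0n // exprn_ege1 // ler1n.
rewrite [_ ^+ m.+1]exprS mulrCA; apply: ler_pM => //.
- by rewrite subr_ge0.
- by apply: sumr_ge0.
rewrite lerD2l lerN2 lef_pV2 ?posrE ?exprn_gt0 ?ltr0n //.
by rewrite ler_weXn2l ?ler1n // ltnS bnd.
Qed.

(** A geometric sum stays below twice its last term, and that term is below [x]. Thus a vertex can
    be charged at every dyadic threshold below its degree for only twice its degree. *)
Lemma sum_pow2_lt (K x : nat) : (\sum_(i < K | 2 ^ i < x) 2 ^ i <= 2 * x)%N.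
Proof.
have step (S P : nat) (b : bool) : (S < P -> S + (if b then P else 0) < 2 * P)%N.
  by case: b; lia.
have sum_all k : (\sum_(i < k | 2 ^ i < x) 2 ^ i < 2 ^ k)%N.
  elim: k => [|k IH]; first by rewrite big_ord0.
  by rewrite big_mkcond big_ord_recr /= -big_mkcond /= expnS step.
elim: K => [|K IH]; first by rewrite big_ord0.
rewrite big_mkcond big_ord_recr /= -big_mkcond /=; case: ifP => xK.
  by move: (sum_all K) xK; move: (\sum_(i < K | _) _)%N (2 ^ K)%N => S P; lia.
by rewrite addn0.
Qed.

(** * Degree statistics and disjoint low-degree blocks *)

Section DegreeBounds.
Variables (T : finType) (e : rel T).

Definition nbhd (v : T) : {set T} := [set u | e v u].

(** Averaging: the [K] terms [2 ^ i * h i] together count each vertex with at most twice its degree,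
    so they sum to at most [2 * d * #|T|] and one of them has at most a [K]-th of this. *)
Lemma exists_sparse_threshold (d K : nat) :
  (0 < K)%N -> (\sum_v #|nbhd v| <= d * #|T|)%N ->
  exists2 i, (i < K)%N &
    (K * (2 ^ i * #|[set v | (2 ^ i < #|nbhd v|)%N]|) <= 2 * d * #|T|)%N.
Proof.
move=> K_gt0 sumd.
pose h i := #|[set v | (2 ^ i < #|nbhd v|)%N]|.
have [/existsP[i hi]|nex] :=
  boolP [exists i : 'I_K, (K * (2 ^ i * h i) <= 2 * d * #|T|)%N]; first by exists i.
have big i : (i < K)%N -> (2 * d * #|T| < K * (2 ^ i * h i))%N.
  move=> iK; rewrite ltnNge; apply: contra nex => hi.
  by apply/existsP; exists (Ordinal iK).
have sum_h : (\sum_(i < K) 2 ^ i * h i <= 2 * d * #|T|)%N.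
  rewrite (eq_bigr (fun i : 'I_K => \sum_(v | 2 ^ i < #|nbhd v|) 2 ^ i)%N); last first.
    by move=> i _; rewrite sum_nat_const mulnC /h cardsE.
  rewrite (exchange_big_dep predT) //=.
  apply: (@leq_trans (\sum_v 2 * #|nbhd v|)%N).
    by apply: leq_sum => v _; apply: sum_pow2_lt.
  by rewrite -big_distrr /= -mulnA leq_mul2l sumd orbT.
have : (K * (2 * d * #|T|).+1 <= K * \sum_(i < K) 2 ^ i * h i)%N.
  rewrite big_distrr /= -[X in (X * _.+1)%N]card_ord -sum_nat_const.
  by apply: leq_sum => i _; apply: big.
by rewrite leq_mul2l ltnNge sum_h orbF eqn0Ngt K_gt0.
Qed.

(** Markov's inequality at twice the average. *)
Lemma half_low_degree (d : nat) :
  (0 < d)%N -> (\sum_v #|nbhd v| <= d * #|T|)%N ->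
  (#|T| <= 2 * #|[set v | (#|nbhd v| <= 2 * d)%N]|)%N.
Proof.
move=> d_gt0 sumd; set L := [set v | _].
have hi : (#|~: L| * (2 * d) <= d * #|T|)%N.
  apply: leq_trans sumd; rewrite -sum_nat_const [leqRHS](bigID (mem (~: L))) /=.
  apply: leq_trans (leq_addr _ _); apply: leq_sum => v.
  by rewrite !inE -ltnNge => /ltnW.
have : (#|~: L| * 2 <= #|T|)%N by move: hi d_gt0; clear; nia.
by have := cardsC L; lia.
Qed.

Hypotheses (e_sym : symmetric e) (e_irr : irreflexive e).

Definition low_block (D : nat) (a : T) : {set T} :=
  a |: [set u in nbhd a | (#|nbhd u| <= D)%N].

(** A block of a vertex of degree at most [2 * d] has at most [(2 * d).+1] vertices [w], and each
    [w] lies only in blocks around [w] or a neighbour of [w], at most [(2 * d).+2 * D] many. A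
    maximal disjoint family therefore loses only the product of these factors, and restricting to
    low degrees costs the factor 2. *)
Lemma exists_low_blocks (d D : nat) :
  (0 < d)%N -> (0 < D)%N -> (\sum_v #|nbhd v| <= d * #|T|)%N ->
  exists A : {set T},
    [/\ {in A, forall a, #|low_block D a| <= (2 * d).+1}%N,
        {in A &, forall a b, ~~ [disjoint low_block D a & low_block D b] -> a = b}
      & (#|T| <= 2 * ((2 * d).+1 * (2 * d).+2 * D) * #|A|)%N].
Proof.
move=> d_gt0 D_gt0 sumd.
pose L := [set v | (#|nbhd v| <= 2 * d)%N].
have blk a : a \in L -> (#|low_block D a| <= (2 * d).+1)%N.
  rewrite inE => da; rewrite /low_block cardsU1 -add1n leq_add //; first by case: (_ \notin _).
  by apply: leq_trans da; apply: subset_leq_card; apply/subsetP => x; rewrite inE => /andP[].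
have [||a aL|A [AL disj leL]] := @exists_independent _ L
    (fun a b => ~~ [disjoint low_block D a & low_block D b])
    ((2 * d).+1 * (2 * d).+2 * D).
- by move=> a b; rewrite disjoint_sym.
- by move=> a; apply/pred0Pn; exists a; rewrite /= setU11.
- set S := [set b in L | _].
  have sub : S \subset \bigcup_(w in low_block D a) (w |: nbhd w).
    apply/subsetP => b; rewrite inE => /andP[bL /pred0Pn[w /= /andP[wa wb]]].
    apply/bigcupP; exists w => //.
    by move: wb; rewrite !inE => /orP[/eqP->|/andP[bw _]]; rewrite ?eqxx // e_sym bw orbT.
  apply: leq_trans (subset_leq_card sub) _.
  apply: (@leq_trans (\sum_(w in low_block D a) #|w |: nbhd w|)%N).
    elim/big_rec2: _ => [|w n X _ IH]; first by rewrite cards0.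
    by rewrite (leq_trans (leq_card_setU _ _)) // leq_add2l.
  apply: (@leq_trans (\sum_(w in low_block D a) (2 * d).+2 * D)%N).
    apply: leq_sum => w; rewrite !inE => wa.
    (* [D] may be smaller than [2 * d], so the centre [a] itself need not have degree at most [D];
       the sum covers both cases. *)
    have dw : (#|nbhd w| <= 2 * d + D)%N.
      case/orP: wa => [/eqP->|/andP[_ dw]]; last by lia.
      by move: aL; rewrite inE; lia.
    rewrite cardsU1; apply: (@leq_trans (1 + (2 * d + D))%N); last by nia.
    by rewrite leq_add //; case: (_ \notin _).
  by rewrite sum_nat_const -mulnA leq_mul2r blk ?orbT.
exists A; split=> //.
  by move=> a /(subsetP AL)/blk.
by have := half_low_degree d_gt0 sumd; rewrite -/L; nia.
Qed.

End DegreeBounds.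

(* The vertices after [s] in [X] have been entered one after another, each from a
   vertex of [X] that was left only once, and [v] has not yet been left. *)
Definition traced (N : nat) (e : rel 'I_N) (s : nat) (X : {set 'I_N}) (v : 'I_N) : Prop :=
  [/\ forall i : 'I_N, (i <= s)%N -> i \in X, v \in X &
      exists p : 'I_N -> 'I_N,
        (forall x, x \in X -> (s < x)%N -> [/\ p x \in X, p x != v & e (p x) x]) /\
        (forall x y, x \in X -> y \in X -> (s < x)%N -> (s < y)%N -> p x = p y -> x = y)].

(** * The constants and the bound on the number of traced sets *)

(** Up to the threshold [D], the first factors bound [N / #|A|], and the power of two is the inverse
    of the saving per block of at most [(2 * d).+1] vertices. *)
Definition eps_den (d : nat) : nat := 2 * ((2 * d).+1 * (2 * d).+2) * 2 ^ (2 * d).+2.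

(** The exponent [4 * d * eps_den d] is the number [K] of dyadic thresholds that are tried, so
    [2 ^ K] bounds the unknown [D]. *)
Definition eps_nat (R : realType) (d : nat) : R :=
  ((2 * eps_den d * 2 ^ (4 * d * eps_den d))%N%:R)^-1.

Lemma eps_den_gt0 d : (0 < eps_den d)%N.
Proof. by rewrite /eps_den muln_gt0 expn_gt0 andbT. Qed.

Lemma eps_nat_den_gt0 d : (0 < 2 * eps_den d * 2 ^ (4 * d * eps_den d))%N.
Proof. by rewrite muln_gt0 expn_gt0 andbT muln_gt0 eps_den_gt0. Qed.

Lemma eps_nat_gt0 (R : realType) d : 0 < eps_nat R d.
Proof. by rewrite invr_gt0 ltr0n eps_nat_den_gt0. Qed.

Lemma eps_nat_le1 (R : realType) d : eps_nat R d <= 1.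
Proof. by rewrite invf_le1 ?ltr0n ?ler1n eps_nat_den_gt0. Qed.

(** From [1 - x <= exp (- x) <= 2 ^ (- x)], the second step because [ln 2 <= 1]. *)
Lemma exp1B_le_powR (R : realType) (x : R) (m : nat) :
  0 <= x <= 1 -> (1 - x) ^+ m <= 2 `^ (- (x * m%:R)).
Proof.
move=> /andP[x_ge0 x_le1].
rewrite -mulNr powRrM powR_mulrn ?powR_ge0 //.
apply: lerXn2r; rewrite ?nnegrE ?subr_ge0 ?powR_ge0 //.
apply: le_trans (expR_ge1Dx (- x)) _.
rewrite /powR (gt_eqF (ltr0n _ 2)) ler_expR mulNr lerN2.
rewrite -[leRHS]mulr1 ler_wpM2l //.
have -> : 2 = 1 + 1 :> R by [].
by apply: le_ln1Dx; rewrite (lt_trans _ ltr01) // ltrN10.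
Qed.

Theorem card_traced (R : realType) (d N s : nat) (e : rel 'I_N) (F : {set {set 'I_N}}) :
  (0 < d)%N -> symmetric e -> irreflexive e ->
  (\sum_v #|nbhd e v| <= d * N)%N ->
  (forall X, X \in F -> exists v, traced e s X v) ->
  #|F|%:R <= 2 `^ ((1 - eps_nat R d) * N%:R).
Proof.
move=> d_gt0 e_sym e_irr sumd FP.
set K := (4 * d * eps_den d)%N.
have K_gt0 : (0 < K)%N by rewrite muln_gt0 eps_den_gt0 andbT muln_gt0 d_gt0.
have sumd' : (\sum_v #|nbhd e v| <= d * #|'I_N|)%N by rewrite card_ord.
have [i iK] := exists_sparse_threshold K_gt0 sumd'.
set D := (2 ^ i)%N; set H := [set v | _] => hH.
have D_gt0 : (0 < D)%N by rewrite expn_gt0.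
have [A [Abnd Adisj leA]] := exists_low_blocks e_sym d_gt0 D_gt0 sumd'.
rewrite card_ord in hH leA.
pose B := low_block e D.
(* A block meeting [0..s] gets the pattern [set0], which no traced set matches. *)
pose P a : {set 'I_N} := if [forall x in B a, (s < x)%N] then [set a] else set0.
have PB : {in A, forall a, P a \subset B a}.
  move=> a _; rewrite /P; case: ifP => _; last exact: sub0set.
  by rewrite sub1set setU11.
(* The predecessor map sends the matched centres injectively into [H]: a predecessor of small degree
   would lie in [X :&: B a = [set a]], and [a] is not adjacent to itself. *)
have badH X : X \in F -> (#|[set a in A | X :&: B a == P a]| <= #|H|)%N.
  move=> /FP[v [Xs vX [p [pP pI]]]]; set S := [set a in A | _].
  have SP a : a \in S -> [/\ a \in X, (s < a)%N & forall x, x \in X -> x \in B a -> x = a].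
    rewrite !inE /P => /andP[aA /eqP XB].
    have aB : a \in B a by rewrite setU11.
    case: ifP XB => [/forall_inP sB XB|/forall_inPn[x xB] /= xs XB].
      split; [|exact: sB|] => [|x xX xB].
        by have : a \in X :&: B a; [rewrite XB inE | rewrite inE => /andP[]].
      by have : x \in X :&: B a; [rewrite inE xX | rewrite XB inE => /eqP].
    have : x \in X :&: B a by rewrite inE xB Xs // leqNgt.
    by rewrite XB inE.
  rewrite -(@card_in_imset _ _ p S).
    apply: subset_leq_card; apply/subsetP => _ /imsetP[a /SP[aX sa aB] ->].
    have [pX _ pa] := pP a aX sa.
    rewrite inE ltnNge; apply/negP => low.
    have : p a \in B a by rewrite !inE e_sym pa low orbT.
    by move=> /(aB _ pX) paE; move: pa; rewrite paE e_irr.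
  by move=> a b /SP[aX sa _] /SP[bX sb _]; apply: pI.
have two_gt0 j : 0 < 2%:R ^+ j :> R by rewrite exprn_gt0 ?ltr0n.
have cardF : #|F|%:R <= 2%:R ^+ #|H| *
    \sum_(X : {set 'I_N}) 2%:R ^- #|[set a in A | X :&: B a == P a]| :> R.
  rewrite mulr_sumr -sum1_card natr_sum.
  rewrite [leRHS](bigID (mem F)) /= -[leLHS]addr0 lerD //.
    apply: ler_sum => X XF; rewrite ler_pdivlMr // mul1r.
    by rewrite ler_weXn2l ?ler1n ?badH.
  by apply: sumr_ge0 => X _; rewrite divr_ge0 // ltW.
have := sum_avoiding_patterns R Adisj PB Abnd; rewrite card_ord => avoid.
have := le_trans cardF (ler_wpM2l (ltW (two_gt0 _)) avoid).
move/le_trans; apply.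
set x : R := 2%:R ^- (2 * d).+2.
have x01 : 0 <= x <= 1.
  by rewrite invr_ge0 ltW //= invf_le1 // exprn_ege1 // ler1n.
have two_nz : 2 != 0 :> R by rewrite pnatr_eq0.
rewrite mulrA -exprD.
apply: le_trans (ler_wpM2l (ltW (two_gt0 _)) (exp1B_le_powR _ x01)) _.
rewrite -powR_mulrn ?ler0n // -powRD ?two_nz ?implybT //.
apply: ler_powR; first by rewrite ler1n.
(* Half of [x * #|A|] pays for the factor [2 ^ #|H|], the other half is the gain. In the first
   estimate [D] cancels, thanks to the choice of [K]; the second uses [D <= 2 ^ K]. *)
have [h_le A_ge] : (#|H|%:R <= x * #|A|%:R / 2%:R) /\
    (eps_nat R d * N%:R <= x * #|A|%:R / 2%:R).
  have xE : x * (2 ^ (2 * d).+2)%N%:R = 1.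
    by rewrite natrX mulVf // expf_neq0.
  set y : nat := (2 ^ (2 * d).+2)%N in xE *.
  have y_gt0 : (0 < y)%N by rewrite expn_gt0.
  have cE : (eps_den d = 2 * ((2 * d).+1 * (2 * d).+2) * y)%N by [].
  have N_le : (N * y <= eps_den d * D * #|A|)%N.
    by rewrite cE; move: leA; clear; nia.
  have h_nat : (2 * (#|H| * y) <= #|A|)%N.
    have : (2 * eps_den d * (D * #|H|) <= N)%N by move: hH d_gt0; rewrite /K; clear; nia.
    move=> h2.
    have : (2 * (#|H| * y) * (eps_den d * D) <= #|A| * (eps_den d * D))%N.
      by move: h2 N_le; clear; nia.
    by rewrite leq_mul2r muln_eq0 !eqn0Ngt eps_den_gt0 D_gt0.
  have D_le : (D <= 2 ^ K)%N by rewrite leq_exp2l // ltnW.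
  have N_nat : (N * y <= eps_den d * 2 ^ K * #|A|)%N.
    by apply: leq_trans N_le _; rewrite leq_mul2r leq_mul2l D_le !orbT.
  have toR (u : R) : u * y%:R <= #|A|%:R / 2%:R -> u <= x * #|A|%:R / 2%:R.
    have y0 : 0 < y%:R :> R by rewrite ltr0n.
    have -> : x = y%:R^-1 by apply: (mulIf (lt0r_neq0 y0)); rewrite xE mulVf ?lt0r_neq0.
    by move=> uy; rewrite -mulrA mulrC ler_pdivlMr.
  split; apply: toR.
    by rewrite ler_pdivlMr ?ltr0n // -!natrM ler_nat mulnC.
  rewrite /eps_nat -/K -mulrA mulrC ler_pdivrMr ?ltr0n ?eps_nat_den_gt0 //.
  have -> : #|A|%:R / 2 * (2 * eps_den d * 2 ^ K)%N%:R = (eps_den d * 2 ^ K * #|A|)%N%:R :> R.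
    by rewrite !natrM; field.
  by rewrite -natrM ler_nat.
rewrite natrD; move: h_le A_ge.
by move: (eps_nat R d) (#|H|%:R : R) (x * _) => a b c; lra.
Qed.

(** * Time-bounded total correctness *)

Local Open Scope nat_scope.

Lemma bitlen_le (x k : nat) : 0 < k -> x < 2 ^ k -> bitlen x <= k.
Proof.
move=> k_gt0 xk; rewrite /bitlen.
have [->|x_gt0] := posnP x; first by rewrite trunc_log0.
rewrite -(ltn_exp2l _ _ (ltnSn 1)); apply: leq_ltn_trans xk.
exact: trunc_logP.
Qed.

Lemma bitlen_gt (x : nat) : x < 2 ^ bitlen x.
Proof. exact: trunc_log_ltn. Qed.

(** A multiplier for the word length: intermediate values may outgrow a memory cell, but only by a
    factor that depends on the expression alone. *)
Fixpoint esize (e : nexpr) : nat :=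
  match e with
  | Lit k => bitlen k
  | NGet _ i => (esize i).+1
  | Op _ e1 e2 => (esize e1 + esize e2).+1
  end.

Fixpoint rsize (e : rexpr) : nat :=
  match e with
  | RZero => 1
  | RGet _ i => (esize i ^ 2).+1
  | RAdd e1 e2 => (rsize e1 + rsize e2).+1
  end.

Definition condsize (b : cond) : nat :=
  match b with
  | NLe e1 e2 => (esize e1 ^ 2 + esize e2 ^ 2).+1
  | RLe e1 e2 => (rsize e1 + rsize e2).+1
  end.

(** Iteration counts do not enter: they belong to the step count [W] of [run]. Hence [csize] of a
    program is a constant, and it ends up in the constant of the O-star bound. *)
Fixpoint csize (c : cmd) : nat :=
  match c with
  | Skip => 1
  | NSet _ i e => (esize i ^ 2 + esize e ^ 2).+1
  | RSet _ i e => (esize i ^ 2 + rsize e).+1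
  | Seq c1 c2 => csize c1 + csize c2
  | If b c1 c2 => condsize b + (csize c1 + csize c2)
  | While b c => condsize b + csize c
  end.

(** A syntactic footprint, so that frame conditions are decided by computation and follow from
    execution alone. *)
Fixpoint nwrites (c : cmd) : seq nat :=
  match c with
  | NSet a _ _ => [:: a]
  | Seq c1 c2 => nwrites c1 ++ nwrites c2
  | If _ c1 c2 => nwrites c1 ++ nwrites c2
  | While _ c => nwrites c
  | _ => [::]
  end.

Fixpoint rwrites (c : cmd) : seq nat :=
  match c with
  | RSet a _ _ => [:: a]
  | Seq c1 c2 => rwrites c1 ++ rwrites c2
  | If _ c1 c2 => rwrites c1 ++ rwrites c2
  | While _ c => rwrites c
  | _ => [::]
  end.

Section Logic.
Variables (R : numDomainType) (b : nat).
Hypothesis b_gt0 : 0 < b.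
Implicit Types (s : state R) (e : nexpr) (c : cmd).

Definition bounded s : Prop := forall a i, nmem s a i < 2 ^ b.

Definition unchanged (na ra : seq nat) s s' : Prop :=
  (forall a, a \notin na -> forall i, nmem s' a i = nmem s a i) /\
  (forall a, a \notin ra -> forall i, rmem s' a i = rmem s a i).

Lemma unchanged_refl na ra s : unchanged na ra s s.
Proof. by []. Qed.

Lemma unchanged_trans na ra s1 s2 s3 :
  unchanged na ra s1 s2 -> unchanged na ra s2 s3 -> unchanged na ra s1 s3.
Proof.
by move=> [n12 r12] [n23 r23]; split=> a ha i; rewrite ?n23 ?n12 ?r23 ?r12.
Qed.

Lemma unchanged_sub na ra na' ra' s1 s2 : {subset na <= na'} -> {subset ra <= ra'} ->
  unchanged na ra s1 s2 -> unchanged na' ra' s1 s2.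
Proof.
by move=> nn rr [n12 r12]; split=> a ha; [apply/n12/(contra (@nn a))|apply/r12/(contra (@rr a))].
Qed.

Lemma exec_unchanged c s s' t :
  exec c s s' t -> unchanged (nwrites c) (rwrites c) s s'.
Proof.
elim=> {c s s' t} //=.
- by move=> s a i e; split=> //= a'; rewrite inE /upd => /negPf->.
- by move=> s a i e; split=> //= a'; rewrite inE /upd => /negPf->.
- move=> s s1 s2 c1 c2 t1 t2 _ h1 _ h2; apply: (@unchanged_trans _ _ _ s1).
    by apply: unchanged_sub h1 => a; rewrite mem_cat => ->.
  by apply: unchanged_sub h2 => a; rewrite mem_cat => ->; rewrite orbT.
- move=> s s' b0 c1 c2 t _; case: (cval s b0) => h;
    by apply: unchanged_sub h => a; rewrite mem_cat => ->; rewrite ?orbT.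
- by move=> s s1 s2 b0 c t1 t2 _ _ h1 _ h2; apply: unchanged_trans h1 h2.
Qed.

Lemma esize_gt0 e : 0 < esize e.
Proof. by case: e. Qed.

(** Products add bit lengths and sums need one more bit, which [esize] grants at each operation; the
    other operations never exceed their first operand. *)
Lemma nval_lt s e : bounded s -> nval s e < 2 ^ (esize e * b).
Proof.
move=> bs; elim: e => [k|a i IH|o e1 IH1 e2 IH2] /=.
- apply: leq_trans (bitlen_gt k) _.
  by rewrite leq_exp2l // leq_pmulr.
- apply: leq_trans (bs _ _) _; rewrite leq_exp2l // mulSn leq_addr //.
have [le1 le2] : 2 ^ (esize e1 * b) * 2 <= 2 ^ ((esize e1 + esize e2).+1 * b) /\
   2 ^ (esize e1 * b) * 2 ^ (esize e2 * b) * 2 <= 2 ^ ((esize e1 + esize e2).+1 * b).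
  by rewrite -!expnD -!expnSr !leq_exp2l // !mulSn mulnDl; split; lia.
move: IH1 IH2 le1 le2; move: (nval s e1) (nval s e2) => x y.
move: (2 ^ (esize e1 * b)) (2 ^ (esize e2 * b)) (2 ^ (_ * b)) => X Y Z hx hy h1 h2.
by case: o => /=; nia.
Qed.

(** There are at most [esize e] subexpressions, each charged at most [esize e * b]; hence the
    square. *)
Lemma ncost_le s e : bounded s -> ncost s e <= esize e ^ 2 * b.
Proof.
move=> bs.
have val e' : bitlen (nval s e') <= esize e' * b.
  by apply: bitlen_le (nval_lt _ bs); rewrite muln_gt0 esize_gt0 b_gt0.
elim: e => [k|a i IH|o e1 IH1 e2 IH2].
- rewrite /= addn0; apply: leq_trans (leq_pmulr _ b_gt0) _.
  by rewrite leq_mul2r expnS expn1 leq_pmull ?orbT.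
- have := val (NGet a i); rewrite [ncost _ _]/= [esize _]/=.
  have := esize_gt0 i; move: IH b_gt0.
  move: (bitlen _) (ncost s i) (esize i) => X c x h1 b0 x0 hX.
  by rewrite -!mulnn in h1 *; nia.
have := val (Op o e1 e2); rewrite [ncost _ _]/= [esize _]/=.
have := esize_gt0 e1; have := esize_gt0 e2; move: IH1 IH2 b_gt0.
move: (bitlen _) (ncost s e1) (ncost s e2) (esize e1) (esize e2) => X c1 c2 x y.
by move=> h1 h2 b0 x0 y0 hX; rewrite -!mulnn in h1 h2 *; nia.
Qed.

Lemma rcost_le s (e : rexpr) : bounded s -> rcost s e <= rsize e * b.
Proof.
move=> bs; elim: e => [|a i|e1 IH1 e2 IH2] /=.
- by rewrite addn0 mul1n.
- by rewrite mulSn leq_add // ncost_le.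
by rewrite mulSn mulnDl leq_add // leq_add.
Qed.

Lemma ccost_le s (d : cond) : bounded s -> ccost s d <= condsize d * b.
Proof.
by move=> bs; case: d => e1 e2; rewrite /ccost /= mulSn mulnDl leq_add // leq_add
  ?ncost_le ?rcost_le.
Qed.

(* Total correctness with a time bound; [W] counts the basic steps, each of cost
   proportional to [b]. *)
Definition run c s (W : nat) (Q : state R -> Prop) : Prop :=
  bounded s -> exists s' t, [/\ exec c s s' t, t <= csize c * W, bounded s' & Q s'].

Lemma run_conseq c s W W' (Q Q' : state R -> Prop) :
  W <= W' -> run c s W Q ->
  (forall s', unchanged (nwrites c) (rwrites c) s s' -> Q s' -> Q' s') -> run c s W' Q'.
Proof.
move=> WW' h QQ' /h[s' [t [ex tW bs Qs]]]; exists s', t; split=> //.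
  by rewrite (leq_trans tW) // leq_mul2l WW' orbT.
by apply: QQ' => //; apply: exec_unchanged ex.
Qed.

Lemma run_skip s W (Q : _ -> Prop) : b <= W -> Q s -> run Skip s W Q.
Proof.
move=> bW Qs bs; exists s, 1; split=> //=; first exact: ExecSkip.
by rewrite mul1n (leq_trans b_gt0).
Qed.

Definition nset s a i x : state R := State (upd (nmem s) a i x) (rmem s).
Definition rset s a i x : state R := State (nmem s) (upd (rmem s) a i x).

Lemma run_nset s W a i e (Q : _ -> Prop) : b <= W -> nval s e < 2 ^ b ->
  Q (nset s a (nval s i) (nval s e)) -> run (NSet a i e) s W Q.
Proof.
move=> bW lt_e Qs bs; do 2!eexists; split; [exact: ExecNSet| | |exact: Qs].
  rewrite /= mulSn mulnDl -addnA leq_add ?(leq_trans b_gt0) //.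
  by rewrite leq_add // (leq_trans (ncost_le _ bs)) // leq_mul2l bW orbT.
by move=> a' i'; rewrite /= /upd; case: ifP.
Qed.

Lemma run_rset s W a i (e : rexpr) (Q : _ -> Prop) : b <= W ->
  Q (rset s a (nval s i) (rval s e)) -> run (RSet a i e) s W Q.
Proof.
move=> bW Qs bs; do 2!eexists; split; [exact: ExecRSet| |exact: bs|exact: Qs].
rewrite /= mulSn mulnDl -addnA leq_add ?(leq_trans b_gt0) //.
rewrite leq_add // ?(leq_trans (ncost_le _ bs)) ?(leq_trans (rcost_le _ bs)) //.
  by rewrite leq_mul2l bW orbT.
by rewrite leq_mul2l bW orbT.
Qed.

Lemma run_seq c1 c2 s W (Q : _ -> Prop) :
  run c1 s W (fun s' => run c2 s' W Q) -> run (Seq c1 c2) s W Q.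
Proof.
move=> h /h[s1 [t1 [ex1 le1 bs1 /(_ bs1)[s2 [t2 [ex2 le2 bs2 Q2]]]]]].
exists s2, (t1 + t2); split=> //; first exact: ExecSeq ex1 ex2.
by rewrite /= mulnDl leq_add.
Qed.

Lemma run_if d c1 c2 s W (Q : _ -> Prop) : b <= W ->
  (cval s d -> run c1 s W Q) -> (~~ cval s d -> run c2 s W Q) -> run (If d c1 c2) s W Q.
Proof.
move=> bW h1 h2 bs.
have cost : ccost s d <= condsize d * W.
  by rewrite (leq_trans (ccost_le _ bs)) // leq_mul2l bW orbT.
have [s' [t [ex le bs' Qs']]] : exists s' t,
   [/\ exec (if cval s d then c1 else c2) s s' t, t <= (csize c1 + csize c2) * W,
       bounded s' & Q s'].
  case: (boolP (cval s d)) => [/h1|/h2] /(_ bs)[s' [t [ex le bs' Qs']]];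
    exists s', t; split=> //; apply: leq_trans le _; rewrite leq_mul2r ?leq_addl ?leq_addr orbT //.
exists s', (ccost s d + t); split=> //; first exact: ExecIf.
by rewrite /= [leqRHS]mulnDl leq_add.
Qed.

(** [k] bounds the number of iterations, and the extra [W] in [k.+1 * W] pays for the final failing
    test. The induction is on the number of iterations still allowed. *)
Lemma run_while (I : nat -> state R -> Prop) (k : nat) d c s W W' (Q : _ -> Prop) :
  b <= W -> k.+1 * W <= W' ->
  (forall i s', unchanged (nwrites c) (rwrites c) s s' -> I i s' -> cval s' d ->
     i < k /\ run c s' W (I i.+1)) ->
  (forall i s', unchanged (nwrites c) (rwrites c) s s' -> I i s' -> ~~ cval s' d -> Q s') ->
  I 0 s -> run (While d c) s W' Q.
Proof.
move=> bW kW hstep hend I0 bs0.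
have cost s' : bounded s' -> ccost s' d <= condsize d * W.
  by move=> bs; rewrite (leq_trans (ccost_le _ bs)) // leq_mul2l bW orbT.
have gen j : forall i s', j + i = k -> unchanged (nwrites c) (rwrites c) s s' -> I i s' ->
   bounded s' -> exists s2 t, [/\ exec (While d c) s' s2 t,
     t <= (condsize d + csize c) * (j.+1 * W), bounded s2 & Q s2].
  elim: j => [|j IH] i s' jik fr Is bs;
    (case: (boolP (cval s' d)) => dc; last first; [exists s', (ccost s' d); split=> //;
      [exact: ExecWhileFalse | have := cost s' bs; nia | exact: (hend i s')]|]).
    by have [] := hstep i s' fr Is dc; lia.
  have [_ /(_ bs)[s1 [t1 [ex1 le1 bs1 I1]]]] := hstep i s' fr Is dc.
  have [|s2 [t2 [ex2 le2 bs2 Q2]]] := IH i.+1 s1 _ (unchanged_trans fr (exec_unchanged ex1)) I1 bs1.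
    by lia.
  exists s2, (ccost s' d + t1 + t2); split=> //; first exact: ExecWhileTrue ex1 ex2.
  have cost' := cost s' bs.
  by rewrite [j.+2 * W]mulSn mulnDr leq_add // mulnDl leq_add.
have [|s2 [t2 [ex2 le2 bs2 Q2]]] := gen k 0 s _ (unchanged_refl _ _ _) I0 bs0.
  by rewrite addn0.
exists s2, t2; split=> //=.
by rewrite (leq_trans le2) // leq_mul2l kW orbT.
Qed.

Definition var x : nexpr := NGet x (Lit 0).

Definition for_loop (w : nat) (e : nexpr) (c : cmd) : cmd :=
  Seq (NSet w (Lit 0) (Lit 0))
    (While (NLe (Op Add (var w) (Lit 1)) e)
       (Seq c (NSet w (Lit 0) (Op Add (var w) (Lit 1))))).

(** The body has to establish the invariant for the state in which the counter is already advanced,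
    so the invariant need not be stable under writes to [w]. *)
Lemma run_for (I : nat -> state R -> Prop) (k w : nat) e c s W W' (Q : _ -> Prop) :
  b <= W -> k.+1 * W <= W' -> k < 2 ^ b -> w \notin nwrites c ->
  (forall s', unchanged (w :: nwrites c) (rwrites c) s s' -> nval s' e = k) ->
  (forall i s', unchanged (w :: nwrites c) (rwrites c) s s' -> i < k ->
     nmem s' w 0 = i -> I i s' ->
     run c s' W (fun s2 => I i.+1 (nset s2 w 0 i.+1))) ->
  I 0 (nset s w 0 0) ->
  (forall s', unchanged (w :: nwrites c) (rwrites c) s s' -> I k s' -> Q s') ->
  run (for_loop w e c) s W' Q.
Proof.
move=> bW kW kb wc he hc I0 hQ.
have WW' : W <= W' by apply: leq_trans kW; rewrite mulSn leq_addr.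
apply: run_seq; apply: run_nset; [exact: leq_trans WW'|by rewrite expn_gt0|].
set s1 := nset _ _ _ _.
have fr1 s' : unchanged (nwrites c ++ [:: w]) (rwrites c ++ [::]) s1 s' ->
    unchanged (w :: nwrites c) (rwrites c) s s'.
  move=> h; apply: (@unchanged_trans _ _ _ s1).
    by split=> // a; rewrite inE negb_or /nset /s1 /= /upd => /andP[/negPf-> _].
  by apply: unchanged_sub h => a; rewrite ?cats0 // mem_cat !inE orbC.
apply: (run_while (I := fun i s' => [/\ i <= k, nmem s' w 0 = i & I i s']) (k := k)
         bW kW) => [i s' /fr1 fr [ik wi Ii]|i s' /fr1 fr [ik wi Ii]|].
- rewrite /= he // wi addn1 => lt_ik; split=> //.
  apply: run_seq; apply: run_conseq (leqnn _) (hc i s' fr lt_ik wi Ii) _.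
  move=> s2 [fr2 _] I2; have ws2 : nmem s2 w 0 = i by rewrite fr2.
  apply: run_nset => //=; rewrite ?ws2 addn1 //; first exact: leq_ltn_trans lt_ik kb.
  by split=> //=; rewrite /upd !eqxx.
- rewrite /= he // wi addn1 -leqNgt => le_ki; apply: hQ fr _.
  by have -> : k = i by apply/eqP; rewrite eqn_leq le_ki.
- by split=> //=; rewrite /upd !eqxx.
Qed.

End Logic.

(** * Exploring the reachable states *)

Local Notation aQ := 4 (only parsing).
Local Notation aSeen := 5 (only parsing).
Local Notation vLen := 8 (only parsing).
Local Notation vHead := 9 (only parsing).
Local Notation vC := 10 (only parsing).
Local Notation vW := 11 (only parsing).

Definition incr (x : nat) : cmd := NSet x (Lit 0) (Op Add (var x) (Lit 1)).

Definition push (nx : nexpr) : cmd :=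
  Seq (NSet aQ (var vLen) nx) (Seq (NSet aSeen nx (Lit 1)) (incr vLen)).

(** Breadth-first search. Entries are never removed from the queue [aQ], which ends up listing all
    reachable codes. [aSeen] is addressed by the codes themselves, which takes exponential space;
    its cells start at 0, so no time goes into initialisation. *)
Definition explore (nx kx ix : nexpr) : cmd :=
  Seq (NSet aQ (Lit 0) ix) (Seq (NSet aSeen ix (Lit 1)) (Seq (NSet vLen (Lit 0) (Lit 1))
  (Seq (NSet vHead (Lit 0) (Lit 0))
  (While (NLe (Op Add (var vHead) (Lit 1)) (var vLen))
    (Seq (NSet vC (Lit 0) (NGet aQ (var vHead)))
    (Seq (for_loop vW kx (If (NLe (Lit 1) (NGet aSeen nx)) Skip (push nx)))
      (incr vHead))))))).

Section Explore.
Variables (R : numDomainType) (b : nat).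
Hypothesis b_gt0 : 0 < b.
Variables (nx kx ix : nexpr) (s0 : state R).
Variables (c0 K M : nat) (step : nat -> nat -> nat) (level : nat -> nat).

(* The tables the transition expression reads: size, adjacency matrix, powers of
   two, and the real weight matrix. *)
Definition tables (s : state R) : Prop :=
  (forall a, a \in [:: 0; 1; 3] -> forall j, nmem s a j = nmem s0 a j) /\
  (forall j, rmem s 0 j = rmem s0 0 j).

Inductive reach : nat -> Prop :=
  | Reach0 : reach c0
  | ReachStep c w : reach c -> w < K -> reach (step c w).

Hypothesis nx_val : forall s, tables s -> reach (nmem s vC 0) -> nmem s vW 0 < K ->
  nval s nx = step (nmem s vC 0) (nmem s vW 0).
Hypothesis kx_val : forall s, tables s -> nval s kx = K.
Hypothesis ix_val : forall s, tables s -> nval s ix = c0.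
Hypothesis step_level : forall c w, reach c -> w < K ->
  step c w = c \/ level (step c w) = (level c).+1.
Hypothesis reach_lt : forall c, reach c -> c < 2 ^ b.
Hypothesis reach_card : forall q, uniq q -> (forall c, c \in q -> reach c) -> size q <= M.
Hypothesis M_lt : M < 2 ^ b.
Hypothesis K_lt : K < 2 ^ b.

(** The last clause is what makes the reversed queue a valid order of evaluation. *)
Definition explored (q : seq nat) (s : state R) : Prop :=
  [/\ nmem s vLen 0 = size q /\ (forall i, i < size q -> nmem s aQ i = nth 0 q i),
      uniq q, (forall c, c \in q -> reach c), c0 \in q &
      (forall i j, i <= j -> j < size q -> level (nth 0 q i) <= level (nth 0 q j))].

Lemma tables_unchanged na ra s s' : 0 \notin na -> 1 \notin na -> 3 \notin na -> 0 \notin ra ->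
  unchanged na ra s s' -> tables s -> tables s'.
Proof.
move=> n0 n1 n3 r0 [un ur] [tn tr]; split=> [a ha j|j]; last by rewrite ur.
by rewrite un ?tn //; move: ha; rewrite !inE => /or3P[] /eqP->.
Qed.

(** Invariant of the search with head [h]. By the last clause no level exceeds that of the head by
    more than one, so appending a successor of the head keeps the queue sorted. *)
Let BI (q : seq nat) (h : nat) (s : state R) : Prop :=
  [/\ explored q s, (forall x, nmem s aSeen x = (x \in q)), h <= size q,
      (forall i w, i < h -> w < K -> step (nth 0 q i) w \in q) &
      (h < size q -> forall c, c \in q -> level c <= (level (nth 0 q h)).+1)].

(** The queue is at all times a duplicate-free list of reachable codes, hence of length at most [M].
    This bounds the iterations without any estimate of the running time of the search itself. *)
Lemma run_explore s W (Q : _ -> Prop) :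
  tables s -> (forall x, nmem s aSeen x = 0) -> M.+1 * (K.+1 * b) <= W ->
  (forall s' q, unchanged [:: aQ; aSeen; vLen; vHead; vC; vW] [::] s s' -> explored q s' ->
     (forall c w, c \in q -> w < K -> step c w \in q) -> Q s') ->
  run b (explore nx kx ix) s W Q.
Proof.
move=> tab seen0 leW hQ.
have bK : b <= K.+1 * b by rewrite mulSn leq_addr.
have bW : b <= W by apply: leq_trans leW; rewrite mulSn (leq_trans bK) ?leq_addr.
have one_lt : 1 < 2 ^ b by rewrite -[1](expn0 2) ltn_exp2l.
have tab' na ra s1 s2 := @tables_unchanged na ra s1 s2.
have r0 := Reach0.
apply: run_seq; apply: run_nset => //=; first by rewrite ix_val ?reach_lt.
apply: run_seq; apply: run_nset => //=.
apply: run_seq; apply: run_nset => //=.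
apply: run_seq; apply: run_nset => //=; first by rewrite expn_gt0.
have tabQ : tables (nset s aQ 0 c0).
  by split=> [a|]; [rewrite !inE => /or3P[] /eqP-> j|]; apply tab.
rewrite !(ix_val tab) (ix_val tabQ).
set s1 := nset _ _ _ _.
have un1 : unchanged [:: aQ; aSeen; vLen; vHead; vC; vW] [::] s s1.
  split=> // a; rewrite !inE !negb_or => /and5P[/negPf h1 /negPf h2 /negPf h3 /negPf h4 _] i.
  by rewrite /s1 /= /upd h1 h2 h3 h4.
have tab1 : tables s1 by apply: tab' tab; try exact: un1.
apply: (run_while b_gt0 (I := fun h s' => nmem s' vHead 0 = h /\ exists q, BI q h s')
  (k := M) bK leW) => [h s2 un2 [hh [q [[[hl hq] uq rq cq lq] sq hs cl lv]]]
                       |h s2 un2 [hh [q [[[hl hq] uq rq cq lq] sq hs cl lv]]]|].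
- rewrite /= hh hl addn1 => lt_h; split; first exact: leq_trans lt_h (reach_card uq rq).
  have tab2 : tables s2 by apply: tab' tab1; try exact: un2.
  set c := nth 0 q h; have cQ : c \in q by rewrite mem_nth.
  have rc := rq c cQ.
  apply: run_seq; apply: run_nset => //=; first by rewrite hh hq ?reach_lt.
  rewrite hh hq // -/c; set s3 := nset _ _ _ _.
  have tab3 : tables s3 by split=> [a|]; [rewrite !inE => /or3P[] /eqP-> j|]; apply tab2.
  apply: run_seq.
  (* [q] is the queue when the head was read, and [r] collects what the labels tried so far have
     appended. *)
  apply: (run_for b_gt0 (W := b) (I := fun w s' => nmem s' vHead 0 = h /\
    exists r, BI (q ++ r) h s' /\ forall w', w' < w -> step c w' \in q ++ r)) => //.
  + by move=> s' un; apply: kx_val; apply: tab' tab3; try exact: un.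
  + move=> w s4 un4 lt_wK ws4 [hh4 [r [BI4 cw4]]].
    have tab4 : tables s4 by apply: tab' tab3; try exact: un4.
    have c4 : nmem s4 vC 0 = c by rewrite un4.1.
    have nx4 : nval s4 nx = step c w by rewrite nx_val ?c4 ?ws4.
    have [[[hl4 hq4] uq4 rq4 cq4 lq4] sq4 hs4 cl4 lv4] := BI4.
    have cw (w' : nat) q' : {subset q ++ r <= q'} -> step c w \in q' -> w' < w.+1 ->
        step c w' \in q'.
      by move=> sub sw; rewrite ltnS leq_eqVlt => /orP[/eqP->//|/cw4/sub].
    have rx : reach (step c w) by apply: ReachStep.
    apply: run_if => //=; rewrite nx4 sq4 lt0b.
      move=> sw; apply: run_skip => //; split; first by rewrite /= /upd.
      by exists r; split=> // w'; apply: cw.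
    move=> sw; set q4 := q ++ r in hl4 hq4 uq4 rq4 cq4 lq4 sq4 hs4 cl4 lv4 sw cw4 cw BI4.
    set x := step c w in sw rx *.
    have size_lt : (size q4).+1 <= M.
      rewrite -[_.+1](size_rcons q4 x); apply: reach_card.
        by rewrite rcons_uniq sw.
      by move=> c'; rewrite mem_rcons inE => /orP[/eqP->|/rq4].
    apply: run_seq; apply: run_nset => //=; first by rewrite nx4 reach_lt.
    rewrite hl4 nx4; set s5 := nset _ _ _ _.
    have nx5 : nval s5 nx = x.
      have tab5 : tables s5 by split=> [a|]; [rewrite !inE => /or3P[] /eqP-> j|]; apply tab4.
      by rewrite nx_val ?ws4 ?c4 //= /upd /= ?ws4 ?c4.
    apply: run_seq; apply: run_nset => //=; rewrite nx5.
    apply: run_nset => //=; rewrite /upd /= hl4 addn1.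
      exact: leq_ltn_trans size_lt M_lt.
    split=> //; exists (rcons r x).
    have cq' : c = nth 0 q4 h by rewrite nth_cat lt_h.
    have hsz : h < size q4 by rewrite size_cat ltn_addr.
    (* The label cannot have been void, since [c] is already in the queue and [x] is not. *)
    have levx : level x = (level c).+1.
      case: (step_level rc lt_wK) => //; rewrite -/x => xc.
      by move: sw; rewrite xc cq' mem_nth.
    have nthx i : i < size q4 -> nth 0 (rcons q4 x) i = nth 0 q4 i.
      by move=> li; rewrite nth_rcons li.
    rewrite -rcons_cat -/q4; split; last first.
      by move=> w'; apply: cw; [move=> y|]; rewrite mem_rcons inE ?eqxx // orbC => ->.
    split.
    * split=> /=; rewrite ?rcons_uniq ?sw ?uq4 //.
      -- rewrite /= /upd /= size_rcons; split=> // i; rewrite ltnS leq_eqVlt.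
         move=> /orP[/eqP->|li]; first by rewrite eqxx nth_rcons ltnn eqxx.
         by rewrite (ltn_eqF li) nthx ?hq4.
      -- by move=> c'; rewrite mem_rcons inE => /orP[/eqP->|/rq4].
      -- by rewrite mem_rcons inE cq4 orbT.
      -- move=> i j ij; rewrite size_rcons ltnS leq_eqVlt => /orP[/eqP jE|lj]; last first.
           by rewrite !nthx ?lq4 // (leq_ltn_trans ij).
         rewrite [nth _ _ j]nth_rcons jE ltnn eqxx nth_rcons.
         case: ifP => li; last by case: ifP => //; rewrite jE in ij; move: li ij; lia.
         by rewrite levx cq'; apply: lv4 => //; apply: mem_nth.
    * move=> y; rewrite /= /upd /= mem_rcons inE.
      by case: (y == x).
    * by rewrite size_rcons leqW.
    * move=> i w' ih w'K; rewrite nthx ?(ltn_trans ih) // mem_rcons inE cl4 ?orbT //.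
    * by move=> _ c'; rewrite mem_rcons inE nthx // -cq' => /orP[/eqP->|c'q];
        [rewrite levx | rewrite cq' lv4].
  + split=> //; exists [::]; rewrite cats0; split=> //; split=> //.
  move=> s4 un4 [hh4 [r [[ex4 sq4 hs4 cl4 lv4] cw4]]].
  have [[hl4 hq4] uq4 rq4 cq4 lq4] := ex4.
  have hsz : h < size (q ++ r) by rewrite size_cat ltn_addr.
  apply: run_nset => //=; rewrite hh4 addn1.
    by apply: leq_ltn_trans M_lt; apply: leq_trans hsz (reach_card uq4 rq4).
  split=> //; exists (q ++ r); split=> //.
    move=> i w; rewrite ltnS leq_eqVlt => /orP[/eqP->|]; last exact: cl4.
    by rewrite nth_cat lt_h; apply: cw4.
  move=> lt_h1 c' c'q; apply: leq_trans (lv4 hsz c' c'q) _.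
  by rewrite ltnS lq4.
- rewrite /= hh hl addn1 -leqNgt => le_h.
  apply: (hQ s2 q).
  + apply: unchanged_trans un1 _; apply: unchanged_sub un2 => // a.
    by rewrite !inE; do !case: eqP => //.
  + by split.
  move=> c w cq'; rewrite -(nth_index 0 cq') => wK; apply: cl => //.
  by apply: leq_trans le_h; rewrite index_mem.
- split=> //; exists [:: c0]; split=> //=; rewrite /s1 /upd /=.
  + split=> //=; first by split=> // -[].
    * by move=> c; rewrite inE => /eqP->.
    * by rewrite inE.
    * by move=> i [|j] //; rewrite leqn0 => /eqP->.
  + by move=> x; rewrite inE; case: (x == c0).
  + by move=> _ c; rewrite inE => /eqP->.
Qed.

End Explore.

(** * Counting and minimizing over paths to the final state *)

Local Notation aVal := 6 (only parsing).
Local Notation aNxt := 6 (only parsing).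
Local Notation aOk := 7 (only parsing).

(** Later queue entries are handled first, so that the values of all proper successors are final
    when a code is reached. *)
Definition backward (kx : nexpr) (pre body : cmd) : cmd :=
  Seq (NSet vHead (Lit 0) (var vLen))
  (While (NLe (Lit 1) (var vHead))
    (Seq (NSet vHead (Lit 0) (Op Defs.Sub (var vHead) (Lit 1)))
    (Seq (NSet vC (Lit 0) (NGet aQ (var vHead)))
    (Seq pre (for_loop vW kx body))))).

(* Truncated subtraction turns comparisons into 0/1-valued expressions. *)
Definition eq_expr (e1 e2 : nexpr) : nexpr :=
  Op Defs.Sub (Lit 1) (Op Add (Op Defs.Sub e1 e2) (Op Defs.Sub e2 e1)).
Definition neq_expr (e1 e2 : nexpr) : nexpr := Op Defs.Sub (Lit 1) (eq_expr e1 e2).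

Lemma eq_exprE (R : numDomainType) (s : state R) e1 e2 :
  nval s (eq_expr e1 e2) = (nval s e1 == nval s e2).
Proof. by rewrite /=; case: eqP => [->|]; lia. Qed.

Lemma neq_exprE (R : numDomainType) (s : state R) e1 e2 :
  nval s (neq_expr e1 e2) = (nval s e1 != nval s e2).
Proof.
have -> : nval s (neq_expr e1 e2) = 1 - nval s (eq_expr e1 e2) by [].
by rewrite eq_exprE; case: eqP.
Qed.

Section Backward.
Variables (R : numDomainType) (b : nat).
Hypothesis b_gt0 : 0 < b.
Variables (kx : nexpr) (pre body : cmd) (q : seq nat).
Let prog := backward kx pre body.
Let loop := Seq pre (for_loop vW kx body).
Hypothesis q_lt : size q < 2 ^ b.
Hypothesis q_val_lt : forall c, c \in q -> c < 2 ^ b.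

(** [I i] describes the state when the queue from position [i] on has been processed; it must ignore
    the two cells that the driver itself overwrites. *)
Lemma run_backward (I : nat -> state R -> Prop) s W W' (Q : _ -> Prop) :
  b <= W -> (size q).+1 * W <= W' ->
  nmem s vLen 0 = size q -> (forall i, i < size q -> nmem s aQ i = nth 0 q i) ->
  vLen \notin nwrites loop -> vHead \notin nwrites loop -> aQ \notin nwrites loop ->
  (forall i s', unchanged (nwrites prog) (rwrites prog) s s' -> i < size q ->
     nmem s' vC 0 = nth 0 q i -> I i.+1 s' -> run b loop s' W (I i)) ->
  (forall i a x s', a \in [:: vHead; vC] -> I i s' -> I i (nset s' a 0 x)) ->
  I (size q) s ->
  (forall s', unchanged (nwrites prog) (rwrites prog) s s' -> I 0 s' -> Q s') ->
  run b prog s W' Q.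
Proof.
move=> bW leW lenq qq nLen nHead nQ step stab Is hQ.
have bW' : b <= W' by apply: leq_trans leW; rewrite mulSn (leq_trans bW) ?leq_addr.
apply: run_seq; apply: run_nset => //=; first by rewrite lenq.
set s1 := nset _ _ _ _.
have un0 s2 : unchanged [:: vHead, vC & nwrites loop] (rwrites loop) s1 s2 ->
    unchanged (nwrites prog) (rwrites prog) s s2.
  move=> un; apply: (@unchanged_trans _ _ _ _ s1).
    by split=> // a; rewrite !inE negb_or => /andP[/negPf h _] i; rewrite /s1 /= /upd h.
  apply: unchanged_sub un => // a.
  by rewrite !inE => /or3P[->|->|h] //; rewrite ?orbT // h !orbT.
pose J i s' := [/\ i <= size q, nmem s' vHead 0 = size q - i & I (size q - i) s'].
apply: (run_while b_gt0 (I := J) (k := size q) bW leW)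
  => [i s2 un2 [isz hi Ii]|i s2 un2 [isz hi Ii]|].
- rewrite /= hi subn_gt0 => lt_i; split=> //.
  have {}un2 : unchanged [:: vHead, vC & nwrites loop] (rwrites loop) s1 s2 by [].
  have lenq2 : nmem s2 vLen 0 = size q.
    by rewrite un2.1.
  have qq2 j : j < size q -> nmem s2 aQ j = nth 0 q j.
    by move=> lj; rewrite un2.1 // -qq.
  apply: run_seq; apply: run_nset => //=; first by apply: leq_ltn_trans q_lt; lia.
  rewrite hi; have -> : size q - i - 1 = size q - i.+1 by lia.
  have lt_i' : size q - i.+1 < size q by lia.
  apply: run_seq; apply: run_nset => //=; rewrite /upd /= qq2 //.
    by apply: q_val_lt; apply: mem_nth.
  set s3 := nset _ _ _ _.
  have h3 : nmem s3 vHead 0 = size q - i.+1 by [].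
  have := step (size q - i.+1) s3 _ lt_i'.
  have -> : (size q - i.+1).+1 = size q - i by lia.
  move=> /(_ _ erefl) run3; apply: run_conseq (leqnn _) (run3 _ _) _.
  + apply: un0; apply: (@unchanged_trans _ _ _ _ s2).
      by apply: unchanged_sub un2 => // a; rewrite !inE.
    split=> // a; rewrite !inE !negb_or => /and3P[/negPf h1 /negPf h2 _] j.
    by rewrite /s3 /= /upd h1 h2.
  + by apply: (stab _ vC); rewrite ?inE //; apply: (stab _ vHead); rewrite ?inE.
  move=> s4 un4 I4; split=> //; rewrite un4.1 //.
- rewrite /= hi subn_gt0 -leqNgt => le_i; apply: hQ.
    by apply: un0; apply: unchanged_sub un2 => // a; rewrite !inE.
  by move: Ii; have -> : size q - i = 0 by lia.
- split=> //; rewrite subn0 /s1.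
  exact: lenq.
  exact: (stab _ vHead).
Qed.

End Backward.

(** * Counting paths in a layered state graph *)

Section Paths.
Variables (K term L : nat) (step : nat -> nat -> nat) (level : nat -> nat) (reach : nat -> Prop).
Hypothesis step_level : forall c w, reach c -> w < K ->
  step c w = c \/ level (step c w) = (level c).+1.
Hypothesis reach_step : forall c w, reach c -> w < K -> reach (step c w).
Hypothesis level_le : forall c, reach c -> level c <= L.

(** [k] is fuel. Labels that leave the code unchanged are void and must not be counted. *)
Fixpoint npaths (k c : nat) : nat :=
  if c == term then 1
  else if k is k'.+1 then \sum_(w < K | step c w != c) npaths k' (step c w) else 0.

Lemma npaths_term k : npaths k term = 1.
Proof. by case: k => [|k]; rewrite /= eqxx. Qed.

Lemma npaths_le k c : 0 < K -> npaths k c <= K ^ k.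
Proof.
move=> K_gt0; elim: k c => [|k IH] c /=; first by case: ifP.
case: ifP => _; first by rewrite expn_gt0 K_gt0.
rewrite expnS -[X in X * _]card_ord -sum_nat_const big_mkcond /=.
by apply: leq_sum => w _; case: ifP.
Qed.

(** The fuel [L - level c] drops by exactly one at each proper step. Without fuel there is no proper
    step, as it would lead to a level above [L]. *)
Lemma npaths_step c : reach c -> c != term ->
  npaths (L - level c) c =
  \sum_(w < K | step c w != c) npaths (L - level (step c w)) (step c w).
Proof.
move=> rc /negPf cT.
have lev (w : 'I_K) : step c w != c -> level (step c w) = (level c).+1.
  by move=> sw; case: (step_level rc (ltn_ord w)) => // h; rewrite h eqxx in sw.
case E : (L - level c) => [|k] /=; rewrite cT.
  rewrite big_pred0 // => w; apply/negP => sw.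
  by have := level_le (reach_step rc (ltn_ord w)); rewrite lev //; lia.
by apply: eq_bigr => w sw; congr npaths; rewrite lev //; lia.
Qed.

End Paths.

Definition count_paths (nx kx tx : nexpr) : cmd :=
  backward kx (NSet aVal (var vC) (eq_expr (var vC) tx))
    (NSet aVal (var vC) (Op Add (NGet aVal (var vC))
       (Op Mul (neq_expr nx (var vC)) (NGet aVal nx)))).

Definition update_min (nx : nexpr) (wx : rexpr) : cmd :=
  Seq (RSet 1 (var vC) (RAdd wx (RGet 1 nx)))
    (Seq (NSet aNxt (var vC) nx) (NSet aOk (var vC) (Lit 1))).

(** The product acts as a conjunction. The flag [aOk] tells whether the final state can be reached
    and replaces an infinite weight, which real cells cannot hold. *)
Definition relax (nx : nexpr) (wx : rexpr) : cmd :=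
  If (NLe (Lit 1) (Op Mul (NGet aOk nx) (neq_expr nx (var vC))))
    (If (NLe (NGet aOk (var vC)) (Lit 0)) (update_min nx wx)
      (If (RLe (RGet 1 (var vC)) (RAdd wx (RGet 1 nx))) Skip (update_min nx wx)))
    Skip.

Definition min_paths (nx kx tx : nexpr) (wx : rexpr) : cmd :=
  Seq (NSet aOk tx (Lit 1)) (backward kx Skip (relax nx wx)).

(** * Dynamic programming along the reversed queue *)

Section Dag.
Variables (R : realDomainType) (b : nat).
Hypothesis b_gt0 : 0 < b.
Variables (nx kx tx : nexpr) (s0 : state R).
Variables (c0 K M term L : nat) (step : nat -> nat -> nat) (level : nat -> nat).
Let reach := reach c0 K step.
Let tab := tables s0.

Hypothesis nx_val : forall s, tab s -> reach (nmem s vC 0) -> nmem s vW 0 < K ->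
  nval s nx = step (nmem s vC 0) (nmem s vW 0).
Hypothesis kx_val : forall s, tab s -> nval s kx = K.
Hypothesis tx_val : forall s, tab s -> nval s tx = term.
Hypothesis step_level : forall c w, reach c -> w < K ->
  step c w = c \/ level (step c w) = (level c).+1.
Hypothesis level_le : forall c, reach c -> level c <= L.
Hypothesis step_term : forall w, w < K -> step term w = term.
Hypothesis reach_lt : forall c, reach c -> c < 2 ^ b.
Hypothesis M_lt : M < 2 ^ b.
Hypothesis K_lt : K < 2 ^ b.

Variable q : seq nat.
Hypothesis q_size : size q <= M.
Hypothesis q_uniq : uniq q.
Hypothesis q_reach : forall c, c \in q -> reach c.
Hypothesis q_closed : forall c w, c \in q -> w < K -> step c w \in q.
Hypothesis q_sorted : forall i j, i <= j -> j < size q -> level (nth 0 q i) <= level (nth 0 q j).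

(** A proper step raises the level, and the queue is closed under steps and sorted by level. *)
Lemma step_later i w : i < size q -> w < K -> step (nth 0 q i) w != nth 0 q i ->
  exists j, [/\ i < j, j < size q & step (nth 0 q i) w = nth 0 q j].
Proof.
move=> iq wK sw; have iQ := mem_nth 0 iq.
have jQ := q_closed iQ wK; exists (index (step (nth 0 q i) w) q).
rewrite index_mem nth_index //; split=> //.
rewrite ltnNge; apply/negP => /q_sorted/(_ iq); rewrite nth_index //.
case: (step_level (q_reach iQ) wK) => [h|->]; first by rewrite h eqxx in sw.
by rewrite ltnn.
Qed.

Let P c := npaths K term step (L - level c) c.

Lemma run_count_paths s W (Q : _ -> Prop) :
  tab s -> nmem s vLen 0 = size q -> (forall i, i < size q -> nmem s aQ i = nth 0 q i) ->
  0 < K -> K ^ L < 2 ^ b -> M.+1 * (K.+1 * b) <= W ->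
  (forall s', unchanged [:: aVal; vHead; vC; vW] [::] s s' ->
     (forall c, c \in q -> nmem s' aVal c = P c) -> Q s') ->
  run b (count_paths nx kx tx) s W Q.
Proof.
move=> tabs lenq qq K_gt0 KL_lt leW hQ.
have P_lt c : P c < 2 ^ b.
  apply: leq_ltn_trans (npaths_le _ _ _ _ K_gt0) _.
  by apply: leq_ltn_trans KL_lt; rewrite leq_pexp2l ?leq_subr.
have one_lt : 1 < 2 ^ b by rewrite -[1](expn0 2) ltn_exp2l.
have bK : b <= K.+1 * b by rewrite mulSn leq_addr.
have tab' na ra s1 s2 := @tables_unchanged R s0 na ra s1 s2.
pose I i (s' : state R) := forall j, i <= j -> j < size q ->
  nmem s' aVal (nth 0 q j) = P (nth 0 q j).
have q_lt := leq_ltn_trans q_size M_lt.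
have q_val_lt c : c \in q -> c < 2 ^ b by move/q_reach/reach_lt.
rewrite /count_paths; apply: (run_backward b_gt0 q_lt q_val_lt (I := I) (W := K.+1 * b)) => //.
- by apply: leq_trans leW; rewrite leq_mul2r ltnS q_size orbT.
- move=> i s1 un1 iq c1 I1; set c := nth 0 q i in c1.
  have cQ : c \in q by rewrite mem_nth.
  have rc := q_reach cQ.
  have tab1 : tab s1 by apply: tab' tabs; try exact: un1.
  apply: run_seq; apply: run_nset => //.
    rewrite eq_exprE; apply: leq_ltn_trans one_lt; exact: leq_b1.
  rewrite eq_exprE (tx_val tab1) [nval _ _]/= c1.
  set s2 := nset _ _ _ _.
  have tab2 : tab s2 by split=> [a|]; [rewrite !inE => /or3P[] /eqP-> j|]; apply tab1.
  (* Content of the cell of [c] after the first [w] labels. For the final state all labels are void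
     and the initial 1 remains. *)
  pose S w := (c == term) + \sum_(w' < w | step c w' != c) P (step c w').
  have SK : S K = P c.
    rewrite /S; case: eqP => [cT|/eqP cT].
      rewrite big_pred0 ?addn0 /P ?cT ?npaths_term //.
      by move=> w; rewrite step_term ?eqxx.
    by rewrite add0n /P (npaths_step step_level) // => *; apply: ReachStep.
  (* Partial sums only grow, so they fit in a cell because the final value does. *)
  have S_lt w : w <= K -> S w < 2 ^ b.
    move=> wK; apply: leq_ltn_trans (P_lt c); rewrite -SK /S leq_add2l.
    rewrite -!(big_mkord (fun w' => step c w' != c) (fun w' => P (step c w'))).
    by rewrite [leqRHS](@big_cat_nat _ _ _ w) //= leq_addr.
  apply: (run_for b_gt0 (W := b) (k := K) (I := fun w s' => nmem s' aVal c = S w /\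
     forall j, i < j -> j < size q -> nmem s' aVal (nth 0 q j) = P (nth 0 q j))) => //.
  + by move=> s3 un; apply: kx_val; apply: tab' tab2; try exact: un.
  + move=> w s3 un3 wK w3 [vc vq].
    have tab3 : tab s3 by apply: tab' tab2; try exact: un3.
    have c3 : nmem s3 vC 0 = c by rewrite un3.1.
    have nx3 : nval s3 nx = step c w by rewrite nx_val ?c3 ?w3.
    have val_new : nmem s3 aVal c + (step c w != c) * nmem s3 aVal (step c w) = S w.+1.
      rewrite vc /S [X in _ = _ + X]big_mkcond big_ord_recr /= -big_mkcond addnA; congr (_ + _).
      case: ifP => // sw; rewrite mul1n; have [j [ij jq ->]] := step_later iq wK sw.
      exact: vq.
    have vC3 : nval s3 (var vC) = c by [].
    have body_val : nval s3 (Op Add (NGet aVal (var vC))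
        (Op Mul (neq_expr nx (var vC)) (NGet aVal nx))) = S w.+1.
      transitivity (nmem s3 aVal (nval s3 (var vC)) +
        nval s3 (neq_expr nx (var vC)) * nmem s3 aVal (nval s3 nx)) => //.
      by rewrite neq_exprE vC3 nx3.
    apply: run_nset => //; rewrite body_val; first exact: S_lt.
    rewrite vC3.
    split=> [|j ij jq]; rewrite /= /upd /= ?eqxx // ifN ?vq //.
    by rewrite nth_uniq // neq_ltn ij orbT.
  + split=> [|j ij jq]; rewrite /= /upd /= ?eqxx.
      by rewrite /S big_ord0 addn0.
    rewrite ifN; first exact: I1.
    by rewrite nth_uniq // neq_ltn ij orbT.
  move=> s3 un3 [vc vq] j; rewrite leq_eqVlt => /orP[/eqP<-|]; last exact: vq.
  by rewrite vc SK.
- by move=> i a x s1; rewrite !inE => /orP[] /eqP->.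
- by move=> j jq /(leq_ltn_trans jq); rewrite ltnn.
move=> s1 un1 I1; apply: hQ => [|c cQ].
  by apply: unchanged_sub un1 => // a; rewrite !inE; do !case: eqP => //.
by rewrite -(nth_index 0 cQ) I1 // index_mem.
Qed.

Variables (wx : rexpr) (wt : nat -> nat -> R).
Hypothesis wx_val : forall s, tab s -> reach (nmem s vC 0) -> nmem s vW 0 < K ->
  step (nmem s vC 0) (nmem s vW 0) != nmem s vC 0 ->
  rval s wx = wt (nmem s vC 0) (nmem s vW 0).

(** The first clause says that the stored weight is attained through the stored successor, the
    second that none of the first [n] labels does better. For [n = K] these are Bellman's equations;
    for smaller [n], the invariant of the inner loop. *)
Definition bellman (c n : nat) (s : state R) : Prop :=
  [/\ 0 < nmem s aOk c -> (c = term /\ rmem s 1 c = 0%R) \/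
        exists w, [/\ w < K, step c w != c, 0 < nmem s aOk (step c w),
          nmem s aNxt c = step c w & rmem s 1 c = (wt c w + rmem s 1 (step c w))%R],
      (forall w, w < n -> step c w != c -> 0 < nmem s aOk (step c w) ->
         0 < nmem s aOk c /\ (rmem s 1 c <= wt c w + rmem s 1 (step c w))%R) &
      (c = term -> 0 < nmem s aOk c)].

Let agree (s s' : state R) (x : nat) : Prop :=
  [/\ nmem s' aOk x = nmem s aOk x, nmem s' aNxt x = nmem s aNxt x & rmem s' 1 x = rmem s 1 x].

Lemma bellman_agree c s s' : agree s s' c ->
  (forall w, w < K -> step c w != c -> agree s s' (step c w)) ->
  bellman c K s -> bellman c K s'.
Proof.
move=> [okc nxc vc] ag [A B C]; split.
- rewrite okc vc nxc => /A[|[w [wK sw okw nxw vw]]]; [by left|right; exists w].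
  by have [-> _ ->] := ag w wK sw; split.
- by move=> w wK sw; have [-> _ ->] := ag w wK sw; rewrite okc vc; apply: B.
- by rewrite okc.
Qed.

Lemma run_min_paths s W (Q : _ -> Prop) :
  tab s -> nmem s vLen 0 = size q -> (forall i, i < size q -> nmem s aQ i = nth 0 q i) ->
  (forall x, nmem s aOk x = 0) -> (forall x, rmem s 1 x = 0%R) ->
  M.+1 * (K.+1 * b) <= W ->
  (forall s', unchanged [:: aOk; aNxt; vHead; vC; vW] [:: 1] s s' ->
     (forall c, c \in q -> bellman c K s') -> Q s') ->
  run b (min_paths nx kx tx wx) s W Q.
Proof.
move=> tabs lenq qq ok0 val0 leW hQ.
have one_lt : 1 < 2 ^ b by rewrite -[1](expn0 2) ltn_exp2l.
have bK : b <= K.+1 * b by rewrite mulSn leq_addr.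
have bW : b <= W by apply: leq_trans leW; rewrite mulSn (leq_trans bK) ?leq_addr.
have tab' na ra s1 s2 := @tables_unchanged R s0 na ra s1 s2.
have q_lt := leq_ltn_trans q_size M_lt.
have q_val_lt c : c \in q -> c < 2 ^ b by move/q_reach/reach_lt.
apply: run_seq; apply: run_nset => //; rewrite [nval _ (Lit 1)]/= tx_val //.
set s1 := nset _ _ _ _.
have un1 : unchanged [:: aOk; aNxt; vHead; vC; vW] [:: 1] s s1.
  by split=> // a; rewrite inE negb_or => /andP[/negPf h _] i; rewrite /s1 /= /upd h.
have tab1 : tab s1 by apply: tab' tabs; try exact: un1.
(* Entries not yet processed still hold their initial values; the final state alone has been marked
   in advance, with weight 0. *)
pose I i (s' : state R) :=
  (forall j, i <= j -> j < size q -> bellman (nth 0 q j) K s') /\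
  (forall j, j < i -> j < size q ->
     nmem s' aOk (nth 0 q j) = (nth 0 q j == term) /\ rmem s' 1 (nth 0 q j) = 0%R).
apply: (run_backward b_gt0 q_lt q_val_lt (I := I) (W := K.+1 * b)) => //.
- by apply: leq_trans leW; rewrite leq_mul2r ltnS q_size orbT.
- move=> i s2 un2 iq c2 [I2 J2]; set c := nth 0 q i in c2.
  have cQ : c \in q by rewrite mem_nth.
  have rc := q_reach cQ.
  have tab2 : tab s2 by apply: tab' tab1; try exact: un2.
  apply: run_seq; apply: run_skip => //.
  have neq_c j : j < size q -> j != i -> (nth 0 q j == c) = false.
    by move=> jq /negPf ji; rewrite nth_uniq.
  have [okc vc] := J2 i (ltnSn i) iq; rewrite -/c in okc vc.
  apply: (run_for b_gt0 (W := b) (k := K) (I := fun w s' => [/\ bellman c w s',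
     forall j, i < j -> j < size q -> bellman (nth 0 q j) K s' &
     forall j, j < i -> j < size q ->
       nmem s' aOk (nth 0 q j) = (nth 0 q j == term) /\ rmem s' 1 (nth 0 q j) = 0%R])) => //.
  + by move=> s3 un; apply: kx_val; apply: tab' tab2; try exact: un.
  + move=> w s3 un3 wK w3 [[A3 B3 C3] I3 J3].
    have tab3 : tab s3 by apply: tab' tab2; try exact: un3.
    have c3 : nmem s3 vC 0 = c by rewrite un3.1.
    have nx3 : nval s3 nx = step c w by rewrite nx_val ?c3 ?w3.
    have testE : nval s3 (Op Mul (NGet aOk nx) (neq_expr nx (var vC))) =
        nmem s3 aOk (step c w) * (step c w != c).
      transitivity (nmem s3 aOk (nval s3 nx) * nval s3 (neq_expr nx (var vC))) => //.
      by rewrite neq_exprE nx3 [nval s3 (var vC)]/= c3.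
    have skip_case : (step c w != c -> 0 < nmem s3 aOk (step c w) ->
         0 < nmem s3 aOk c /\ (rmem s3 1 c <= wt c w + rmem s3 1 (step c w))%R) ->
        run b Skip s3 b (fun s4 => [/\ bellman c w.+1 (nset s4 vW 0 w.+1),
          forall j, i < j -> j < size q -> bellman (nth 0 q j) K (nset s4 vW 0 w.+1) &
          forall j, j < i -> j < size q ->
          nmem (nset s4 vW 0 w.+1) aOk (nth 0 q j) = (nth 0 q j == term) /\
          rmem (nset s4 vW 0 w.+1) 1 (nth 0 q j) = 0%R]).
      move=> Bw; apply: run_skip => //; split=> //; split=> //.
      by move=> w'; rewrite ltnS leq_eqVlt => /orP[/eqP->|/B3].
    apply: run_if => //; last first.
      rewrite /cval testE -ltnNge ltnS leqn0 muln_eq0 => h; apply: skip_case => sw ok_w.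
      by move: h; rewrite sw -leqn0 leqNgt ok_w.
    rewrite /cval testE muln_gt0 lt0b => /andP[ok_w sw].
    have [k [ik kq swE]] := step_later iq wK sw.
    have wx3 : rval s3 wx = wt c w by rewrite wx_val ?c3 ?w3.
    have update_case : (forall w', w' < w -> step c w' != c -> 0 < nmem s3 aOk (step c w') ->
         (wt c w + rmem s3 1 (step c w) <= wt c w' + rmem s3 1 (step c w'))%R) ->
        run b (update_min nx wx) s3 b (fun s4 => [/\ bellman c w.+1 (nset s4 vW 0 w.+1),
          forall j, i < j -> j < size q -> bellman (nth 0 q j) K (nset s4 vW 0 w.+1) &
          forall j, j < i -> j < size q ->
          nmem (nset s4 vW 0 w.+1) aOk (nth 0 q j) = (nth 0 q j == term) /\
          rmem (nset s4 vW 0 w.+1) 1 (nth 0 q j) = 0%R]).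
      move=> Bw.
      apply: run_seq; apply: run_rset => //.
      have -> : nval s3 (var vC) = c by [].
      have -> : rval s3 (RAdd wx (RGet 1 nx)) = (wt c w + rmem s3 1 (step c w))%R.
        by rewrite /= wx3 nx3.
      set v := (_ + _)%R; set s4 := rset _ _ _ _.
      have tab4 : tab s4 by split=> [a|]; [rewrite !inE => /or3P[] /eqP-> j|]; apply tab3.
      have nx4 : nval s4 nx = step c w by rewrite nx_val //= ?c3 ?w3.
      apply: run_seq; apply: run_nset => //; rewrite nx4; first by apply/reach_lt/ReachStep.
      have -> : nval s4 (var vC) = c by [].
      apply: run_nset => //.
      set s6 := nset _ vW _ _.
      have ok6 x : nmem s6 aOk x = if x == c then 1 else nmem s3 aOk x.
        by rewrite /s6 /= /upd /= c3.
      have nx6 x : nmem s6 aNxt x = if x == c then step c w else nmem s3 aNxt x.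
        by rewrite /s6 /= /upd /=.
      have v6 x : rmem s6 1 x = if x == c then v else rmem s3 1 x.
        by rewrite /s6 /= /upd /=.
      split.
      * split; rewrite ?ok6 ?v6 ?nx6 ?eqxx //.
          move=> _; right; exists w; rewrite ok6 v6 (negPf sw); split=> //.
        move=> w'; rewrite ltnS leq_eqVlt => /orP[/eqP-> _|w'w sw'].
          by rewrite ok6 v6 (negPf sw).
        rewrite ok6 v6 (negPf sw') => ok'; split=> //; exact: Bw.
      * move=> j ij jq; apply: bellman_agree (I3 j ij jq).
          by split; rewrite ?ok6 ?v6 ?nx6 neq_c // neq_ltn ij orbT.
        move=> w' w'K sw'; have [k' [jk' k'q ->]] := step_later jq w'K sw'.
        by split; rewrite ?ok6 ?v6 ?nx6 neq_c // neq_ltn (ltn_trans ij) ?orbT.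
      * move=> j ji jq; rewrite ok6 v6 neq_c ?neq_ltn ?ji //; exact: J3.
    apply: run_if => //.
      rewrite /cval /= c3 leqn0 => /eqP ok_c; apply: update_case => w' w'w sw' ok'.
      by have [] := B3 w' w'w sw' ok'; rewrite ok_c.
    rewrite /cval /= c3 -ltnNge => ok_c.
    apply: run_if => //; rewrite /cval /= c3 wx3 nx3.
      by move=> le_v; apply: skip_case.
    rewrite -ltNge => lt_v; apply: update_case => w' w'w sw' ok'.
    by have [_ /(lt_le_trans lt_v)/ltW] := B3 w' w'w sw' ok'.
  + split=> //; last by move=> j ji jq; apply: J2 => //; apply: ltnW.
    split=> //=; rewrite /upd /= ?okc ?vc; last by move=> ->; rewrite eqxx.
    by rewrite lt0b => /eqP; left.
  move=> s3 un3 [b3 I3 J3]; split=> // j; rewrite leq_eqVlt => /orP[/eqP<-//|]; exact: I3.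
- by move=> i a x s2; rewrite !inE => /orP[] /eqP->.
- split=> [j jq /(leq_ltn_trans jq)|j _ jq]; first by rewrite ltnn.
  by rewrite /s1 /= /upd /= val0 ok0; case: eqP.
move=> s2 un2 [I2 _]; apply: hQ.
  apply: unchanged_trans un1 _; apply: unchanged_sub un2 => a; rewrite !inE.
    by do !case: eqP => //.
  by do !case: eqP => //.
by move=> c cQ; rewrite -(nth_index 0 cQ); apply: I2; rewrite ?index_mem.
Qed.

Fixpoint wpath (c : nat) (ws : seq nat) : bool :=
  if ws is w :: ws' then [&& w < K, step c w != c & wpath (step c w) ws'] else c == term.

Fixpoint wsum (c : nat) (ws : seq nat) : R :=
  if ws is w :: ws' then (wt c w + wsum (step c w) ws')%R else 0%R.

Fixpoint wcodes (c : nat) (ws : seq nat) : seq nat :=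
  c :: if ws is w :: ws' then wcodes (step c w) ws' else [::].

Lemma bellman_lower s : (forall c, c \in q -> bellman c K s) ->
  forall ws c, c \in q -> wpath c ws -> 0 < nmem s aOk c /\ (rmem s 1 c <= wsum c ws)%R.
Proof.
move=> bel; elim=> [|w ws IH] c cQ /=.
  move=> /eqP cT; have [A _ C] := bel c cQ; split; first exact: C.
  have [[_ ->]//|[w [wK]]] := A (C cT).
  by rewrite cT step_term ?eqxx.
move=> /and3P[wK sw /IH[|okw vw]]; first exact: q_closed.
have [_ B _] := bel c cQ; have [okc vc] := B w wK sw okw; split=> //.
by apply: le_trans vc _; rewrite lerD2l.
Qed.

(** Following the stored successors must stop, as the level rises at each step and is at most [L].
    The trajectory is recorded because the output is read off along it. *)
Lemma bellman_upper s : (forall c, c \in q -> bellman c K s) ->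
  forall c, c \in q -> 0 < nmem s aOk c ->
  exists ws, [/\ wpath c ws, rmem s 1 c = wsum c ws &
    wcodes c ws = traject (nmem s aNxt) c (size ws).+1].
Proof.
move=> bel c; move: {2}(L - level c) (leqnn (L - level c)) => k.
have step_lev x w : x \in q -> w < K -> step x w != x ->
    level (step x w) = (level x).+1 /\ level x < L.
  move=> xQ wK sw; have := level_le (q_reach (q_closed xQ wK)).
  by case: (step_level (q_reach xQ) wK) => [h|->]; first by rewrite h eqxx in sw.
elim: k c => [|k IH] c lev cQ okc; have [A _ _] := bel c cQ;
    have [[cT v0]|[w [wK sw okw nxw vw]]] := A okc.
- by exists [::]; rewrite /= v0 cT eqxx.
- by have [_] := step_lev c w cQ wK sw; move: lev; lia.
- by exists [::]; rewrite /= v0 cT eqxx.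
have [levE levL] := step_lev c w cQ wK sw.
have [|ws [pw sumw cw]] := IH _ _ (q_closed cQ wK) okw; first by move: lev; rewrite levE; lia.
by exists (w :: ws); rewrite /= wK sw pw cw vw sumw /= nxw.
Qed.

End Dag.

(** * Bit masks *)

Definition bit (X i : nat) : nat := (X %/ 2 ^ i) %% 2.

Lemma bit_le1 X i : bit X i <= 1.
Proof. by rewrite -ltnS ltn_pmod. Qed.

Lemma bit_small X i : X < 2 ^ i -> bit X i = 0.
Proof. by move=> h; rewrite /bit divn_small. Qed.

Lemma bit_mod X m i : i < m -> bit (X %% 2 ^ m) i = bit X i.
Proof.
move=> im; rewrite /bit {2}(divn_eq X (2 ^ m)).
have -> : X %/ 2 ^ m * 2 ^ m = (X %/ 2 ^ m * 2 ^ (m - i.+1) * 2) * 2 ^ i.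
  by rewrite -!mulnA -expnS -expnD; congr (_ * 2 ^ _); lia.
by rewrite divnMDl ?expn_gt0 // modnMDl.
Qed.

(** Setting a clear bit produces no carry. *)
Lemma bit_add X w i : bit X w = 0 -> bit (X + 2 ^ w) i = bit X i + (i == w).
Proof.
move=> X0; case: (ltngtP i w) => [iw|wi|->]; rewrite ?addn0.
- rewrite -(bit_mod (X + 2 ^ w) (ltnSn i)) -(bit_mod X (ltnSn i)) -modnDmr.
  by rewrite (eqP (dvdn_exp2l 2 iw)) addn0.
- rewrite /bit; suff -> : (X + 2 ^ w) %/ 2 ^ i = X %/ 2 ^ i by [].
  rewrite -(subnKC wi) expnD !divnMA; congr (_ %/ _).
  rewrite expnS mulnC !divnMA divnDr ?dvdnn // divnn expn_gt0 /=.
  by move: X0; rewrite /bit => X0; rewrite (divn_eq (X %/ 2 ^ w) 2) X0; lia.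
- rewrite X0 /bit divnDr ?dvdnn // divnn expn_gt0 /=.
  by move: X0; rewrite /bit; lia.
Qed.

Lemma bit_inj m X Y : X < 2 ^ m -> Y < 2 ^ m ->
  (forall i, i < m -> bit X i = bit Y i) -> X = Y.
Proof.
elim: m X Y => [|m IH] X Y; first by rewrite expn0 !ltnS !leqn0 => /eqP-> /eqP->.
rewrite !expnSr => hX hY h.
rewrite (divn_eq X 2) (divn_eq Y 2).
have := h 0 isT; rewrite /bit expn0 !divn1 => ->.
rewrite (IH (X %/ 2) (Y %/ 2)) ?ltn_divLR // => i im.
by have := h i.+1 im; rewrite /bit expnS !divnMA.
Qed.

Lemma bit_ones s i : bit (2 ^ s).-1 i = (i < s).
Proof.
elim: s => [|s IH]; first by rewrite expn0 bit_small // expn_gt0.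
have -> : (2 ^ s.+1).-1 = (2 ^ s).-1 + 2 ^ s by rewrite expnS; have := expn_gt0 2 s; lia.
rewrite bit_add; last by rewrite bit_small // prednK ?expn_gt0.
by rewrite IH; case: ltngtP => //; lia.
Qed.

Definition bitcount (m X : nat) : nat := \sum_(i < m) bit X i.

Lemma bitcount_add m X w : w < m -> bit X w = 0 ->
  bitcount m (X + 2 ^ w) = (bitcount m X).+1.
Proof.
move=> wm X0; rewrite /bitcount (eq_bigr (fun i : 'I_m => bit X i + (i == w :> nat))).
  rewrite big_split /= -addn1; congr addn.
  rewrite (bigD1 (Ordinal wm)) //= eqxx big1 // => i ne.
  by apply/eqP; rewrite eqb0; apply: contra ne => /eqP iw; apply/eqP/val_inj.
by move=> i _; apply: bit_add.
Qed.

Lemma bitcount_le m X : bitcount m X <= m.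
Proof.
rewrite -[leqRHS](card_ord m) -sum1_card; apply: leq_sum => i _; exact: bit_le1.
Qed.

Section Mask.
Variable N : nat.
Implicit Types A : {set 'I_N}.

Definition bitmask A : nat := \sum_(i in A) 2 ^ i.

Lemma bitmaskU1 A w : w \notin A -> bitmask (w |: A) = bitmask A + 2 ^ w.
Proof. by move=> wA; rewrite /bitmask big_setU1 // addnC. Qed.

Lemma bitmask_lt A : bitmask A < 2 ^ N.
Proof.
apply: (@leq_ltn_trans (\sum_(i < N) 2 ^ i)).
  by rewrite /bitmask big_mkcond; apply: leq_sum => i _; case: ifP.
have -> : \sum_(i < N) 2 ^ i = (2 ^ N).-1.
  have -> : (2 ^ N).-1 = (2 ^ N).-1 * 1 by rewrite muln1.
  by rewrite predn_exp mul1n muln1.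
by rewrite prednK ?expn_gt0.
Qed.

Lemma bit_mask A (i : nat) : bit (bitmask A) i = [exists j in A, j == i :> nat].
Proof.
move E : #|A| => k; elim: k A E i => [|k IH] A E i.
  have -> : A = set0 by apply/eqP; rewrite -cards_eq0 E.
  rewrite /bitmask big_set0 bit_small ?expn_gt0 //.
  by apply/esym/eqP; rewrite eqb0; apply/exists_inP => -[j]; rewrite inE.
have [w wA] : exists w, w \in A by apply/set0Pn; rewrite -card_gt0 E.
have Ew : #|A :\ w| = k by move: E; rewrite (cardsD1 w) wA => -[].
have w0 : bit (bitmask (A :\ w)) w = 0.
  rewrite IH //; apply/eqP; rewrite eqb0; apply/exists_inP => -[j jA /eqP jw].
  by move: jA; rewrite !inE (val_inj jw) eqxx.
rewrite -(setD1K wA) bitmaskU1 ?inE ?eqxx // bit_add // IH // setD1K //.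
case: eqP => [->|iw].
  have -> : [exists j in A, j == w :> nat] by apply/exists_inP; exists w.
  by move: w0; rewrite IH // => ->.
rewrite addn0; congr nat_of_bool; apply/exists_inP/exists_inP => -[j jA /eqP ji]; exists j => //;
  try exact/eqP.
  by move: jA; rewrite inE => /andP[].
by rewrite !inE jA andbT; apply/eqP => jw; case: iw; rewrite -ji jw.
Qed.

Lemma bit_mask_ord A (i : 'I_N) : bit (bitmask A) i = (i \in A).
Proof.
rewrite bit_mask; congr nat_of_bool; apply/exists_inP/idP => [[j jA /eqP/val_inj<-]|iA] //.
by exists i.
Qed.

Lemma bit_mask_ge A i : N <= i -> bit (bitmask A) i = 0.
Proof.
move=> Ni; apply: bit_small; apply: leq_trans (bitmask_lt A) _.
by rewrite leq_exp2l.
Qed.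

(** The [s.+1] lowest bits are [s] ones below a zero exactly when [s] is the least index outside
    [A]; one remainder thus performs the test. The value [s = N] is allowed and means that [A] is
    full. *)
Lemma bitmask_prefix A s : s <= N ->
  (bitmask A %% 2 ^ s.+1 == (2 ^ s).-1) =
  [forall i : 'I_N, (i < s) ==> (i \in A)] && [forall i in A, i != s :> nat].
Proof.
move=> sN; apply/eqP/andP => [E|[/forall_inP h1 /forall_inP h2]].
  have bitE i : i <= s -> bit (bitmask A) i = (i < s).
    by move=> is_; rewrite -(bit_mod (bitmask A) (m := s.+1)) // E bit_ones.
  split; apply/forall_inP => i.
    by move=> is_; have := bitE i (ltnW is_); rewrite bit_mask_ord is_; case: (i \in A).
  move=> iA; apply/eqP => is_; have := bitE i; rewrite is_ leqnn ltnn => /(_ isT).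
  by rewrite -is_ bit_mask_ord iA.
apply: (@bit_inj s.+1); first by rewrite ltn_pmod // expn_gt0.
  by rewrite expnS; have := expn_gt0 2 s; lia.
move=> i; rewrite ltnS => is_; rewrite bit_mod // bit_ones.
have [iN|Ni] := ltnP i N; last by rewrite bit_mask_ge // ltnNge (leq_trans sN).
move: is_; rewrite leq_eqVlt => /orP[/eqP Es|lt_is].
  have -> : (i < s) = false by rewrite Es ltnn.
  rewrite (bit_mask_ord A (Ordinal iN)).
  by case iA: (_ \in A) => //; have /eqP[] := h2 _ iA.
by rewrite (bit_mask_ord A (Ordinal iN)) (h1 (Ordinal iN)) // lt_is.
Qed.

Lemma bitmask_setT A : (bitmask A == (2 ^ N).-1) = (A == setT).
Proof.
have -> : (bitmask A == (2 ^ N).-1) = (bitmask A %% 2 ^ N.+1 == (2 ^ N).-1).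
  by rewrite modn_small // (leq_trans (bitmask_lt A)) // leq_exp2l.
rewrite bitmask_prefix //; apply/andP/eqP => [[/forall_inP h _]|->].
  by apply/setP => i; rewrite inE h.
split; first by apply/forall_inP => i; rewrite inE.
by apply/forall_inP => i _; rewrite neq_ltn ltn_ord.
Qed.

End Mask.

Lemma map_next (T : eqType) (p : seq T) : uniq p -> map (next p) p = rot 1 p.
Proof.
case: p => [|x p] // up; apply: (@eq_from_nth _ x); first by rewrite size_map size_rot.
move=> i; rewrite size_map => ip; rewrite (nth_map x) //.
rewrite next_nth mem_nth // index_uniq // rot1_cons nth_rcons; move: ip => /= ip.
case: ltnP => // pi; have -> : i = size p by lia.
by rewrite eqxx nth_default.
Qed.

Local Notation aPow := 3 (only parsing).

Definition powers : cmd :=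
  Seq (NSet aPow (Lit 0) (Lit 1))
    (for_loop vW (Op Add (var 0) (Lit 1))
      (NSet aPow (Op Add (var vW) (Lit 1))
        (Op Add (NGet aPow (var vW)) (NGet aPow (var vW))))).

Lemma run_powers (R : numDomainType) (b n : nat) (s : state R) W (Q : _ -> Prop) :
  0 < b -> n.+2 <= b -> nmem s 0 0 = n -> n.+2 * b <= W ->
  (forall s', unchanged [:: aPow; vW] [::] s s' ->
     (forall i, i <= n.+1 -> nmem s' aPow i = 2 ^ i) -> Q s') ->
  run b powers s W Q.
Proof.
move=> b_gt0 nb sn leW hQ.
have bW : b <= W by apply: leq_trans leW; rewrite mulSn leq_addr.
have lt2 i : i <= n.+1 -> 2 ^ i < 2 ^ b by move=> h; rewrite ltn_exp2l // (leq_trans _ nb).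
apply: run_seq; apply: run_nset => //; first exact: (lt2 0).
set s1 := nset _ _ _ _.
have un1 : unchanged [:: aPow; vW] [::] s s1.
  by split=> // a; rewrite inE negb_or => /andP[/negPf h _] i; rewrite /s1 /= /upd h.
have un2 s2 : unchanged [:: vW; aPow] [::] s1 s2 -> unchanged [:: aPow; vW] [::] s s2.
  move=> h; apply: unchanged_trans un1 _; apply: unchanged_sub h => // a.
  by rewrite !inE orbC.
apply: (run_for b_gt0 (W := b) (k := n.+1) (I := fun i s' =>
    forall j, j <= i -> nmem s' aPow j = 2 ^ j)) => //.
- by apply: ltn_trans (lt2 n.+1 (leqnn _)); apply: ltn_expl.
- by move=> s' /un2 un; rewrite /= un.1 // sn addn1.
- move=> i s' un lt_i wi h; apply: run_nset => //=; rewrite wi h // addnn -mul2n -expnS.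
    exact: lt2.
  by move=> j; rewrite /= /upd /= addn1 leq_eqVlt => /orP[/eqP->|ji];
    rewrite ?eqxx // ltn_eqF ?h.
- by move=> j; rewrite leqn0 => /eqP->.
by move=> s' /un2 un h; apply: hQ.
Qed.

(** * The travelling salesman problem *)

Lemma traced_start (N : nat) (e : rel 'I_N) (o : 'I_N) :
  val o = 0 -> traced e 0 [set o] o.
Proof.
move=> o0; split; last (exists id; split=> [x|x y _ _ _ _ //]).
- by move=> i; rewrite leqn0 inE => /eqP i0; apply/eqP/val_inj; apply: etrans i0 (esym o0).
- by rewrite inE.
by rewrite inE => /eqP->; rewrite -[nat_of_ord o]/(val o) o0.
Qed.

(** The new predecessor of [w] is [v], which by assumption nobody else has as predecessor; so
    injectivity survives. *)
Lemma traced_extend (N : nat) (e : rel 'I_N) s (A : {set 'I_N}) v w :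
  traced e s A v -> e v w -> w \notin A -> traced e s (w |: A) w.
Proof.
move=> [pre vA [p [pP pI]]] evw wA; split.
- by move=> i /pre iA; rewrite !inE iA orbT.
- by rewrite setU11.
have xA x : x \in w |: A -> (x == w) = false -> x \in A by rewrite !inE => /orP[->|].
exists (fun x => if x == w then v else p x); split=> [x xwA sx|x y xwA ywA sx sy].
  case: eqP => [->|/eqP/negPf xw].
    by rewrite !inE vA orbT; split=> //; apply: contraNneq wA => <-.
  have [pA pv epx] := pP x (xA x xwA xw) sx.
  by split=> //; rewrite ?inE ?pA ?orbT //; apply: contraNneq wA => <-.
case: ifP => [/eqP->|xw]; case: ifP => [/eqP->|yw] //; last by apply: pI => //; apply: xA.
  by have [_ /eqP pv _] := pP y (xA y ywA yw) sy => /esym.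
by have [_ /eqP pv _] := pP x (xA x xwA xw) sx.
Qed.

(** [w] joins the initial segment and thus needs no predecessor, while the elements after it keep
    theirs. This is why [traced] exempts a whole segment. *)
Lemma traced_restart (N : nat) (e : rel 'I_N) s (A : {set 'I_N}) v (w : 'I_N) :
  traced e s A v -> (forall i : 'I_N, i < w -> i \in A) -> w \notin A ->
  traced e w (w |: A) w.
Proof.
move=> [pre vA [p [pP pI]]] low wA.
have sw : s < w by rewrite ltnNge; apply: contra wA => /pre.
split.
- move=> i; rewrite leq_eqVlt => /orP[/eqP/val_inj->|/low iA]; first exact: setU11.
  by rewrite !inE iA orbT.
- exact: setU11.
have xA (x : 'I_N) : x \in w |: A -> w < x -> x \in A.
  by rewrite !inE => /orP[/eqP->|//]; rewrite ltnn.
exists p; split=> [x xwA wx|x y xwA ywA wx wy].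
  have [pA pv epx] := pP x (xA x xwA wx) (ltn_trans sw wx).
  by split=> //; rewrite ?inE ?pA ?orbT //; apply: contraNneq wA => <-.
by apply: pI; rewrite ?xA // (ltn_trans sw).
Qed.

Definition traced_sets (N : nat) (e : rel 'I_N) (s : nat) : {set {set 'I_N}} :=
  [set A | `[< exists v, traced e s A v >]].

Lemma matrix_cellsE (T : Type) (x0 : T) (n : nat) (f : 'I_n -> 'I_n -> T) (i j : 'I_n) :
  matrix_cells x0 f (i * n + j) = f i j.
Proof.
have n_gt0 : 0 < n by apply: leq_ltn_trans (ltn_ord i).
rewrite /matrix_cells divnMDl // divn_small // addn0 modnMDl modn_small //.
have insubE (k : 'I_n) : insub (k : nat) = Some k by exact: valK.
by rewrite !insubE.
Qed.

Lemma matrix_cells_le1 (n : nat) (f : 'I_n -> 'I_n -> bool) k :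
  matrix_cells 0 (fun i j => nat_of_bool (f i j)) k <= 1.
Proof.
by rewrite /matrix_cells; case: insub => // i; case: insub => // j; case: (f i j).
Qed.

(** Makes the assumption built into [run] available, as is needed when a value copied from memory
    has to fit in a cell. *)
Lemma run_bounded (R : numDomainType) b (c : cmd) (s : state R) W Q :
  (bounded b s -> run b c s W Q) -> run b c s W Q.
Proof. by move=> h bs; apply: (h bs bs). Qed.

Lemma pow2_double m : 2 ^ (2 * m + 3) = 2 ^ m * 2 ^ m * 8.
Proof. by rewrite mul2n -addnn !expnD. Qed.

Definition bit_expr (e i : nexpr) : nexpr := Op Mod (Op Div e (NGet aPow i)) (Lit 2).

Local Notation vN := 0 (only parsing).
Local Notation aAdj := 1 (only parsing).
Local Notation aOut := 2 (only parsing).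

(* The code of a state [(X, v)] is [X * n + v].  A label [w < n] moves to vertex [w],
   label [n] closes the tour and leads to the final state, in which bit [n] of [X] is set
   as well; a label that is not applicable leaves the code unchanged. *)
Definition tsp_next : nexpr :=
  let X := Op Div (var vC) (var vN) in
  let v := Op Mod (var vC) (var vN) in
  let t := Op Mod (var vW) (var vN) in
  let valid := Op Mul (Op Mul (NGet aAdj (Op Add (Op Mul v (var vN)) t))
                         (Op Defs.Sub (Lit 1) (bit_expr X (var vW))))
      (Op Defs.Sub (Lit 1) (Op Mul (eq_expr (var vW) (var vN))
         (neq_expr (Op Add X (Lit 1)) (NGet aPow (var vN))))) in
  Op Add (var vC) (Op Mul valid
    (Op Defs.Sub (Op Add (Op Mul (Op Add X (NGet aPow (var vW))) (var vN)) t) (var vC))).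

Definition tsp_labels : nexpr := Op Add (var vN) (Lit 1).

Definition tsp_end : nexpr :=
  Op Mul (Op Defs.Sub (NGet aPow (Op Add (var vN) (Lit 1))) (Lit 1)) (var vN).

Definition tsp_weight : rexpr :=
  RGet 0 (Op Add (Op Mul (Op Mod (var vC) (var vN)) (var vN)) (Op Mod (var vW) (var vN))).

Definition emit : cmd :=
  Seq (NSet aOut (Lit 0) (Lit 1)) (Seq (NSet vC (Lit 0) (var vN))
    (for_loop vW (var vN)
      (Seq (NSet aOut (Op Add (var vW) (Lit 1)) (Op Mod (var vC) (var vN)))
           (NSet vC (Lit 0) (NGet aNxt (var vC)))))).

Definition tsp : cmd :=
  If (NLe (Lit 3) (var vN))
    (Seq powers (Seq (explore tsp_next tsp_labels (var vN))
      (Seq (min_paths tsp_next tsp_labels tsp_end tsp_weight)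
        (If (NLe (Lit 1) (NGet aOk (var vN))) emit Skip))))
    Skip.

Section Tsp.
Variables (R : realDomainType) (n : nat) (G : graph n) (cost : {set 'I_n} -> R).
Hypothesis n_ge3 : 2 < n.

Let n_gt0 : 0 < n. Proof. exact: ltn_trans n_ge3. Qed.
Let o : 'I_n := Ordinal n_gt0.
Let adjc : nat -> nat := matrix_cells 0 (fun i j : 'I_n => nat_of_bool (adj G i j)).

(** For [w = n] the residue [w %% n] is 0, so the adjacency tested is that to the starting
    vertex. *)
Definition tsp_valid (c w : nat) : nat :=
  adjc (c %% n * n + w %% n) * (1 - bit (c %/ n) w) * (1 - (w == n) * (c %/ n + 1 != 2 ^ n)).

Definition tsp_step (c w : nat) : nat :=
  c + tsp_valid c w * ((c %/ n + 2 ^ w) * n + w %% n - c).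

Definition tsp_term : nat := (2 ^ n.+1 - 1) * n.

Let K := n.+1.
Let wcell : nat -> R := matrix_cells 0%R (fun i j => if adj G i j then cost [set i; j] else 0%R).
Let wt (c w : nat) : R := wcell (c %% n * n + w %% n).

Definition tsp_tables (s : state R) : Prop :=
  [/\ nmem s vN 0 = n, (forall k, nmem s aAdj k = adjc k),
      (forall i, i <= n.+1 -> nmem s aPow i = 2 ^ i) & (forall k, rmem s 0 k = wcell k)].

Lemma tsp_tables_tables s0 s : tsp_tables s0 -> tables s0 s -> tsp_tables s.
Proof.
move=> [h0 h1 h3 hr] [tn tr]; split=> [|k|i hi|k]; rewrite ?tr ?tn ?inE //; exact: h3.
Qed.

Lemma tsp_next_val s : tsp_tables s -> nmem s vW 0 < K ->
  nval s tsp_next = tsp_step (nmem s vC 0) (nmem s vW 0).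
Proof.
move=> [h0 h1 h3 _] wK.
set c := nmem s vC 0; set w := nmem s vW 0 in wK *.
have -> : nval s tsp_next = c + nmem s aAdj (c %% nmem s vN 0 * nmem s vN 0 + w %% nmem s vN 0) *
    (1 - (c %/ nmem s vN 0 %/ nmem s aPow w) %% 2) *
    (1 - nval s (eq_expr (var vW) (var vN)) *
      nval s (neq_expr (Op Add (Op Div (var vC) (var vN)) (Lit 1)) (NGet aPow (var vN)))) *
    ((c %/ nmem s vN 0 + nmem s aPow w) * nmem s vN 0 + w %% nmem s vN 0 - c) by [].
rewrite eq_exprE neq_exprE /= -/c -/w h0 h1 (h3 _ (leqnSn n)) h3 //.
exact: ltnW.
Qed.

Lemma tsp_step_valid c w : w < K ->
  tsp_step c w = c \/
  [/\ tsp_valid c w = 1, bit (c %/ n) w = 0 & tsp_step c w = (c %/ n + 2 ^ w) * n + w %% n].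
Proof.
move=> wK; have := matrix_cells_le1 (adj G) (c %% n * n + w %% n); rewrite -/adjc => a1.
have := bit_le1 (c %/ n) w => b1.
case v0 : (tsp_valid c w) => [|k]; first by left; rewrite /tsp_step v0 addn0.
right; have [vE bE] : tsp_valid c w = 1 /\ bit (c %/ n) w = 0.
  move: v0; rewrite /tsp_valid; move: (adjc _) (bit _ _) a1 b1 => [|[|?]] [|[|?]] // _ _.
  by case: eqP; case: eqP.
split; rewrite -?v0 // /tsp_step vE mul1n subnKC //.
(* The new code is at least the old one, so the truncated difference in [tsp_step] is exact. *)
rewrite [leqLHS](divn_eq c n) mulnDl -addnA leq_add2l.
apply: leq_trans (leq_addr _ _).
apply: leq_trans (leq_pmull n (_ : 0 < 2 ^ w)); rewrite ?expn_gt0 //.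
by rewrite ltnW // ltn_pmod.
Qed.

(** Bit [n] marks the closed tour, hence [n.+1] bits. *)
Let level c := bitcount n.+1 (c %/ n).

Lemma tsp_level c w : w < K -> tsp_step c w = c \/ level (tsp_step c w) = (level c).+1.
Proof.
move=> wK; have [->|[_ b0 ->]] := tsp_step_valid c wK; [by left|right].
by rewrite /level divnMDl // (divn_small (ltn_pmod w n_gt0)) addn0 bitcount_add.
Qed.

Lemma tsp_step_term w : w < K -> tsp_step tsp_term w = tsp_term.
Proof.
move=> wK; have [//|[_]] := tsp_step_valid tsp_term wK.
by rewrite /tsp_term mulnK // subn1 bit_ones wK.
Qed.

Definition tcode (A : {set 'I_n}) (v : 'I_n) : nat := bitmask A * n + v.

Lemma tcode_div A v : tcode A v %/ n = bitmask A.
Proof. by rewrite /tcode divnMDl // (divn_small (ltn_ord v)) addn0. Qed.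

Lemma tcode_mod A v : tcode A v %% n = v.
Proof. by rewrite /tcode modnMDl modn_small. Qed.

Lemma tcode_term A v : tcode A v != tsp_term.
Proof.
apply/eqP => /(congr1 (divn^~ n)); rewrite tcode_div /tsp_term mulnK // => E.
have := bitmask_lt A; rewrite E expnS; have := expn_gt0 2 n.
by move: (2 ^ n) => x; lia.
Qed.

Lemma tsp_step_ord A v (w : 'I_n) :
  tsp_step (tcode A v) w = if adj G v w && (w \notin A) then tcode (w |: A) w else tcode A v.
Proof.
have wK : w < K by apply: ltnW; rewrite ltnS.
have valE : tsp_valid (tcode A v) w = adj G v w && (w \notin A).
  rewrite /tsp_valid tcode_mod tcode_div modn_small // /adjc matrix_cellsE bit_mask_ord.
  by rewrite (ltn_eqF (ltn_ord w)) /= mul0n muln1; case: adj; case: (w \in A).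
case: (tsp_step_valid (tcode A v) wK) => [h|[]].
  rewrite h; case: ifP => // ok; move: h; rewrite /tsp_step valE ok mul1n tcode_div.
  rewrite modn_small // /tcode => h.
  have := expn_gt0 2 w; move: h (ltn_ord v) (ltn_ord w) n_gt0; move: (2 ^ w) (bitmask A) => x y.
  by clear; nia.
rewrite valE; case: ifP => // /andP[_ wA] _ _ ->.
by rewrite tcode_div modn_small // /tcode bitmaskU1.
Qed.

Lemma tsp_step_close A v :
  tsp_step (tcode A v) n = if adj G v o && (A == setT) then tsp_term else tcode A v.
Proof.
have valE : tsp_valid (tcode A v) n = adj G v o && (A == setT).
  rewrite /tsp_valid tcode_mod tcode_div modnn.
  have -> : v * n + 0 = v * n + o by [].
  rewrite /adjc matrix_cellsE bit_mask_ge // eqxx mul1n -bitmask_setT subn0 muln1.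
  have -> : (bitmask A + 1 != 2 ^ n) = (bitmask A != (2 ^ n).-1).
    by have := expn_gt0 2 n; case: (2 ^ n) => //= x _; rewrite addn1.
  by case: adj; case: eqP.
case: (tsp_step_valid (tcode A v) (leqnn K)) => [h|[]].
  rewrite h; case: ifP => // ok; move: h; rewrite /tsp_step valE ok mul1n tcode_div.
  rewrite modnn /tcode => h.
  have := expn_gt0 2 n; move: h (ltn_ord v) n_gt0; move: (2 ^ n) (bitmask A) => x y.
  by clear; nia.
rewrite valE; case: ifP => // /andP[_ /eqP AT] _ _ ->.
rewrite tcode_div modnn addn0 /tsp_term; congr (_ * _).
have := bitmask_setT A; rewrite AT eqxx => /eqP->.
by rewrite expnS; have := expn_gt0 2 n; lia.
Qed.

Lemma tsp_start : tcode [set o] o = n.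
Proof. by rewrite /tcode /bitmask big_set1 addn0 mul1n. Qed.

Lemma tsp_reach c : reach n K tsp_step c ->
  c = tsp_term \/ exists A v, traced (adj G) 0 A v /\ c = tcode A v.
Proof.
elim=> {c} [|c w _ [->|[A [v [tr ->]]]] wK].
- by right; exists [set o], o; split; [exact: traced_start|rewrite tsp_start].
- by left; apply: tsp_step_term.
move: wK; rewrite ltnS leq_eqVlt => /orP[/eqP->|wn].
  by rewrite tsp_step_close; case: ifP => _; [left|right; exists A, v].
right; rewrite (tsp_step_ord A v (Ordinal wn)).
case: ifP => [/andP[a wA]|_]; last by exists A, v.
by exists (Ordinal wn |: A), (Ordinal wn); split=> //; apply: traced_extend a wA.
Qed.

(** Sets times last vertices, and one for the final state. *)
Definition tsp_bound : nat := (#|traced_sets (adj G) 0| * n).+1.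

Lemma tsp_reach_card q : uniq q -> (forall c, c \in q -> reach n K tsp_step c) ->
  size q <= tsp_bound.
Proof.
move=> uq rq.
pose F := traced_sets (adj G) 0.
pose l := tsp_term :: [seq tcode p.1 p.2 | p <- enum (setX F [set: 'I_n])].
have -> : tsp_bound = size l.
  by rewrite /= size_map -cardE cardsX cardsT card_ord.
apply: uniq_leq_size => // c /rq/tsp_reach[->|[A [v [tr ->]]]]; rewrite inE ?eqxx //.
apply/orP; right; apply/mapP; exists (A, v) => //=.
by rewrite mem_enum !inE /= andbT; apply/asboolP; exists v.
Qed.

Lemma tsp_bound_lt : tsp_bound < 2 ^ (2 * n + 3).
Proof.
have : #|traced_sets (adj G) 0| <= 2 ^ n.
  by rewrite (leq_trans (max_card _)) // -cardsT -powersetT card_powerset cardsT card_ord.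
rewrite pow2_double /tsp_bound; have := ltn_expl n (ltnSn 1).
by move: (2 ^ n) #|_| => x y; nia.
Qed.

Lemma tsp_reach_lt c : reach n K tsp_step c -> c < 2 ^ (2 * n + 3).
Proof.
rewrite pow2_double; have h := ltn_expl n (ltnSn 1).
move=> /tsp_reach[->|[A [v [_ ->]]]].
  by rewrite /tsp_term expnS; move: h; move: (2 ^ n) => x; nia.
have := bitmask_lt A; rewrite /tcode; have := ltn_ord v; move: h; move: (2 ^ n) (bitmask A) => x y.
by nia.
Qed.

Fixpoint tour_weight (v : 'I_n) (p : seq 'I_n) : R :=
  if p is w :: p' then (cost [set v; w] + tour_weight w p')%R else cost [set v; o].

Let labels (p : seq 'I_n) : seq nat := rcons (map val p) n.

(** [wpath] admits no void labels, so each label extends the path or closes the tour; after closing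
    all labels are void, which makes [n] the last one. *)
Lemma wpath_tour ws A v : wpath K tsp_term tsp_step (tcode A v) ws ->
  exists p, [/\ ws = labels p, path (adj G) v p /\ uniq p, (forall x, x \in p -> x \notin A),
     A :|: [set x in p] = setT & adj G (last v p) o].
Proof.
elim: ws A v => [|w ws IH] A v /=; first by rewrite (negPf (tcode_term A v)).
move=> /and3P[]; rewrite ltnS leq_eqVlt => /orP[/eqP->|wn].
  rewrite tsp_step_close; case: ifP => [/andP[avo /eqP AT] _|_]; last by rewrite eqxx.
  case: ws {IH} => [_|w' ws /= /and3P[w'K]]; last by rewrite tsp_step_term ?eqxx.
  exists [::]; split=> //.
  by apply/setP => x; rewrite !inE AT inE.
rewrite (tsp_step_ord A v (Ordinal wn)); case: ifP => [/andP[avw wA] _|_]; last by rewrite eqxx.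
move=> /IH[p [-> [pp up] dp cp lp]]; exists (Ordinal wn :: p); split=> //.
- by rewrite /= avw pp up !andbT; split=> //; apply/negP => /dp; rewrite setU11.
- by move=> x; rewrite inE => /orP[/eqP->//|/dp]; rewrite !inE negb_or => /andP[].
- by rewrite -cp; apply/setP => x; rewrite !inE orbCA orbA.
Qed.

Lemma tour_wpath p (A : {set 'I_n}) v :
  path (adj G) v p -> uniq p -> (forall x, x \in p -> x \notin A) ->
  A :|: [set x in p] = setT -> adj G (last v p) o ->
  [/\ wpath K tsp_term tsp_step (tcode A v) (labels p),
      wsum tsp_step wt (tcode A v) (labels p) = tour_weight v p &
      [seq c %% n | c <- take (size p).+1 (wcodes tsp_step (tcode A v) (labels p))]
        = map val (v :: p)].
Proof.
have wtE A' (v' w' : 'I_n) : adj G v' w' -> wt (tcode A' v') w' = cost [set v'; w'].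
  by move=> a; rewrite /wt tcode_mod modn_small // /wcell matrix_cellsE a.
elim: p A v => [|w p IH] A v /=.
  move=> _ _ _ cov avo.
  have AT : A = setT by rewrite -cov; apply/setP => x; rewrite !inE orbF.
  rewrite ltnS leqnn tsp_step_close avo AT eqxx /= tcode_mod !eqxx eq_sym tcode_term addr0.
  split=> //; rewrite -(wtE setT v o avo) /wt modnn (modn_small (ltn_ord o)) //.
move=> /andP[avw pp] /andP[wp up]; move=> dp cov lp.
have wA := dp w (mem_head w p).
have [||pI sI cI] := IH (w |: A) w pp up _ _ lp.
- move=> x xp; rewrite !inE negb_or dp ?inE ?xp ?orbT // andbT.
  by apply: contraNneq wp => <-.
- by rewrite -cov; apply/setP => x; rewrite !inE orbCA orbA.
rewrite tsp_step_ord avw wA /= tcode_mod.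
rewrite pI sI (leqW (ltn_ord w)) wtE //; split=> //; last by move: cI => /= ->.
rewrite andbT; apply/eqP => /(congr1 (divn^~ n)); rewrite !tcode_div bitmaskU1 //.
by apply/eqP; rewrite -[X in _ != X]addn0 eqn_add2l expn_eq0.
Qed.

(** [cycle_weight] sums over a set of edges, so the edges leaving distinct vertices must be
    distinct. Two equal ones would make their vertices successors of each other, that is [i + 2 = i]
    modulo [n], which [n >= 3] excludes. *)
Lemma tour_weightE p : uniq (o :: p) -> size (o :: p) = n ->
  cycle_weight cost (o :: p) = tour_weight o p.
Proof.
set q := o :: p => uq sq; rewrite /cycle_weight /cycle_edges.
rewrite big_imset /=; last first.
  move=> x y xq yq /setP E; case: (eqVneq x y) => // xy.
  have yx : y = next q x.
    by have := E y; rewrite !inE eqxx [y == x]eq_sym (negPf xy) => /eqP.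
  have xny : x = next q y.
    by have := E x; rewrite !inE eqxx (negPf xy) => /esym/eqP.
  exfalso; clear E.
  have [i [iq xi]] : exists i, i < n /\ x = nth o q i.
    by exists (index x q); rewrite nth_index // -[X in _ < X]sq index_mem.
  have nthn k : k < n -> next q (nth o q k) = nth o q (k.+1 %% n).
    move=> kn; rewrite -[next q _](nth_map o o (next q)) ?sq // map_next //.
    rewrite /q rot1_cons nth_rcons -/q; move: sq => /= sq.
    case: ltnP => [kp|pk]; first by rewrite modn_small // -sq ltnS.
    have -> : k = size p by lia.
    by rewrite eqxx sq modnn.
  have i1 : i.+1 %% n < n by rewrite ltn_pmod.
  have : nth o q i = nth o q ((i.+1 %% n).+1 %% n).
    by rewrite -nthn // -nthn // -xi -yx -xny.
  move/eqP; rewrite nth_uniq ?sq ?ltn_pmod // => /eqP.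
  rewrite -addn1 modnDml addn1 -addn2 => E.
  have : i + 0 == i + 2 %[mod n] by rewrite addn0 -E modn_small.
  by rewrite eqn_modDl !modn_small.
rewrite -(big_uniq _ uq) /=.
have zipE (r r' : seq 'I_n) (f : 'I_n -> 'I_n) : r' = map f r ->
    (\sum_(x <- r) cost [set x; f x] = \sum_(xy <- zip r r') cost [set xy.1; xy.2])%R.
  by move=> ->; elim: r => [|x r IH] /=; rewrite ?big_nil // !big_cons IH.
rewrite (zipE q (rot 1 q) (next q)) ?map_next // rot1_cons {uq sq zipE} /q.
by elim: p {1 3}o => [|y p IH] x /=; rewrite big_cons ?big_nil ?addr0 ?IH.
Qed.

Lemma ham_cycle_tour p : uniq (o :: p) ->
  ham_cycle G (o :: p) = [&& path (adj G) o p,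
     [set o] :|: [set x in p] == setT & adj G (last o p) o].
Proof.
move=> uq; rewrite /ham_cycle n_ge3 uq /= rcons_path.
have op : o \notin p by case/andP: uq.
have card_p : #|[set o] :|: [set x in p]| = (size p).+1.
  rewrite cardsU1 inE op -(card_uniqP (_ : uniq p)) ?cardsE //.
  by case/andP: uq.
have -> : ([set o] :|: [set x in p] == setT) = ((size p).+1 == n).
  have le_n : (size p).+1 <= n by rewrite -card_p -[leqRHS]card_ord max_card.
  by rewrite eqEcard subsetT cardsT card_ord card_p eqn_leq le_n.
by case: path; rewrite ?andbF //= andbC.
Qed.

(** The dynamic program only knows tours from vertex 0, which is no loss: rotation preserves the
    edge set. *)
Lemma ham_cycle_rot q : ham_cycle G q ->
  exists p, [/\ uniq (o :: p), ham_cycle G (o :: p) &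
    cycle_weight cost (o :: p) = cycle_weight cost q].
Proof.
move=> /and4P[_ uq /eqP sq cq].
have oq : o \in q.
  have sz : size (enum 'I_n) <= size q by rewrite size_enum_ord sq.
  have sub : {subset q <= enum 'I_n} by move=> x; rewrite mem_enum.
  by have [_ ->] := uniq_min_size uq sub sz; rewrite mem_enum.
have [i p qE] := rot_to oq; exists p.
have up : uniq (o :: p) by rewrite -qE rot_uniq.
split=> //.
  by rewrite /ham_cycle n_ge3 up -qE size_rot sq eqxx rot_cycle.
rewrite -qE /cycle_weight; suff -> : cycle_edges (rot i q) = cycle_edges q by [].
apply/setP => e; apply/imsetP/imsetP => -[v vq ->]; exists v; rewrite ?(next_rot i uq) //.
  by move: vq; rewrite mem_rot.
by rewrite mem_rot.
Qed.

Lemma run_emit b (s : state R) W (Q : _ -> Prop) :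
  0 < b -> n < 2 ^ b -> n.+1 * b <= W -> nmem s vN 0 = n ->
  (forall s', output s' 0 = 1 ->
     [seq output s' i | i <- iota 1 n] = [seq c %% n | c <- traject (nmem s aNxt) n n] -> Q s') ->
  run b emit s W Q.
Proof.
move=> b_gt0 nb leW sn hQ.
have bW : b <= W by apply: leq_trans leW; rewrite mulSn leq_addr.
have one_lt : 1 < 2 ^ b by rewrite -[1](expn0 2) ltn_exp2l.
apply: run_seq; apply: run_nset => //.
apply: run_seq; apply: run_nset => //; first by rewrite /= /upd /= sn.
set s1 := nset _ _ _ _.
pose f := nmem s aNxt.
apply: (run_for b_gt0 (W := b) (k := n) (I := fun i s' => [/\ nmem s' vC 0 = iter i f n,
   output s' 0 = 1 & forall j, j < i -> output s' j.+1 = iter j f n %% n])) => //.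
- by move=> s' un; rewrite /= un.1.
- move=> i s' un lt_i wi [hc h0 hj]; apply: run_bounded => bs.
  have sn' : nmem s' vN 0 = n by rewrite un.1.
  have mod_lt : nval s' (Op Mod (var vC) (var vN)) < 2 ^ b.
    by rewrite /= sn'; apply: ltn_trans nb; apply: ltn_pmod.
  apply: run_seq; apply: run_nset => //.
  (* Memory is bounded, so the successor fits whatever it is. *)
  apply: run_nset => //=; first exact: bs.
  rewrite /upd /= hc sn' wi un.1 //; split=> //=.
    by rewrite /output /= /upd /= addn1.
  move=> j; rewrite ltnS leq_eqVlt /output /= /upd /= addn1 eqSS => /orP[/eqP->|ji].
    by rewrite eqxx.
  by rewrite ltn_eqF // -hj.
move=> s2 un [_ h0 hj]; apply: hQ => //.
apply: (@eq_from_nth _ 0); first by rewrite !size_map size_iota size_traject.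
move=> i; rewrite size_map size_iota => ni.
rewrite (nth_map 0) ?size_iota // nth_iota // add1n hj //.
by rewrite (nth_map n) ?size_traject // nth_traject.
Qed.

Lemma tour_of_ham_cycle p : uniq (o :: p) -> ham_cycle G (o :: p) ->
  wpath K tsp_term tsp_step n (labels p) /\
  wsum tsp_step wt n (labels p) = cycle_weight cost (o :: p).
Proof.
move=> uop hp; have := hp; rewrite ham_cycle_tour // => /and3P[pp /eqP cov lp].
have [op up] := andP uop.
have dp x : x \in p -> x \notin [set o].
  by move=> xp; rewrite inE; apply: contraNneq op => <-.
have [] := tour_wpath pp up dp cov lp; rewrite tsp_start => wp sp _; split=> //.
by rewrite sp tour_weightE //; have /and4P[_ _ /eqP] := hp.
Qed.

Lemma tsp_tables_correct q s :
  n \in q -> (forall c, c \in q -> reach n K tsp_step c) -> uniq q ->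
  (forall c w, c \in q -> w < K -> tsp_step c w \in q) ->
  (forall c, c \in q -> bellman K tsp_term tsp_step wt c K s) ->
  (0 < nmem s aOk n -> exists2 p, smallest_ham_cycle G cost p &
     [seq c %% n | c <- traject (nmem s aNxt) n n] = map val p) /\
  (~~ (0 < nmem s aOk n) -> forall p, ~~ ham_cycle G p).
Proof.
move=> nq rq uq cq bel.
have lower := bellman_lower tsp_step_term cq bel nq.
split=> [okn|okn p]; last first.
  apply/negP => /ham_cycle_rot[p' [up' /(tour_of_ham_cycle up')[wp _] _]].
  by have [okn' _] := lower _ wp; rewrite okn' in okn.
have K_lt : K < 2 ^ (2 * n + 3).
  by apply: leq_trans (ltn_expl _ (ltnSn 1)) _; rewrite leq_exp2l // /K; lia.
have [|ws [wp sumE codesE]] := bellman_upper (b := 2 * n + 3) (L := n.+1) _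
    (fun c w _ => @tsp_level c w) (fun c _ => bitcount_le n.+1 (c %/ n)) tsp_bound_lt K_lt
    (tsp_reach_card uq rq) uq rq cq bel nq okn; first by rewrite addnC.
have := wp; rewrite -{1}tsp_start => /wpath_tour[p [wsE [pp up] dp cov lp]].
have uop : uniq (o :: p) by rewrite /= up andbT; apply/negP => /dp; rewrite inE eqxx.
have hp : ham_cycle G (o :: p) by rewrite ham_cycle_tour // pp cov eqxx lp.
have [_ sp] := tour_of_ham_cycle uop hp.
have szp : (size p).+1 = n by have /and4P[_ _ /eqP] := hp.
exists (o :: p).
  split=> // p' /ham_cycle_rot[p2 [up2 hp2 <-]].
  have [wp2 <-] := tour_of_ham_cycle up2 hp2.
  by rewrite -sp -wsE -sumE; have [] := lower _ wp2.
have [_ _ <-] := tour_wpath pp up dp cov lp.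
rewrite tsp_start -wsE codesE wsE size_rcons size_map szp.
by rewrite take_traject.
Qed.

Lemma run_tsp_ge3 (W := tsp_bound.+1 * (n.+2 * (2 * n + 3))) :
  run (2 * n + 3) tsp (weighted_graph_input G cost) W (outputs_smallest_ham_cycle G cost).
Proof.
set b := 2 * n + 3; set s := weighted_graph_input G cost.
have b_gt0 : 0 < b by rewrite /b addnC.
have n_lt : n.+2 < 2 ^ b.
  by apply: leq_trans (ltn_expl _ (ltnSn 1)) _; rewrite leq_exp2l // /b; lia.
have leW1 : n.+2 * b <= W by rewrite /W mulSn leq_addr.
have bW : b <= W by apply: leq_trans leW1; rewrite mulSn leq_addr.
apply: run_if => //; last by rewrite /cval /= n_ge3.
move=> _; apply: run_seq; apply: (run_powers b_gt0 (n := n)) => //; first by rewrite /b; lia.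
move=> s1 un1 pow1.
have T1 : tsp_tables s1.
  by split=> // [|k|k]; rewrite ?un1.1 ?un1.2.
have TT s' : tables s1 s' -> tsp_tables s' by apply: tsp_tables_tables.
have nxv s' : tables s1 s' -> reach n K tsp_step (nmem s' vC 0) -> nmem s' vW 0 < K ->
    nval s' tsp_next = tsp_step (nmem s' vC 0) (nmem s' vW 0).
  by move=> tb _; apply: tsp_next_val (TT s' tb).
have kxv s' : tables s1 s' -> nval s' tsp_labels = K.
  by case/TT => h0 _ _ _; rewrite /= h0 addn1.
have ixv s' : tables s1 s' -> nval s' (var vN) = n by case/TT.
have txv s' : tables s1 s' -> nval s' tsp_end = tsp_term.
  by case/TT => h0 _ h3 _; rewrite /= h0 addn1 h3.
have K_lt : K < 2 ^ b by apply: leq_ltn_trans n_lt.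
have lev c w (_ : reach n K tsp_step c) := @tsp_level c w.
apply: run_seq; apply: (run_explore b_gt0 nxv kxv ixv lev tsp_reach_lt
  (tsp_reach_card) tsp_bound_lt K_lt) => //.
  by move=> x; rewrite un1.1.
move=> s2 q un2 [[lq qq] uq rq nq sq] cq.
have tab2 : tables s1 s2 by apply: tables_unchanged un2 _.
have wxv s' : tables s1 s' -> reach n K tsp_step (nmem s' vC 0) -> nmem s' vW 0 < K ->
    tsp_step (nmem s' vC 0) (nmem s' vW 0) != nmem s' vC 0 ->
    rval s' tsp_weight = wt (nmem s' vC 0) (nmem s' vW 0).
  by case/TT => h0 _ _ hr _ _ _; rewrite /= h0 hr.
apply: run_seq; apply: (run_min_paths b_gt0 nxv kxv txv lev tsp_reach_lt tsp_bound_lt K_lt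
  (tsp_reach_card uq rq) uq rq cq sq wxv) => //.
- by move=> x; rewrite un2.1 // un1.1.
- by move=> x; rewrite un2.2 // un1.2.
move=> s3 un3 bel.
have n3 : nmem s3 vN 0 = n by rewrite un3.1 // un2.1 // un1.1.
have [yes no] := tsp_tables_correct nq rq uq cq bel.
apply: run_if => //; rewrite /cval /= n3 => okn.
  apply: run_emit => //; first exact: ltnW (ltnW n_lt).
    by apply: leq_trans leW1; rewrite leq_mul2r leqnSn orbT.
  move=> s4 out0 outE; left; split=> //; have [p hp pE] := yes okn.
  by exists p; rewrite // outE.
apply: run_skip => //; right; split; last exact: no.
by rewrite /output un3.1 // un2.1 // un1.1.
Qed.

End Tsp.

Lemma graph_cells_bounded (n b : nat) (G : graph n) a i :
  0 < b -> n < 2 ^ b -> graph_cells G a i < 2 ^ b.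
Proof.
move=> b_gt0 nb; case: a => [|[|a]] /=; last by rewrite expn_gt0.
  by case: ifP => // _; rewrite expn_gt0.
apply: leq_ltn_trans (matrix_cells_le1 _ _) _.
by rewrite -[1](expn0 2) ltn_exp2l.
Qed.

Lemma exec_tsp (R : realDomainType) (n : nat) (G : graph n) (cost : {set 'I_n} -> R) :
  exists s t, [/\ exec tsp (weighted_graph_input G cost) s t,
    t <= csize tsp * ((tsp_bound G).+1 * (n.+2 * (2 * n + 3))) &
    outputs_smallest_ham_cycle G cost s].
Proof.
have b_gt0 : 0 < 2 * n + 3 by rewrite addnC.
have n_lt : n < 2 ^ (2 * n + 3).
  by apply: leq_trans (ltn_expl _ (ltnSn 1)) _; rewrite leq_exp2l; lia.
have bnd : bounded (2 * n + 3) (weighted_graph_input G cost).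
  by move=> a i; apply: graph_cells_bounded.
suff /(_ bnd)[s [t [ex le _ out]]] : run (2 * n + 3) tsp (weighted_graph_input G cost)
    ((tsp_bound G).+1 * (n.+2 * (2 * n + 3))) (outputs_smallest_ham_cycle G cost).
  by exists s, t.
have [n3|n3] := ltnP 2 n; first exact: run_tsp_ge3.
have bW : 2 * n + 3 <= (tsp_bound G).+1 * (n.+2 * (2 * n + 3)) by rewrite mulnA leq_pmull.
apply: run_if => // [|_]; first by rewrite /cval /= ltnNge n3.
apply: run_skip => //; right; split=> // p.
by rewrite /ham_cycle ltnNge n3.
Qed.

(** * Counting perfect matchings *)

Section Matchings.
Variables (n : nat) (G : graph n).
Implicit Types (U : {set 'I_n}) (M : {set {set 'I_n}}).

Definition matches U M : bool :=
  [&& M \subset edges G, [forall e in M, e \subset U] &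
      [forall v in U, #|[set e in M | v \in e]| == 1]].

Definition num_matchings U : nat := #|[set M | matches U M]|.

Lemma adj_neq v w : adj G v w -> v != w.
Proof. by move=> /edges_card2; rewrite cards2; case: eqP. Qed.

Lemma matchesU e U M : e \in edges G -> e \subset U -> matches (U :\: e) M ->
  matches U (e |: M) /\ e \notin M.
Proof.
move=> eG eU /and3P[MG /forall_inP Me /forall_inP Mv].
have e0 : exists x, x \in e by apply/set0Pn; rewrite -card_gt0 (edges_card2 eG).
have notin e' x : e' \in M -> x \in e' -> x \notin e.
  by move=> /Me/subsetP sub /sub; rewrite inE => /andP[].
split; last by have [x xe] := e0; apply/negP => /notin/(_ xe); rewrite xe.
apply/and3P; split.
- by rewrite subUset sub1set eG.
- apply/forall_inP => e'; rewrite !inE => /orP[/eqP->//|/Me].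
  by move=> /subset_trans; apply; apply: subsetDl.
apply/forall_inP => x xU; have [xe|xe] := boolP (x \in e).
  suff -> : [set e' in e |: M | x \in e'] = [set e] by rewrite cards1.
  apply/setP => e'; rewrite !inE; case: eqP => [->|_] //=.
  by apply/negP => /andP[/notin h /h]; rewrite xe.
suff -> : [set e' in e |: M | x \in e'] = [set e' in M | x \in e'].
  by apply: Mv; rewrite inE xe.
by apply/setP => e'; rewrite !inE; case: eqP => [->|_] //=; rewrite (negPf xe) ?andbF.
Qed.

Lemma matchesD1 e U M : matches U M -> e \in M -> matches (U :\: e) (M :\ e).
Proof.
move=> /and3P[MG /forall_inP Me /forall_inP Mv] eM.
have uniq_edge x e' : x \in U -> e' \in M -> x \in e' -> x \in e -> e' = e.
  move=> xU e'M xe' xe; have /cards1P[e1 E] := Mv x xU.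
  have : e \in [set e2 in M | x \in e2] by rewrite inE eM.
  have : e' \in [set e2 in M | x \in e2] by rewrite inE e'M.
  by rewrite E !inE => /eqP-> /eqP->.
apply/and3P; split.
- exact: subset_trans (subsetDl _ _) MG.
- apply/forall_inP => e'; rewrite !inE => /andP[e'e e'M].
  apply/subsetP => x xe'; have xU := subsetP (Me _ e'M) x xe'.
  by rewrite inE xU andbT; apply: contraNN e'e => xe; apply/eqP/(uniq_edge x).
apply/forall_inP => x; rewrite inE => /andP[xe xU].
suff -> : [set e' in M :\ e | x \in e'] = [set e' in M | x \in e'] by apply: Mv.
apply/setP => e'; rewrite !inE; case: eqP => [->|_] //=.
by rewrite (negPf xe) andbF.
Qed.

(** Expansion along [v]: each matching has exactly one edge at [v], so summing over the possible
    partners counts it once. *)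
Lemma num_matchings_rec U v : v \in U ->
  num_matchings U = \sum_(w in U | adj G v w) num_matchings (U :\: [set v; w]).
Proof.
move=> vU.
have edge_card w : w \in U -> adj G v w ->
    #|[set M | matches U M & [set v; w] \in M]| = num_matchings (U :\: [set v; w]).
  move=> wU vw; set e := [set v; w].
  have eU : e \subset U by rewrite subUset !sub1set vU wU.
  rewrite /num_matchings -[RHS](@card_in_imset _ _ (fun M => e |: M)); last first.
    move=> M1 M2; rewrite !inE => /(matchesU vw eU)[_ h1] /(matchesU vw eU)[_ h2] E.
    by rewrite -(setU1K h1) -(setU1K h2) E.
  apply: eq_card => M; rewrite !inE; apply/andP/imsetP => [[mM eM]|[M']].
    by exists (M :\ e); rewrite ?setD1K // inE; apply: matchesD1.
  by rewrite inE => /(matchesU vw eU)[mU _] ->; rewrite mU setU11.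
rewrite -(eq_bigr _ (fun w (h : (w \in U) && adj G v w) =>
  edge_card w (proj1 (andP h)) (proj2 (andP h)))).
rewrite /num_matchings -sum1_card.
rewrite (eq_bigr (fun w => \sum_(M | matches U M) ([set v; w] \in M : nat))); last first.
  move=> w _; rewrite -sum1_card big_mkcond [RHS]big_mkcond /=; apply: eq_bigr => M _.
  by rewrite inE; case: matches; case: (_ \in M).
rewrite exchange_big /=; apply: eq_big => [M|M]; first by rewrite inE.
rewrite inE => /and3P[MG /forall_inP Me /forall_inP Mv].
have /eqP <- := Mv v vU.
rewrite -big_mkcondr sum1dep_card.
rewrite -(@card_in_imset _ _ (fun w => [set v; w])); last first.
  move=> w1 w2; rewrite !inE => /andP[/andP[_ a1] _] _ /setP/(_ w1).
  rewrite !inE eqxx orbT => /esym/orP[/eqP w1v|/eqP//].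
  by have := adj_neq a1; rewrite w1v eqxx.
apply: eq_card => e; rewrite !inE; apply/andP/imsetP => [[eM ve]|[w]].
  have /eqP := edges_card2 (subsetP MG e eM); rewrite (cardsD1 v) ve add1n eqSS => /cards1P[w E].
  have eE : e = [set v; w] by rewrite -(setD1K ve) E.
  exists w => //; rewrite inE -eE eM andbT; apply/andP; split.
    by apply: (subsetP (Me e eM)); rewrite eE !inE eqxx orbT.
  by rewrite /in_mem /= /adj -eE (subsetP MG).
by rewrite inE => /andP[_ vw] ->; rewrite set21.
Qed.

Lemma num_matchings0 : num_matchings set0 = 1.
Proof.
rewrite /num_matchings -[RHS](cards1 (set0 : {set {set 'I_n}})); apply: eq_card => M.
rewrite !inE; apply/idP/eqP => [/and3P[MG /forall_inP Me _]|->].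
  apply/setP => e; rewrite inE; apply/negP => eM.
  have := Me e eM; rewrite subset0 -cards_eq0.
  by rewrite (edges_card2 (subsetP MG e eM)).
apply/and3P; split; rewrite ?sub0set //; first by apply/forall_inP => x; rewrite inE.
by apply/forall_inP => x; rewrite inE.
Qed.

Lemma num_matchingsT : num_matchings setT = num_perfect_matchings G.
Proof.
apply: eq_card => M; rewrite !inE /matches /perfect_matching; congr andb.
have -> : [forall e in M, e \subset setT] by apply/forall_inP => e _; apply: subsetT.
by apply/forall_inP/forallP => h x; [apply: h|move=> _; apply: h].
Qed.

(** Double counting of incidences gives [n = 2 * #|M|]. *)
Lemma num_perfect_matchings_odd : odd n -> num_perfect_matchings G = 0.
Proof.
move=> on; apply/eqP; rewrite cards_eq0; apply/eqP/setP => M; rewrite !inE.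
apply/negP => /andP[MG /forallP Mv].
have : \sum_(v < n) 1 = \sum_(e in M) 2.
  rewrite (eq_bigr (fun v => \sum_(e in M) (v \in e : nat))); last first.
    move=> v _; have /eqP <- := Mv v; rewrite -sum1_card big_mkcond [RHS]big_mkcond.
    by apply: eq_bigr => e _; rewrite inE; case: (e \in M); case: (v \in e).
  rewrite exchange_big; apply: eq_bigr => e eM.
  by rewrite -(edges_card2 (subsetP MG e eM)) -sum1_card [RHS]big_mkcond.
by rewrite !sum_nat_const card_ord muln1 => E; move: on; rewrite E muln2 odd_double.
Qed.

End Matchings.

(* A label [w < n] matches [v] with [w].  Label [n + k] matches [v] with the second vertex
   of the starting pair and starts the next cycle at pair [k], the least untouched one;
   for [k = n / 2] this leads to the final state. *)
Definition pm_next : nexpr :=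
  let base := Op Add (var vN) (Lit 1) in
  let s := Op Mod (var vC) base in
  let v := Op Mod (Op Div (var vC) base) base in
  let X := Op Div (Op Div (var vC) base) base in
  let code X v s := Op Add (Op Mul (Op Add (Op Mul X base) v) base) s in
  let is_vertex := Op Defs.Sub (Lit 1) (Op Defs.Sub (Op Add (var vW) (Lit 1)) (var vN)) in
  let k := Op Defs.Sub (var vW) (var vN) in
  let half := Op Div (var vW) (Lit 2) in
  let mate := Op Defs.Sub (Op Add (var vW) (Lit 1)) (Op Mul (Lit 2) (Op Mod (var vW) (Lit 2))) in
  let move := Op Mul is_vertex (Op Mul (NGet aAdj (Op Add (Op Mul v (var vN)) (var vW)))
                (Op Defs.Sub (Lit 1) (bit_expr X half))) in
  let close := Op Mul (Op Defs.Sub (Lit 1) is_vertex)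
    (Op Mul (NGet aAdj (Op Add (Op Mul v (var vN)) (Op Add (Op Mul (Lit 2) s) (Lit 1))))
       (eq_expr (Op Mod X (NGet aPow (Op Add k (Lit 1)))) (Op Defs.Sub (NGet aPow k) (Lit 1)))) in
  Op Add (var vC) (Op Add
    (Op Mul move (Op Defs.Sub (code (Op Add X (NGet aPow half)) mate s) (var vC)))
    (Op Mul close (Op Defs.Sub (code (Op Add X (NGet aPow k)) (Op Mul (Lit 2) k) k) (var vC)))).

Definition pm_labels : nexpr := Op Add (Op Add (var vN) (Op Div (var vN) (Lit 2))) (Lit 1).

Definition pm_begin : nexpr :=
  let base := Op Add (var vN) (Lit 1) in Op Mul base base.

Definition pm_end : nexpr :=
  let base := Op Add (var vN) (Lit 1) in
  let half := Op Div (var vN) (Lit 2) in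
  Op Add (Op Mul (Op Add
    (Op Mul (Op Defs.Sub (NGet aPow (Op Add half (Lit 1))) (Lit 1)) base) (var vN)) base) half.

Definition count_matchings : cmd :=
  If (NLe (Op Mod (var vN) (Lit 2)) (Lit 0))
    (Seq powers (Seq (explore pm_next pm_labels pm_begin)
      (Seq (count_paths pm_next pm_labels pm_end)
        (NSet aOut (Lit 0) (NGet aVal pm_begin)))))
    Skip.

Section Pairs.
Variables (N : nat) (G : graph N.*2).
Let n := N.*2.
Let B := n.+1.
Let K := n + N.+1.
Let adjc : nat -> nat := matrix_cells 0 (fun i j : 'I_n => nat_of_bool (adj G i j)).

(* The vertices [2 i] and [2 i + 1] form pair [i].  A state consists of the set of
   pairs touched so far, the vertex [v] to be matched next, and a pair [s] whose second
   vertex is to be matched last on the current alternating cycle. *)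
Definition ncode (X v s : nat) : nat := (X * B + v) * B + s.

Definition pm_move (c w : nat) : nat :=
  (1 - (w + 1 - n)) * (adjc (c %/ B %% B * n + w) * (1 - bit (c %/ B %/ B) (w %/ 2))).

Definition pm_close (c w : nat) : nat :=
  (1 - (1 - (w + 1 - n))) * (adjc (c %/ B %% B * n + (2 * (c %% B) + 1)) *
     ((c %/ B %/ B) %% 2 ^ (w - n + 1) == 2 ^ (w - n) - 1)).

Definition pm_step (c w : nat) : nat :=
  c + (pm_move c w * (ncode (c %/ B %/ B + 2 ^ (w %/ 2)) (w + 1 - 2 * (w %% 2)) (c %% B) - c) +
       pm_close c w * (ncode (c %/ B %/ B + 2 ^ (w - n)) (2 * (w - n)) (w - n) - c)).

(** What label [n + N] makes of a full mask: bit [N] marks completion, and [2 * N = n] stands where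
    a vertex would be. *)
Definition pm_term : nat := ncode (2 ^ N.+1 - 1) n N.

Definition pm_tables (R : numDomainType) (s : state R) : Prop :=
  [/\ nmem s vN 0 = n, (forall k, nmem s aAdj k = adjc k) &
      (forall i, i <= n.+1 -> nmem s aPow i = 2 ^ i)].

Lemma pm_tables_tables (R : numDomainType) (s0 s : state R) :
  pm_tables s0 -> tables s0 s -> pm_tables s.
Proof. by move=> [h0 h1 h3] [tn _]; split=> [|k|i hi]; rewrite tn ?inE //; apply: h3. Qed.

Lemma pm_next_val (R : numDomainType) (s : state R) : pm_tables s -> nmem s vW 0 < K ->
  nval s pm_next = pm_step (nmem s vC 0) (nmem s vW 0).
Proof.
move=> [h0 h1 h3] wK; set c := nmem s vC 0; set w := nmem s vW 0 in wK *.
pose base := nmem s vN 0 + 1.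
have -> : nval s pm_next =
    let v := c %/ base %% base in let X := c %/ base %/ base in
    c + ((1 - (w + 1 - nmem s vN 0)) *
           (nmem s aAdj (v * nmem s vN 0 + w) * (1 - (X %/ nmem s aPow (w %/ 2)) %% 2)) *
         (((X + nmem s aPow (w %/ 2)) * base + (w + 1 - 2 * (w %% 2))) * base + c %% base - c) +
         (1 - (1 - (w + 1 - nmem s vN 0))) *
           (nmem s aAdj (v * nmem s vN 0 + (2 * (c %% base) + 1)) *
            nval s (eq_expr (Op Mod (Op Div (Op Div (var vC) (Op Add (var vN) (Lit 1)))
                (Op Add (var vN) (Lit 1)))
              (NGet aPow (Op Add (Op Defs.Sub (var vW) (var vN)) (Lit 1))))
              (Op Defs.Sub (NGet aPow (Op Defs.Sub (var vW) (var vN))) (Lit 1)))) *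
         (((X + nmem s aPow (w - nmem s vN 0)) * base + 2 * (w - nmem s vN 0)) * base
            + (w - nmem s vN 0) - c)) by [].
have wn : w - n <= N by move: wK; rewrite /K; lia.
have wn' : w - n <= n.+1 by rewrite (leq_trans wn) // /n; lia.
have wn1 : w - n + 1 <= n.+1 by rewrite addn1 ltnS (leq_trans wn) // /n; lia.
have w2 : w %/ 2 <= n.+1 by move: wK; rewrite /K /n; lia.
by rewrite eq_exprE /base /= -/c -/w h0 (addn1 n) !h1 (h3 _ w2) (h3 _ wn') (h3 _ wn1).
Qed.

Lemma ncode_div X v s : s < B -> v < B -> ncode X v s %/ B %/ B = X.
Proof.
move=> sB vB; rewrite /ncode !divnMDl // (divn_small sB) addn0.
by rewrite divnMDl // (divn_small vB) addn0.
Qed.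

Lemma ncode_v X v s : s < B -> v < B -> ncode X v s %/ B %% B = v.
Proof. by move=> sB vB; rewrite /ncode divnMDl // (divn_small sB) addn0 modnMDl modn_small. Qed.

Lemma ncode_s X v s : s < B -> ncode X v s %% B = s.
Proof. by move=> sB; rewrite /ncode modnMDl modn_small. Qed.

(** The leading digit grows, so the truncated differences in [pm_step] are exact. *)
Lemma ncode_gt c x v s : c < ncode (c %/ B %/ B + 2 ^ x) v s.
Proof.
have := expn_gt0 2 x; rewrite /= => p.
rewrite /ncode {1}(divn_eq c B) {1}(divn_eq (c %/ B) B).
have := ltn_pmod c (ltn0Sn n); have := ltn_pmod (c %/ B) (ltn0Sn n); rewrite -/B.
move: p; move: (2 ^ x) (c %/ B %/ B) (c %/ B %% B) (c %% B) => y X v' s'.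
have : 0 < B by []. 
by move: B; nia.
Qed.

Lemma pm_step_cases c w : w < K ->
  [\/ [/\ pm_step c w = c, pm_move c w = 0 & pm_close c w = 0],
      [/\ w < n, pm_move c w = 1, bit (c %/ B %/ B) (w %/ 2) = 0 &
         pm_step c w = ncode (c %/ B %/ B + 2 ^ (w %/ 2)) (w + 1 - 2 * (w %% 2)) (c %% B)] |
      [/\ n <= w, pm_close c w = 1, (c %/ B %/ B) %% 2 ^ (w - n + 1) = 2 ^ (w - n) - 1 &
         pm_step c w = ncode (c %/ B %/ B + 2 ^ (w - n)) (2 * (w - n)) (w - n)]].
Proof.
move=> wK; rewrite /pm_step.
have := matrix_cells_le1 (adj G) (c %/ B %% B * n + w); rewrite -/adjc => a1.
have := matrix_cells_le1 (adj G) (c %/ B %% B * n + (2 * (c %% B) + 1)); rewrite -/adjc => a2.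
have b1 := bit_le1 (c %/ B %/ B) (w %/ 2).
have gt1 := ncode_gt c (w %/ 2) (w + 1 - 2 * (w %% 2)) (c %% B).
have gt2 := ncode_gt c (w - n) (2 * (w - n)) (w - n).
have [wn|nw] := ltnP w n.
  have cl0 : pm_close c w = 0.
    by rewrite /pm_close; have -> : 1 - (1 - (w + 1 - n)) = 0 by lia.
  rewrite cl0 mul0n addn0.
  case mE : (pm_move c w) => [|x]; first by constructor 1; rewrite mul0n addn0.
  have [bE xE] : bit (c %/ B %/ B) (w %/ 2) = 0 /\ x = 0.
    move: mE; rewrite /pm_move; have -> : 1 - (w + 1 - n) = 1 by lia.
    by move: (adjc _) (bit _ _) a1 b1 => [|[|?]] [|[|?]] //= _ _ []; lia.
  by constructor 2; split=> //; rewrite ?xE ?mul1n ?subnKC // ltnW.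
have mv0 : pm_move c w = 0.
  by rewrite /pm_move; have -> : 1 - (w + 1 - n) = 0 by lia.
rewrite mv0 mul0n add0n.
case mE : (pm_close c w) => [|x]; first by constructor 1; rewrite mul0n addn0.
have [bE xE] : (c %/ B %/ B) %% 2 ^ (w - n + 1) = 2 ^ (w - n) - 1 /\ x = 0.
  move: mE; rewrite /pm_close; have -> : 1 - (1 - (w + 1 - n)) = 1 by lia.
  move: (adjc _) a2 => [|[|?]] // _; rewrite mul1n ?mul0n ?mul1n //.
  by case: eqP => //= -> [<-].
by constructor 3; split=> //; rewrite ?xE ?mul1n ?subnKC // ltnW.
Qed.

Let level c := bitcount N.+1 (c %/ B %/ B).

Lemma bit_prefix0 X k : X %% 2 ^ (k + 1) = 2 ^ k - 1 -> bit X k = 0.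
Proof.
move=> E; rewrite -(bit_mod X (m := k + 1)) ?addn1 //.
by rewrite -[k.+1]addn1 E subn1 bit_ones ltnn.
Qed.

Lemma mod2_lt w : w < n -> w + 1 - 2 * (w %% 2) < n.
Proof. by rewrite /n; lia. Qed.

Lemma pm_level c w : w < K -> pm_step c w = c \/ level (pm_step c w) = (level c).+1.
Proof.
move=> wK; have [[-> _ _]|[wn _ b0 ->]|[nw _ p0 ->]] := pm_step_cases c wK; first by left.
  right; rewrite /level ncode_div ?ltn_pmod //; last by rewrite ltnS ltnW // mod2_lt.
  by rewrite bitcount_add //; move: wn; rewrite /n; lia.
have kN : w - n <= N by rewrite leq_subLR -ltnS -addnS.
right; rewrite /level ncode_div.
- by rewrite bitcount_add ?(bit_prefix0 p0).
- by rewrite ltnS (leq_trans kN) // /n -addnn leq_addr.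
- by rewrite ltnS (@leq_trans (2 * N)) ?leq_mul2l // /n mul2n.
Qed.

Lemma pm_step_term w : w < K -> pm_step pm_term w = pm_term.
Proof.
move=> wK.
have nB : n < B by []. have NB : N < B by rewrite /B /n; lia.
have XE : pm_term %/ B %/ B = (2 ^ N.+1).-1 by rewrite ncode_div // subn1.
have [[-> _ _]//|[wn _]|[nw _]] := pm_step_cases pm_term wK; rewrite XE.
  by rewrite bit_ones; have -> : w %/ 2 < N.+1 by move: wn; rewrite /n; lia.
move=> /bit_prefix0; rewrite bit_ones.
by have -> : w - n < N.+1 by move: wK; rewrite /K; lia.
Qed.

Lemma pair_of_subproof (u : 'I_n) : u %/ 2 < N.
Proof. by have := ltn_ord u; rewrite /n; lia. Qed.
Definition pair_of (u : 'I_n) : 'I_N := Ordinal (pair_of_subproof u).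

Lemma mate_subproof (u : 'I_n) : u + 1 - 2 * (u %% 2) < n.
Proof. exact: mod2_lt. Qed.
Definition mate (u : 'I_n) : 'I_n := Ordinal (mate_subproof u).

Lemma fst_of_subproof (i : 'I_N) : 2 * i < n.
Proof. by have := ltn_ord i; rewrite /n; lia. Qed.
Definition fst_of (i : 'I_N) : 'I_n := Ordinal (fst_of_subproof i).

Lemma snd_of_subproof (i : 'I_N) : 2 * i + 1 < n.
Proof. by have := ltn_ord i; rewrite /n; lia. Qed.
Definition snd_of (i : 'I_N) : 'I_n := Ordinal (snd_of_subproof i).

Lemma pair_mate u : pair_of (mate u) = pair_of u.
Proof. by apply/val_inj => /=; lia. Qed.

Lemma mate_neq u : mate u != u.
Proof. by apply/eqP => /(congr1 val) /=; lia. Qed.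

Lemma pair_eq u w : (pair_of u == pair_of w) = (u == w) || (u == mate w).
Proof. by rewrite -!val_eqE /=; apply/eqP/orP => [|[] /eqP]; lia. Qed.

Lemma pair_fst_of i : pair_of (fst_of i) = i.
Proof. by apply/val_inj => /=; lia. Qed.

Lemma pair_snd_of i : pair_of (snd_of i) = i.
Proof. by apply/val_inj => /=; lia. Qed.

Lemma mate_fst_of i : mate (fst_of i) = snd_of i.
Proof. by apply/val_inj => /=; lia. Qed.

Definition pcode (A : {set 'I_N}) (v : 'I_n) (s : 'I_N) : nat := ncode (bitmask A) v s.

Let sB (s : 'I_N) : s < B. Proof. by have := ltn_ord s; rewrite /B /n; lia. Qed.
Let vB (v : 'I_n) : v < B. Proof. by rewrite ltnS ltnW. Qed.

Lemma pcode_term A v s : pcode A v s != pm_term.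
Proof.
apply/eqP => /(congr1 (fun c => c %/ B %/ B)).
have NB : N < B by rewrite /B /n; lia.
rewrite !ncode_div ?sB ?vB // expnS; have := bitmask_lt A.
by move: (2 ^ N) => x; lia.
Qed.

Lemma pm_step_vertex A v s (w : 'I_n) : pm_step (pcode A v s) w =
  if adj G v w && (pair_of w \notin A) then pcode (pair_of w |: A) (mate w) s else pcode A v s.
Proof.
have wK : w < K by rewrite /K ltn_addr.
have valE : pm_move (pcode A v s) w = adj G v w && (pair_of w \notin A).
  rewrite /pm_move ncode_v ?ncode_div ?sB ?vB // /adjc matrix_cellsE.
  rewrite -[w %/ 2]/(val (pair_of w)) bit_mask_ord.
  have -> : 1 - (w + 1 - n) = 1 by have := ltn_ord w; lia.
  by case: adj; case: (_ \in A).
have [[-> mv _]|[_ mv _ ->]|[nw]] := pm_step_cases (pcode A v s) wK.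
- by rewrite -(lt0b (_ && _)) -valE mv.
- move: mv; rewrite valE; case: ifP => // /andP[_ pA] _.
  by rewrite ncode_div ?ncode_s ?sB ?vB // -[w %/ 2]/(val (pair_of w)) /pcode bitmaskU1.
- by move: nw; rewrite leqNgt ltn_ord.
Qed.

Definition prefix_in (A : {set 'I_N}) (k : nat) : bool :=
  [forall i : 'I_N, (i < k) ==> (i \in A)] && [forall i in A, i != k :> nat].

Lemma pm_step_close A v s k : k <= N -> pm_step (pcode A v s) (n + k) =
  if adj G v (snd_of s) && prefix_in A k
  then ncode (bitmask A + 2 ^ k) (2 * k) k else pcode A v s.
Proof.
move=> kN; have wK : n + k < K by rewrite /K ltn_add2l.
have valE : pm_close (pcode A v s) (n + k) = adj G v (snd_of s) && prefix_in A k.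
  rewrite /pm_close ncode_v ?ncode_div ?ncode_s ?sB ?vB // -[2 * s + 1]/(val (snd_of s)).
  rewrite /adjc matrix_cellsE addKn (addn1 k) subn1 bitmask_prefix //.
  have -> : 1 - (1 - (n + k + 1 - n)) = 1 by lia.
  by case: adj; rewrite ?mul1n ?mul0n.
have [[-> _ mv]|[nw]|[_ mv _ ->]] := pm_step_cases (pcode A v s) wK.
- by rewrite -(lt0b (_ && _)) -valE mv.
- by move: nw; rewrite ltnNge leq_addr.
- move: mv; rewrite valE addKn; case: ifP => // _ _.
  by rewrite ncode_div ?sB ?vB.
Qed.

Lemma prefix_in_setT k : k <= N -> prefix_in setT k = (k == N).
Proof.
move=> kN; apply/andP/eqP => [[_ /forall_inP h]|->].
  apply/eqP; rewrite eqn_leq kN leqNgt; apply/negP => lt_k.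
  by have := h (Ordinal lt_k) (in_setT _); rewrite eqxx.
split; first by apply/forall_inP => i; rewrite inE.
by apply/forall_inP => i _; rewrite neq_ltn ltn_ord.
Qed.

(** [k] is the least untouched pair, or [N] if there is none; so at most one closing label
    applies. *)
Lemma prefix_inP A : exists2 k, k <= N & forall k', k' <= N -> prefix_in A k' = (k' == k).
Proof.
have [->|AT] := eqVneq A setT; first by exists N => // k'; apply: prefix_in_setT.
have [x xA] : exists x, x \notin A.
  apply/existsP; rewrite -negb_forall; apply: contra AT => /forallP h.
  by apply/eqP/setP => x; rewrite inE h.
case: (@arg_minnP _ x (fun i => i \notin A) (fun i : 'I_N => val i) xA) => m mA mmin.
have low (i : 'I_N) : i < m -> i \in A by apply: contraTT => /mmin; rewrite -leqNgt.
exists (val m); first exact: (ltnW (ltn_ord m)).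
move=> k kN; apply/andP/eqP => [[/forall_inP h1 /forall_inP h2]|->].
  case: (ltngtP k m) => // [km|mk].
    have kN' := ltn_trans km (ltn_ord m).
    by have := h2 (Ordinal kN') (low (Ordinal kN') km); rewrite eqxx.
  by have := h1 m mk; rewrite (negPf mA).
split; first by apply/forall_inP => i; apply: low.
by apply/forall_inP => i iA; apply: contraNneq mA => /val_inj <-.
Qed.

Lemma close_code A k : k <= N -> prefix_in A k ->
  [/\ A = setT, k = N & ncode (bitmask A + 2 ^ k) (2 * k) k = pm_term] \/
  exists i : 'I_N, [/\ k = i, i \notin A, forall j : 'I_N, j < i -> j \in A &
    ncode (bitmask A + 2 ^ k) (2 * k) k = pcode (i |: A) (fst_of i) i].
Proof.
move=> kN /andP[/forall_inP low /forall_inP notin].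
move: kN; rewrite leq_eqVlt => /orP[/eqP kN|kN]; [left|right].
  have AT : A = setT by apply/setP => i; rewrite inE low // kN.
  split=> //; rewrite /pm_term kN AT.
  have /eqP-> : bitmask [set: 'I_N] == (2 ^ N).-1 by rewrite bitmask_setT.
  rewrite /n -mul2n; congr ncode.
  by rewrite expnS; have := expn_gt0 2 N; case: (2 ^ N) => //= x _; lia.
have kA : Ordinal kN \notin A by apply/negP => /notin; rewrite eqxx.
by exists (Ordinal kN); split=> //; rewrite /pcode bitmaskU1.
Qed.

(** Edges inside a pair would become loops and are dropped, to keep the relation irreflexive. *)
Definition contracted : rel 'I_N := fun i j =>
  (i != j) && [exists u, exists w, [&& pair_of u == i, pair_of w == j & adj G u w]].

Let c0 := B * B.

Lemma pcode_start (o : 'I_N) : o = 0 :> nat -> pcode [set o] (fst_of o) o = c0.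
Proof.
by move=> o0; rewrite /pcode /bitmask big_set1 /ncode /= o0 expn0 muln0 mul1n !addn0.
Qed.

Lemma pm_start0 : N = 0 -> c0 = pm_term.
Proof. by move=> N0; rewrite /c0 /pm_term /ncode /B /n N0. Qed.

(** Moving enters a new pair from that of [v], which is [traced_extend]; closing starts at the least
    untouched pair, which is [traced_restart]. The two open ends [v] and [snd_of s] stay distinct
    because a newly entered pair is not [s]. *)
Lemma pm_reach c : reach c0 K pm_step c -> c = pm_term \/
  exists A v (s : 'I_N), [/\ traced contracted s A (pair_of v), v != snd_of s & c = pcode A v s].
Proof.
elim=> {c} [|c w _ [->|[A [v [s [tr vs ->]]]]] wK].
- case: (posnP N) => [/pm_start0|N_gt0]; first by left.
  right; pose o := Ordinal N_gt0; exists [set o], (fst_of o), o.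
  rewrite pcode_start // pair_fst_of; split=> //; exact: traced_start.
- by left; apply: pm_step_term.
have [wn|nw] := ltnP w n.
  right; rewrite (pm_step_vertex A v s (Ordinal wn)).
  case: ifP => [/andP[a wA]|_]; last by exists A, v, s.
  exists (pair_of (Ordinal wn) |: A), (mate (Ordinal wn)), s; rewrite pair_mate; split=> //.
    apply: (traced_extend tr) => //; apply/andP; split.
      by have [_ vA _] := tr; apply: contraNneq wA => <-.
    by apply/existsP; exists v; apply/existsP; exists (Ordinal wn); rewrite !eqxx.
  have [sA _ _] := tr; apply: contraNneq wA => ms.
  by rewrite -pair_mate ms pair_snd_of sA.
have kN : w - n <= N by rewrite leq_subLR -ltnS -addnS.
rewrite -(subnKC nw) pm_step_close //; case: ifP => [/andP[_ /(close_code kN)]|_].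
  case=> [[_ _ ->]|[i [_ iA low ->]]]; [by left|right].
  exists (i |: A), (fst_of i), i; rewrite pair_fst_of; split=> //.
    exact: traced_restart tr low iA.
  by rewrite -mate_fst_of eq_sym mate_neq.
by right; exists A, v, s.
Qed.

Definition pm_bound : nat :=
  (\sum_(s < N) #|traced_sets contracted s| * n).+1.

Lemma pm_reach_card q : uniq q -> (forall c, c \in q -> reach c0 K pm_step c) ->
  size q <= pm_bound.
Proof.
move=> uq rq.
pose l := pm_term :: [seq pcode p.1 p.2 s | s <- enum 'I_N,
   p <- enum (setX (traced_sets contracted s) [set: 'I_n])].
have -> : pm_bound = size l.
  rewrite /= size_allpairs_dep sumnE big_map big_enum /=; congr _.+1.
  by apply: eq_bigr => s _; rewrite -cardE cardsX cardsT card_ord.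
apply: uniq_leq_size => // c /rq/pm_reach[->|[A [v [s [tr _ ->]]]]]; rewrite inE ?eqxx //.
apply/orP; right; apply/allpairsPdep; exists s, (A, v); rewrite mem_enum; split=> //.
by rewrite mem_enum !inE /= andbT; apply/asboolP; exists (pair_of v).
Qed.

(** Quadratic, since the numbers of paths may reach [K ^ N.+1], with [N.+1] factors of up to [n.+1]
    bits. *)
Let b := n.+2 * n.+3.

Let pow_lt x : x <= 3 * n + 1 -> 2 ^ x < 2 ^ b.
Proof.
by move=> h; rewrite ltn_exp2l // /b; apply: leq_ltn_trans h _; move: n; clear; nia.
Qed.

Let n_lt_pow : n < 2 ^ n. Proof. exact: ltn_expl. Qed.
Let N_le_n : N <= n. Proof. by rewrite /n -addnn leq_addr. Qed.

Lemma pm_bound_lt : pm_bound < 2 ^ b.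
Proof.
apply: leq_ltn_trans (pow_lt (x := 3 * n) _); last by rewrite leq_addr.
have : \sum_(s < N) #|traced_sets contracted s| * n <= N * (2 ^ N * n).
  rewrite -[X in X * _](card_ord N) -sum_nat_const; apply: leq_sum => s _.
  rewrite leq_mul2r (leq_trans (max_card _)) ?orbT //.
  by rewrite -cardsT -powersetT card_powerset cardsT card_ord.
have : 2 ^ N <= 2 ^ n by rewrite leq_exp2l.
have -> : 2 ^ (3 * n) = 2 ^ n * 2 ^ n * 2 ^ n by rewrite !mulSn mul0n addn0 !expnD mulnA.
rewrite /pm_bound; move: n_lt_pow N_le_n.
move: (\sum_(s < N) _) (2 ^ N) (2 ^ n) => z x y.
move: N n => N' n'; clear => ny Nn xy zx.
have : z <= y.-1 * (y * y) by rewrite (leq_trans zx) // !leq_mul //; lia.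
by case: y ny {xy zx} => // y _ h; rewrite -mulnA [leqRHS]mulSn -add1n leq_add // muln_gt0.
Qed.

Lemma pm_reach_lt c : reach c0 K pm_step c -> c < 2 ^ b.
Proof.
move=> rc; apply: leq_trans (ltnW (pow_lt (leqnn _))).
have E : 2 ^ (3 * n + 1) = 2 ^ n * 2 ^ n * 2 ^ n * 2.
  by rewrite addn1 expnSr !mulSn mul0n addn0 !expnD !mulnA.
have xy : 2 ^ N <= 2 ^ n by rewrite leq_exp2l.
have code_lt X v s : X < 2 ^ N.+1 -> v < B -> s < B -> ncode X v s < 2 ^ (3 * n + 1).
  move=> XN vB' sB'.
  have BY : B <= 2 ^ n by [].
  apply: (@leq_trans ((X * B + v).+1 * B)); first by rewrite /ncode mulSn addnC ltn_add2r.
  rewrite E.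
  apply: (@leq_trans (X.+1 * B * B)).
    by rewrite leq_mul2r mulSn -addnS addnC leq_add2r vB' orbT.
  have X2 : X.+1 <= 2 ^ n * 2 by rewrite (leq_trans XN) // expnSr leq_mul2r xy.
  apply: leq_trans (leq_mul (leq_mul X2 BY) BY) _.
  by move: (2 ^ n) => y; lia.
case: (pm_reach rc) => [->|[A [v [s [_ _ ->]]]]].
  apply: code_lt => //.
  by have := expn_gt0 2 N.+1; case: (2 ^ N.+1) => // x _; lia.
apply: code_lt => //; by rewrite (leq_trans (bitmask_lt A)) // leq_exp2l.
Qed.

Lemma pm_labels_pow : K ^ N.+1 < 2 ^ b.
Proof.
have K_lt : K <= 2 ^ n.+1.
  rewrite expnS mul2n -addnn /K; move: n_lt_pow N_le_n; move: (2 ^ n) => y; lia.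
apply: (@leq_ltn_trans ((2 ^ n.+1) ^ N.+1)); first by rewrite leq_exp2r.
rewrite -expnM ltn_exp2l // /b; move: N_le_n; move: N n => N' n'; clear; nia.
Qed.

(** The vertices still to be matched: those of the untouched pairs and the two open ends of the
    current alternating path. *)
Definition rest (A : {set 'I_N}) (v t : 'I_n) : {set 'I_n} :=
  [set u | [|| pair_of u \notin A, u == v | u == t]].

Let P c := npaths K pm_term pm_step (N.+1 - level c) c.

Lemma rest_vertex (A : {set 'I_N}) v s w :
  v != snd_of s -> s \in A -> pair_of v \in A -> pair_of w \notin A ->
  rest A v (snd_of s) :\: [set v; w] = rest (pair_of w |: A) (mate w) (snd_of s).
Proof.
move=> vs sA vA wA; apply/setP => u; rewrite !inE !negb_or pair_eq.
have [->|uv] := eqVneq u v; rewrite /= ?andbF ?andbT.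
  rewrite vA andbF (negPf vs) orbF; apply/esym/negbTE/eqP => vm.
  by move: vA; rewrite vm pair_mate (negPf wA).
have [->|uw] := eqVneq u w; rewrite /= ?andbF ?andbT.
  rewrite [w == mate w]eq_sym (negPf (mate_neq w)) /=.
  by apply/esym/negbTE/eqP => ws; move: wA; rewrite ws pair_snd_of sA.
have [->|um] := eqVneq u (mate w); rewrite /= ?orbT //.
by rewrite pair_mate wA.
Qed.

Lemma rest_close (A : {set 'I_N}) v s (i : 'I_N) :
  v != snd_of s -> s \in A -> pair_of v \in A -> i \notin A ->
  rest A v (snd_of s) :\: [set v; snd_of s] = rest (i |: A) (fst_of i) (snd_of i).
Proof.
move=> vs sA vA iA; apply/setP => u; rewrite !inE !negb_or.
have uE x : (pair_of x == i) = (x == fst_of i) || (x == snd_of i).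
  by rewrite -{1}(pair_fst_of i) pair_eq mate_fst_of.
have [->|uv] := eqVneq u v; rewrite /= ?andbF ?andbT.
  rewrite vA /= andbF -uE; apply/esym/negbTE; apply: contraNneq iA => <-; exact: vA.
have [->|us] := eqVneq u (snd_of s); rewrite /= ?andbF ?andbT ?orbF.
  rewrite pair_snd_of sA andbF -uE pair_snd_of; apply/esym/negbTE.
  by apply: contraNneq iA => <-.
by rewrite -uE; case: eqP => [->|_]; rewrite ?orbF // iA.
Qed.

Lemma pcode_neq (A A' : {set 'I_N}) v s v' s' x :
  bitmask A' = bitmask A + 2 ^ x -> pcode A' v' s' != pcode A v s.
Proof.
move=> E; apply/eqP => /(congr1 (fun c => c %/ B %/ B)).
rewrite !ncode_div ?sB ?vB // E; move/eqP.
by rewrite -[X in _ == X]addn0 eqn_add2l expn_eq0.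
Qed.

(** The recursion for paths is the expansion of the matchings along [v]. The induction is on the
    number of untouched pairs. *)
Lemma pm_count_correct m (A : {set 'I_N}) v (s : 'I_N) : N - #|A| < m ->
  reach c0 K pm_step (pcode A v s) -> pair_of v \in A -> s \in A -> v != snd_of s ->
  P (pcode A v s) = num_matchings G (rest A v (snd_of s)).
Proof.
elim: m A v s => [|m IH] A v s cardA rc vA sA vs; first by [].
set t := snd_of s; set c := pcode A v s in rc *.
have cardU i : i \notin A -> N - #|i |: A| < m.
  move=> iA; have := max_card (mem (i |: A)); rewrite card_ord.
  by move: cardA; rewrite cardsU1 iA; clear; lia.
have cT : c != pm_term by apply: pcode_term.
rewrite /P (npaths_step (reach := reach c0 K pm_step) (L := N.+1)
  (fun x w _ => @pm_level x w) (@ReachStep _ _ _) (fun x _ => bitcount_le _ _) rc cT) -/P.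
rewrite (num_matchings_rec G (v := v)); last by rewrite !inE eqxx orbT.
(* Labels below [n] correspond to partners in untouched pairs. In touched pairs the only possible
   partner is [t], to be compared with the closing labels. *)
rewrite /K big_split_ord [RHS](bigID (fun w => pair_of w \notin A)) /=; congr (_ + _).
  have stepE (w : 'I_n) : (pm_step c w != c) = adj G v w && (pair_of w \notin A).
    rewrite pm_step_vertex; case: ifP => [/andP[_ wA]|]; last by rewrite eqxx.
    by rewrite (pcode_neq _ _ _ _ (bitmaskU1 wA)).
  apply: eq_big => [w|w]; rewrite stepE.
    by rewrite !inE; case: (pair_of w \notin A); rewrite ?andbT ?andbF.
  move=> h; have := h => /andP[vw wA]; rewrite -/(P _) pm_step_vertex h rest_vertex //.
  rewrite IH ?cardU //.
  - by have := ReachStep rc (ltn_addr N.+1 (ltn_ord w)); rewrite pm_step_vertex h.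
  - by rewrite pair_mate setU11.
  - by rewrite !inE sA orbT.
  - by apply: contraNneq wA => ms; rewrite -pair_mate ms pair_snd_of sA.
have rhsE : \sum_(w | (w \in rest A v t) && adj G v w && ~~ (pair_of w \notin A))
      num_matchings G (rest A v t :\: [set v; w]) =
    if adj G v t then num_matchings G (rest A v t :\: [set v; t]) else 0.
  case: ifP => vt.
    apply: big_pred1 => w; rewrite !inE negbK /=.
    apply/andP/eqP => [[/andP[/or3P[wA|/eqP wv|/eqP//] vw] wA']|->].
    - by rewrite wA' in wA.
    - by have := adj_neq vw; rewrite wv eqxx.
    - by rewrite eqxx !orbT vt pair_snd_of sA.
  apply: big_pred0 => w; rewrite !inE negbK.
  apply/negP => /andP[/andP[/or3P[wA|/eqP wv|/eqP wt] vw] wA'].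
  - by rewrite wA' in wA.
  - by have := adj_neq vw; rewrite wv eqxx.
  - by rewrite wt vt in vw.
rewrite rhsE {rhsE}.
have [k kN kP] := prefix_inP A.
have stepE (j : 'I_N.+1) : pm_step c (n + j) =
    if adj G v t && (j == k :> nat) then ncode (bitmask A + 2 ^ k) (2 * k) k else c.
  have jN : j <= N by rewrite -ltnS.
  by rewrite pm_step_close // kP //; case: eqP => [->|_]; rewrite ?andbF.
case: ifP => vt; last by apply: big_pred0 => j; rewrite stepE vt eqxx.
have kN' : k < N.+1 by [].
have ck : ncode (bitmask A + 2 ^ k) (2 * k) k != c.
  apply/eqP => /(congr1 (fun c => c %/ B %/ B)); rewrite /c.
  rewrite !ncode_div ?sB ?vB //; first by have := expn_gt0 2 k; lia.
    by rewrite (leq_ltn_trans kN) // ltnS.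
  by rewrite ltnS (@leq_trans (2 * N)) ?leq_mul2l ?kN ?orbT // /n mul2n.
rewrite (big_pred1 (Ordinal kN')) => [|j]; last first.
  by rewrite /= stepE vt /= -val_eqE /=; case: (j == k :> nat); rewrite ?ck ?eqxx.
have rk := ReachStep rc (_ : n + k < K); rewrite -/(P _) stepE vt eqxx /=.
have := stepE (Ordinal kN'); rewrite vt eqxx /= => stepk.
have {}rk : reach c0 K pm_step (ncode (bitmask A + 2 ^ k) (2 * k) k).
  by rewrite -stepk; apply: ReachStep => //; rewrite /K ltn_add2l.
have pre : prefix_in A k by rewrite kP // eqxx.
have [[AT kE ->]|[i [ki iA low codeE]]] := close_code kN pre.
  rewrite /P npaths_term; have -> : rest A v t :\: [set v; t] = set0.
    by apply/setP => u; rewrite !inE AT inE /=; case: eqP; case: eqP.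
  by rewrite num_matchings0.
rewrite codeE in rk *; rewrite IH ?cardU ?pair_fst_of ?setU11 //.
  by rewrite (rest_close vs sA vA iA).
by rewrite -mate_fst_of eq_sym mate_neq.
Qed.

Lemma pm_start_correct : P c0 = num_perfect_matchings G.
Proof.
case: (posnP N) => [N0|N_gt0].
  rewrite (pm_start0 N0) /P npaths_term -num_matchingsT -[LHS](num_matchings0 G).
  congr num_matchings; apply/setP => -[u u_lt]; exfalso.
  by move: u_lt; rewrite N0.
pose o := Ordinal N_gt0.
have cE := pcode_start (o := o) erefl.
rewrite -cE (pm_count_correct (m := N.+1)) ?pair_fst_of ?set11 //.
- rewrite -num_matchingsT; congr num_matchings; apply/setP => u; rewrite !inE.
  by rewrite -[o in X in ~~ X](pair_fst_of o) pair_eq mate_fst_of; case: eqP; case: eqP.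
- by rewrite ltnS leq_subr.
- by rewrite cE; apply: Reach0.
Qed.

Lemma run_count_matchings (R : realDomainType) (W := pm_bound.+1 * ((n + N.+2) * b)) :
  run b count_matchings (graph_input R G) W (fun s => output s 0 = num_perfect_matchings G).
Proof.
have KW : (n + N.+2) * b = K.+1 * b by rewrite /K addnS.
set s := graph_input R G.
have b_gt0 : 0 < b by [].
have n_lt : n < 2 ^ b by apply: ltn_trans n_lt_pow (pow_lt _); lia.
have leW1 : n.+2 * b <= W.
  rewrite /W [leqRHS]mulSn; apply: leq_trans (leq_addr _ _).
  by rewrite leq_mul2r -addn2 leq_add2l orbT.
have bW : b <= W by apply: leq_trans leW1; rewrite mulSn leq_addr.
have K_gt0 : 0 < K by rewrite /K addnS.
have K_lt : K < 2 ^ b.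
  by apply: leq_ltn_trans pm_labels_pow; rewrite expnS leq_pmulr // expn_gt0 K_gt0.
have n_even : n %% 2 = 0 by rewrite /n -muln2 modnMl.
apply: run_if => // [_|]; last by rewrite /cval [nval _ _]/= n_even.
apply: run_seq; apply: (run_powers b_gt0 (n := n)) => //.
  by rewrite /b mulnS leq_addr.
move=> s1 un1 pow1.
have T1 : pm_tables s1 by split=> // [|k]; rewrite un1.1.
have TT s' : tables s1 s' -> pm_tables s' by apply: pm_tables_tables.
have nxv s' : tables s1 s' -> reach c0 K pm_step (nmem s' vC 0) -> nmem s' vW 0 < K ->
    nval s' pm_next = pm_step (nmem s' vC 0) (nmem s' vW 0).
  by move=> tb _; apply: pm_next_val (TT s' tb).
have half : n %/ 2 = N by rewrite /n -muln2 mulnK.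
have kxv s' : tables s1 s' -> nval s' pm_labels = K.
  by case/TT => h0 _ _; rewrite /= h0 half addn1 -addnS.
have ixv s' : tables s1 s' -> nval s' pm_begin = c0.
  by case/TT => h0 _ _; rewrite /= h0 addn1.
have txv s' : tables s1 s' -> nval s' pm_end = pm_term.
  case/TT => h0 _ h3; rewrite /= h0 half (addn1 n) (addn1 N) h3 ?ltnS ?N_le_n //.
have lev c w (_ : reach c0 K pm_step c) := @pm_level c w.
apply: run_seq; rewrite /W KW; apply: (run_explore b_gt0 nxv kxv ixv lev pm_reach_lt
  pm_reach_card pm_bound_lt K_lt) => //.
  by move=> x; rewrite un1.1.
move=> s2 q un2 [[lq qq] uq rq cq0 sq] cq.
have tab2 : tables s1 s2 by apply: tables_unchanged un2 _.
apply: run_seq; apply: (run_count_paths (L := N.+1) b_gt0 nxv kxv txv lev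
  (fun c _ => bitcount_le N.+1 _) pm_step_term pm_reach_lt pm_bound_lt K_lt
  (pm_reach_card uq rq) uq rq cq sq tab2 lq qq K_gt0 pm_labels_pow) => //.
move=> s3 un3 vals; apply: run_bounded => bs3.
have tab3 : tables s1 s3 by apply: tables_unchanged un3 _.
apply: run_nset => //; [by move: bW; rewrite /W KW|exact: bs3|].
transitivity (nmem s3 aVal (nval s3 pm_begin)) => //.
by rewrite (ixv _ tab3) vals // -pm_start_correct.
Qed.

End Pairs.

Lemma exec_count_matchings_odd (R : realDomainType) (n : nat) (G : graph n) : odd n ->
  exists s t, [/\ exec count_matchings (graph_input R G) s t,
    t <= csize count_matchings * bitlen n & output s 0 = num_perfect_matchings G].
Proof.
move=> on.
have b_gt0 : 0 < bitlen n by [].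
have bnd : bounded (bitlen n) (graph_input R G).
  by move=> a i; apply: graph_cells_bounded => //; apply: bitlen_gt.
suff /(_ bnd)[s [t [ex le _ out]]] : run (bitlen n) count_matchings (graph_input R G)
    (bitlen n) (fun s => output s 0 = num_perfect_matchings G) by exists s, t.
apply: run_if => // [|_]; first by rewrite /cval /= modn2 on.
by apply: run_skip => //; rewrite num_perfect_matchings_odd.
Qed.

Lemma exec_count_matchings_even (R : realDomainType) (N : nat) (G : graph N.*2) :
  exists s t, [/\ exec count_matchings (graph_input R G) s t,
    t <= csize count_matchings *
      ((pm_bound G).+1 * ((N.*2 + N.+2) * (N.*2.+2 * N.*2.+3))) &
    output s 0 = num_perfect_matchings G].
Proof.
have bnd : bounded (N.*2.+2 * N.*2.+3) (graph_input R G).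
  move=> a i; apply: graph_cells_bounded => //.
  by apply: leq_trans (ltn_expl _ (ltnSn 1)) _; rewrite leq_exp2l // !mulSn; lia.
by have [s [t [ex le _ out]]] := run_count_matchings bnd; exists s, t.
Qed.

(** * Running times *)

Local Open Scope ring_scope.

Lemma adj_sym (n : nat) (G : graph n) : symmetric (adj G).
Proof. by move=> u v; rewrite /adj setUC. Qed.

Lemma adj_irr (n : nat) (G : graph n) : irreflexive (adj G).
Proof. by move=> v; apply/negP => /adj_neq; rewrite eqxx. Qed.

Lemma nbhd_le_deg (n : nat) (G : graph n) v : (#|nbhd (adj G) v| <= deg G v)%N.
Proof.
rewrite -(@card_in_imset _ _ (fun u => [set v; u]) (nbhd (adj G) v)).
  apply: subset_leq_card; apply/subsetP => _ /imsetP[u uv ->].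
  by rewrite !inE eqxx andbT; move: uv; rewrite inE.
move=> u w; rewrite !inE => vu _ /setP/(_ u).
by rewrite !inE eqxx orbT [u == v]eq_sym (negPf (adj_neq vu)) => /esym/eqP.
Qed.

Lemma sum_nbhd_le (R : realType) (n : nat) (G : graph n) (x : R) :
  avg_degree G R <= x -> ((\sum_v #|nbhd (adj G) v|)%N%:R <= x * n%:R).
Proof.
move=> avg; apply: (@le_trans _ _ (\sum_v deg G v)%N%:R).
  by rewrite ler_nat leq_sum // => v _; apply: nbhd_le_deg.
case: (posnP n) => [n0|n_gt0]; last by rewrite -ler_pdivrMr // ltr0n.
rewrite big1 ?n0 ?mulr0 // => -[v v_lt]; exfalso.
by move: v_lt; rewrite n0.
Qed.

Lemma pow2_ge1 (R : realType) (d : nat) (x : R) : 0 <= x -> 1 <= 2 `^ ((1 - eps_nat R d) * x).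
Proof.
move=> x_ge0; rewrite -[leLHS](powRr0 2); apply: ler_powR; first by rewrite ler1n.
by rewrite mulr_ge0 // subr_ge0 eps_nat_le1.
Qed.

(** The counting bound wants a positive integer as degree bound; the saving depends on the real
    bound only through it. *)
Definition degree_bound (R : realType) (x : R) : nat := (Num.truncn x).+1.

Lemma le_degree_bound (R : realType) (x : R) (n s : nat) : 1 <= x ->
  s%:R <= x * n%:R -> (s <= degree_bound x * n)%N.
Proof.
move=> x_ge1 sx; rewrite -(ler_nat R) natrM; apply: le_trans sx _.
rewrite ler_wpM2r // ltW // /degree_bound.
by rewrite -truncn_lt_nat // (le_trans ler01).
Qed.

Lemma contracted_sym (N : nat) (G : graph N.*2) : symmetric (contracted G).
Proof.
have half i j : contracted G i j -> contracted G j i.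
  move=> /andP[ij /existsP[u /existsP[w /and3P[ui wj uw]]]].
  rewrite /contracted eq_sym ij; apply/existsP; exists w; apply/existsP; exists u.
  by rewrite wj ui adj_sym.
by move=> i j; apply/idP/idP; apply: half.
Qed.

Lemma contracted_irr (N : nat) (G : graph N.*2) : irreflexive (contracted G).
Proof. by move=> i; rewrite /contracted eqxx. Qed.

(** A neighbour of pair [i] is the pair of a neighbour of one of its two vertices. With half as many
    vertices, the average degree at most doubles. *)
Lemma sum_contracted_le (N : nat) (G : graph N.*2) :
  (\sum_i #|nbhd (contracted G) i| <= \sum_v #|nbhd (adj G) v|)%N.
Proof.
rewrite [leqRHS](partition_big (@pair_of N) predT) //=; apply: leq_sum => i _.
apply: (@leq_trans #|\bigcup_(v | pair_of v == i) (@pair_of N @: nbhd (adj G) v)|).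
  apply: subset_leq_card; apply/subsetP => j; rewrite inE => /andP[_ /existsP[u /existsP[w]]].
  move=> /and3P[ui /eqP wj uw]; apply/bigcupP; exists u => //.
  by apply/imsetP; exists w; rewrite ?inE.
elim/big_rec2: _ => [|v m X _ IH]; first by rewrite cards0.
by rewrite (leq_trans (leq_card_setU _ _)) // leq_add // leq_imset_card.
Qed.

Lemma tsp_time (R : realType) (n : nat) (G : graph n) (X : R) :
  1 <= X -> #|traced_sets (adj G) 0|%:R <= X ->
  ((tsp_bound G).+1 * (n.+2 * (2 * n + 3)))%N%:R <=
  (45 * weighted_graph_size n ^ 3)%N%:R * X.
Proof.
move=> X1 FX; set S := weighted_graph_size n.
have [S1 Sn] : (0 < S)%N /\ (n <= S)%N.
  have : (n <= n * n)%N by case: (n) => // m; rewrite leq_pmull.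
  by rewrite /S /weighted_graph_size /graph_size /bitlen; lia.
have bnd : (tsp_bound G).+1%:R <= n.+2%:R * X.
  rewrite /tsp_bound -[in leLHS]addn2 natrD natrM -[n.+2]addn2 natrD mulrDl lerD //.
    by rewrite mulrC ler_wpM2l ?ler0n.
  by rewrite ler_peMr ?ler0n.
rewrite natrM; apply: le_trans (ler_wpM2r _ bnd) _; first by [].
rewrite mulrAC ler_wpM2r ?(le_trans ler01) // -natrM ler_nat.
(* The factors 3, 3 and 5 multiply to 45. *)
have h1 : (n.+2 <= 3 * S)%N by lia.
have h2 : (2 * n + 3 <= 5 * S)%N by lia.
apply: leq_trans (leq_mul h1 (leq_mul h1 h2)) _.
by rewrite !expnS expn0; lia.
Qed.

Lemma matchings_time (R : realType) (N : nat) (G : graph N.*2) (X : R) :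
  1 <= X -> (forall s : 'I_N, #|traced_sets (contracted G) s|%:R <= X) ->
  ((pm_bound G).+1 * ((N.*2 + N.+2) * (N.*2.+2 * N.*2.+3)))%N%:R <=
  (144 * graph_size N.*2 ^ 5)%N%:R * X.
Proof.
move=> X1 FX; set S := graph_size _.
have [S1 [SN SNN]] : (0 < S)%N /\ (N.*2 <= S)%N /\ (N * N.*2 <= S * S)%N.
  have h : (N.*2 <= S)%N.
    have : (N.*2 <= N.*2 * N.*2)%N by case: (N.*2) => // m; rewrite leq_pmull.
    by rewrite /S /graph_size; lia.
  split; first by rewrite /S /graph_size /bitlen addSn.
  by split=> //; apply: leq_mul => //; apply: leq_trans h; rewrite -addnn leq_addr.
have bnd : (pm_bound G).+1%:R <= (3 * (S * S))%N%:R * X.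
  apply: (@le_trans _ _ ((N * N.*2 + 2)%N%:R * X)); last first.
    rewrite ler_wpM2r ?(le_trans ler01) // ler_nat.
    have S2 : (0 < S * S)%N by rewrite muln_gt0 S1.
    by move: S2 SNN; lia.
  rewrite /pm_bound -[in leLHS]addn2 natrD [in leRHS]natrD mulrDl lerD //;
    last by rewrite ler_peMr ?ler0n.
  rewrite natr_sum; apply: (@le_trans _ _ (\sum_(s < N) N.*2%:R * X)).
    by apply: ler_sum => s _; rewrite natrM mulrC ler_wpM2l.
  by rewrite sumr_const card_ord -[leLHS]mulr_natl natrM mulrA.
rewrite natrM; apply: le_trans (ler_wpM2r _ bnd) _; first by [].
rewrite mulrAC ler_wpM2r ?(le_trans ler01) // -natrM ler_nat.
have h1 : (N.*2 + N.+2 <= 4 * S)%N by lia.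
have h2 : (N.*2.+2 <= 3 * S)%N by lia.
have h3 : (N.*2.+3 <= 4 * S)%N by lia.
apply: leq_trans (leq_mul (leqnn _) (leq_mul h1 (leq_mul h2 h3))) _.
by rewrite !expnS expn0; lia.
Qed.

Lemma solves_within_exec (R : realType) prog (s0 : state R) (A B W : nat) (X : R) Q :
  (exists s t, [/\ exec prog s0 s t, (t <= A * W)%N & Q s]) ->
  W%:R <= B%:R * X -> solves_within prog s0 ((A * B)%N%:R * X) Q.
Proof.
move=> [s [t [ex le_t Qs]]] leW; exists s, t; split=> //.
apply: (@le_trans _ _ (A * W)%N%:R); first by rewrite ler_nat.
by rewrite natrM [in leRHS]natrM -mulrA ler_wpM2l ?ler0n.
Qed.

Unset Implicit Arguments.

Theorem theorem1p2 (R : realType) :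
  exists eps : R -> R,
    [/\ forall delta : R, 1 <= delta -> 0 < eps delta,
        forall delta : R, 1 <= delta ->
          exists (prog : cmd) (C k : nat),
            forall (n : nat) (G : graph n) (c : {set 'I_n} -> R),
              (forall e, e \in edges G -> 0 <= c e) ->
              avg_degree G R <= delta ->
              solves_within prog (weighted_graph_input G c)
                (Ostar_factor R C k (weighted_graph_size n)
                 * 2 `^ ((1 - eps delta) * n%:R))
                (outputs_smallest_ham_cycle G c)
      & forall d : R, 1 <= 2 * d ->
          exists (prog : cmd) (C k : nat),
            forall (n : nat) (G : graph n),
              avg_degree G R <= d ->
              solves_within prog (graph_input R G)
                (Ostar_factor R C k (graph_size n)
                 * 2 `^ ((1 - eps (2 * d)) * n%:R / 2))
                (fun s => output s 0 = num_perfect_matchings G)].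
Proof.
exists (fun x => eps_nat R (degree_bound x)); split=> [x _|x x_ge1|d d_ge].
- exact: eps_nat_gt0.
- exists tsp, (csize tsp * 45)%N, 3 => n G c _ avg.
  rewrite /Ostar_factor -mulnA; apply: (solves_within_exec (exec_tsp G c)).
  apply: tsp_time; first exact: pow2_ge1.
  apply: (@card_traced _ _ _ 0 _ _ _ (@adj_sym n G) (@adj_irr n G)) => [//||A].
    by apply: le_degree_bound => //; apply: sum_nbhd_le.
  by rewrite inE => /asboolP.
exists count_matchings, (csize count_matchings * 144)%N, 5 => n G avg.
rewrite /Ostar_factor -mulnA.
have X1 : 1 <= 2 `^ ((1 - eps_nat R (degree_bound (2 * d))) * n%:R / 2).
  by rewrite -mulrA pow2_ge1 // divr_ge0.
(* For odd [n] the program stops after the parity test, and the exponential factor is only needed to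
   be at least 1. *)
have [on|en] := boolP (odd n).
  apply: (solves_within_exec (exec_count_matchings_odd R G on)).
  apply: (@le_trans _ _ (144 * graph_size n ^ 5)%N%:R); last by rewrite ler_peMr ?ler0n.
  rewrite ler_nat; have : (bitlen n <= graph_size n)%N by rewrite leq_addr.
  by move/leq_trans; apply; rewrite expnS mulnCA leq_pmulr // muln_gt0 expn_gt0.
have nE : n = n./2.*2 by rewrite -[LHS]odd_double_half (negPf en).
move: (n./2) nE => N nE; subst n.
apply: (solves_within_exec (exec_count_matchings_even R G)).
apply: matchings_time => // s.
have -> : (1 - eps_nat R (degree_bound (2 * d))) * N.*2%:R / 2 =
    (1 - eps_nat R (degree_bound (2 * d))) * N%:R.
  by rewrite -muln2 natrM; field.
(* The contracted graph has [N] vertices and degree sum at most [d * (2 * N) = (2 * d) * N]; hence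
   the index [2 * d] and the exponent [n / 2]. *)
apply: (@card_traced _ _ _ s _ _ _ (@contracted_sym N G) (@contracted_irr N G)) => [//||A].
  apply: leq_trans (sum_contracted_le G) _.
  apply: le_degree_bound => //; apply: le_trans (sum_nbhd_le avg) _.
  by rewrite -muln2 natrM mulrA (mulrC 2) mulrAC.
by rewrite inE => /asboolP.
Qed.
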